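(* Let $\varepsilon>0$, $\alpha\in\mathbb{R}$, $\Delta t>0$, and suppose that $V$ and $b$ satisfy assumptions (A) and (B) of the context. Let $\widehat{\Lambda}_{\Delta t}$ be the spectral radius of $\widehat{P}^U_{\Delta t}$. Then there exist a measure $\widehat{\mu}^\star_{U,\Delta t}\in\mathcal{P}(\mathbb{R}^d)$ with $\widehat{\Lambda}_{\Delta t}=(\widehat{\mu}^\star_{U,\Delta t},\widehat{P}^U_{\Delta t}\mathbf{1})$ and a constant $\widehat{\beta}\in(0,1)$ with the following property: for any initial measure $\mu\in\mathcal{P}(\mathbb{R}^d)$, there is a constant $C_\mu$ for which $$\left|(\Phi_{k,\Delta t}\mu,\varphi)-(\widehat{\mu}^\star_{U,\Delta t},\varphi)\right|\le C_\mu\,\widehat{\beta}^k\,\|\varphi\|_{L^\infty}$$ for all $\varphi\in L^\infty(\mathbb{R}^d)$ and all integers $k\ge1$. Moreover, for any such $\mu$, $$\log\widehat{\Lambda}_{\Delta t}=\lim_{k\to\infty}\frac1k\log\mathbb{E}\left[\exp\left(\Delta t\sum_{j=0}^{k-1}U(\widehat{X}_j)\right)\,\bigg|\,\widehat{X}_0\sim\mu\right].$$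
   Context: Fix $d\ge1$, $\varepsilon>0$, $\alpha\in\mathbb{R}$ and a time step $\Delta t>0$. Notation: $|\cdot|$ is the Euclidean norm on $\mathbb{R}^d$ and $\|\cdot\|$ the induced operator norm on $d\times d$ matrices; $D^2V$ is the Hessian of $V$; $\mathcal{P}(\mathbb{R}^d)$ is the set of probability measures on $\mathbb{R}^d$; $(\mu,\varphi)=\int_{\mathbb{R}^d}\varphi\,\mathrm{d}\mu$; $\mathbf{1}$ is the constant function equal to $1$. Assumption (A) on $V$: (1) $V\in C^\infty(\mathbb{R}^d)$ is real-valued; (2) there exists a positive-definite matrix $H_0$ such that $\langle x,H_0\nabla V(x)\rangle\ge|x|^2$ whenever $|x|$ is large enough; (3) $\|D^2V(x)\|=o(|\nabla V(x)|)$ as $|x|\to\infty$. Assumption (B) on $b$: (1) $b\in(C^\infty(\mathbb{R}^d))^d$; (2) $\|b\|_{C^1(\mathbb{R}^d)}<\infty$; (3) $\langle b,\nabla V\rangle\le c|\nabla V|^2$ on $\mathbb{R}^d$ for some constant $0<c<\tfrac12$. Define $$U=-\frac1{4\varepsilon}|\nabla V|^2+\frac1{2\varepsilon}\langle b,\nabla V\rangle-\frac{\alpha(1-\alpha)}{\varepsilon}|b|^2+\frac12\Delta V-\alpha(\nabla\cdot b).$$ The Euler--Maruyama scheme is the Markov chain $$\widehat{X}_{n+1}=\widehat{X}_n+(1-2\alpha)b(\widehat{X}_n)\Delta t+\sqrt{2\varepsilon\Delta t}\,G_n,\qquad\widehat{X}_0\sim\mu,$$ where the $G_n$ are independent $d$-dimensional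 standard Gaussian random variables, independent of $\widehat X_0$. Define $$\widehat{P}_{\Delta t}\varphi(x)=\mathbb{E}[\varphi(\widehat{X}_{n+1})\,|\,\widehat{X}_n=x],\qquad\widehat{P}^U_{\Delta t}\varphi(x)=\exp(U(x)\Delta t)\,\widehat{P}_{\Delta t}\varphi(x).$$ The operator $\widehat{P}^U_{\Delta t}$ is regarded as a bounded operator on $L^\infty(\mathbb{R}^d)$ for the purpose of defining its spectral radius. For $\mu\in\mathcal{P}(\mathbb{R}^d)$, an integer $k\ge 1$ and bounded measurable $\varphi$, the probability measure $\Phi_{k,\Delta t}\mu$ is defined by $$(\Phi_{k,\Delta t}\mu,\varphi)=\frac{(\mu,(\widehat{P}^U_{\Delta t})^k\varphi)}{(\mu,(\widehat{P}^U_{\Delta t})^k\mathbf{1})}=\frac{\mathbb{E}\left[\varphi(\widehat{X}_k)\exp\left(\Delta t\sum_{j=0}^{k-1}U(\widehat{X}_j)\right)\Big|\widehat{X}_0\sim\mu\right]}{\mathbb{E}\left[\exp\left(\Delta t\sum_{j=0}^{k-1}U(\widehat{X}_j)\right)\Big|\widehat{X}_0\sim\mu\right]}.$$ *)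

(* Defs.v *)
From HB Require Import structures.
From mathcomp Require Import all_boot all_order all_algebra.
From mathcomp Require Import all_classical all_reals all_analysis.
From mathcomp Require Import measurable_realfun complex.
Set Implicit Arguments.
Unset Strict Implicit.
Unset Printing Implicit Defensive.
Import Order.TTheory GRing.Theory Num.Theory.
Import numFieldNormedType.Exports.
Local Open Scope classical_set_scope.
Local Open Scope ring_scope.

Definition borel_display : measure_display.
Proof. exact: default_measure_display. Qed.

Section borel_matrix.
Context {R : realType} (m n : nat).

Definition borel_mx : set (set 'M[R]_(m, n)) := <<s @open 'M[R]_(m, n) >>.

HB.instance Definition _ := @isMeasurable.Build borel_display 'M[R]_(m, n)
  borel_mx (@sigma_algebra0 _ _ _) (@sigma_algebraC _ _)
  (@sigma_algebra_bigcup _ _ _).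

End borel_matrix.

Section borel_matrix_measurability.
Context {R : realType}.

Lemma measurable_coord m n (i : 'I_m) (j : 'I_n) :
  measurable_fun [set: 'M[R]_(m, n)] (fun x : 'M[R]_(m, n) => x i j).
Proof.
apply: (measurability _ (RGenOpens.measurableE R)).
move=> _ [_ [x [y ->]] <-]; rewrite setTI; apply: sub_sigma_algebra.
apply: open_comp; last exact: interval_open.
by move=> M _; exact: coord_continuous.
Qed.

Lemma measurable_mx d (T : measurableType d) m n (f : T -> 'M[R]_(m, n)) :
  (forall i j, measurable_fun [set: T] (fun t => f t i j)) ->
  measurable_fun [set: T] f.
Proof.
move=> mf; apply: (measurability (@open 'M[R]_(m, n))) => //.
move=> _ [U oU <-]; rewrite setTI.
pose box (q : 'M[rat]_(m, n) * rat) : set 'M[R]_(m, n) :=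
  [set x | forall i j, `|ratr (q.1 i j) - x i j| < ratr q.2].
have mbox q : measurable (f @^-1` box q).
  have -> : f @^-1` box q = \bigcap_(i in [set: 'I_m]) \bigcap_(j in [set: 'I_n])
      ((fun t => f t i j) @^-1` [set y : R | `|ratr (q.1 i j) - y| < ratr q.2]).
    by apply/seteqP; split => [t /= bt i _ j _|t bt i j]; [exact: bt|exact: bt].
  apply: fin_bigcap_measurable => // i _; apply: fin_bigcap_measurable => // j _.
  rewrite -[X in measurable X]setTI; apply: mf => //.
  exact: (open_measurable (@ball_open _ R^o (ratr (q.1 i j)) (ratr q.2))).
suff -> : f @^-1` U =
    \bigcup_(q in [set q | box q `<=` U]) (f @^-1` box q).
  rewrite bigcup_mkcond; apply: countable_bigcupT_measurable => [|q].
    exact: countableP.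
  by case: ifP.
apply/seteqP; split => [t Ut|t [q /= qU] /qU//].
have /nbhs_ballP[e /= e0 eU] : nbhs (f t) U by exact: open_nbhs_nbhs.
have [r /itvP rP] : exists r : rat, ratr r \in `]0, (e / 2)[.
  by apply: rat_in_itvoo; rewrite divr_gt0.
have qP i j : {q : rat | `|ratr q - f t i j| < ratr r}.
  apply: cid; have [q /itvP qP] : exists q : rat,
      ratr q \in `](f t i j), (f t i j + ratr r)[.
    by apply: rat_in_itvoo; rewrite ltrDl rP.
  by exists q; rewrite gtr0_norm ?subr_gt0 ?qP// ltrBlDl qP.
exists (\matrix_(i, j) sval (qP i j), r) => [x bx|i j] /=; last first.
  by rewrite mxE; exact: svalP (qP i j).
apply: eU; split=> // i j; rewrite /ball/=.
have := bx i j; rewrite /= mxE => xq; have qf := svalP (qP i j).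
rewrite (splitr e) (le_lt_trans (ler_distD (ratr (sval (qP i j))) _ _))//.
rewrite ltrD//; first by rewrite distrC (lt_trans qf)// rP.
by rewrite (lt_trans xq)// rP.
Qed.

End borel_matrix_measurability.

Section product_measure_rV.
Context {R : realType}.
Local Open Scope ereal_scope.

Definition cons_rV n (p : measurableTypeR R * 'rV[R]_n) : 'rV[R]_n.+1 :=
  row_mx (const_mx p.1 : 'rV_1) p.2.

Definition uncons_rV n (x : 'rV[R]_n.+1) : measurableTypeR R * 'rV[R]_n :=
  (x ord0 ord0, \row_j x ord0 (lift ord0 j)).

Lemma cons_rVK n : cancel (@cons_rV n) (@uncons_rV n).
Proof.
move=> [a x]; rewrite /uncons_rV /cons_rV/=; congr pair.
  transitivity (row_mx (const_mx a : 'rV_1) x ord0 (lshift n ord0)).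
    by congr (fun_of_matrix _ _ _); apply: val_inj.
  by rewrite row_mxEl mxE.
apply/rowP => j; rewrite [LHS]mxE.
transitivity (row_mx (const_mx a : 'rV_1) x ord0 (rshift 1 j)).
  by congr (fun_of_matrix _ _ _); apply: val_inj.
by rewrite row_mxEr.
Qed.

Lemma measurable_cons_rV n : measurable_fun [set: measurableTypeR R * 'rV[R]_n] (@cons_rV n).
Proof.
apply: measurable_mx => i j; rewrite /cons_rV.
case: (split_ordP (j : 'I_(1 + n))) => k ->.
  rewrite [X in measurable_fun _ X](_ : _ = fst) //.
  apply/funext => p; transitivity ((const_mx p.1 : 'rV_1) i k).
    exact: row_mxEl.
  by rewrite mxE.
rewrite [X in measurable_fun _ X](_ : _ = (fun x : 'rV_n => x i k) \o snd).
  exact: (measurableT_comp (measurable_coord i k) measurable_snd).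
by apply/funext => p; exact: row_mxEr.
Qed.

Lemma measurable_uncons_rV n :
  measurable_fun [set: 'rV[R]_n.+1] (@uncons_rV n).
Proof.
apply: measurable_fun_pair; first exact: measurable_coord.
apply: measurable_mx => i j.
under eq_fun do rewrite mxE.
exact: measurable_coord.
Qed.

HB.instance Definition _ n :=
  @isMeasurableFun.Build _ _ _ _ (@cons_rV n) (@measurable_cons_rV n).

Section cons_measure.
Variables (m : {sigma_finite_measure set (measurableTypeR R) -> \bar R}) (n : nat).
Variable mu : {sigma_finite_measure set 'rV[R]_n -> \bar R}.

Definition cons_measure : set 'rV[R]_n.+1 -> \bar R :=
  pushforward (m \x mu) (@cons_rV n).

Let cons_measure0 : cons_measure set0 = 0.
Proof. exact: measure0. Qed.

Let cons_measure_ge0 A : 0 <= cons_measure A.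
Proof. exact: measure_ge0. Qed.

Let cons_measure_sigma_additive : semi_sigma_additive cons_measure.
Proof. exact: measure_semi_sigma_additive. Qed.

HB.instance Definition _ := isMeasure.Build _ _ _ cons_measure
  cons_measure0 cons_measure_ge0 cons_measure_sigma_additive.

Let cons_measure_sigma_finite : sigma_finite setT cons_measure.
Proof.
have /sigma_finiteP[F [FT Fnd Foo]] := sigma_finiteT m.
have /sigma_finiteP[G [GT Gnd Goo]] := sigma_finiteT mu.
exists (fun i => @uncons_rV n @^-1` (F i `*` G i)).
  rewrite -preimage_bigcup; apply/esym/seteqP; split => // x _ /=.
  have [i _ Fi] : (\bigcup_i F i) (uncons_rV x).1 by rewrite -FT.
  have [j _ Gj] : (\bigcup_i G i) (uncons_rV x).2 by rewrite -GT.
  exists (maxn i j) => //; split.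
    by move: Fi; exact/subsetPset/Fnd/leq_maxl.
  by move: Gj; exact/subsetPset/Gnd/leq_maxr.
move=> i; have [mFi Fioo] := Foo i; have [mGi Gioo] := Goo i; split.
  rewrite -[X in measurable X]setTI; apply: measurable_uncons_rV => //.
  exact: measurableX.
rewrite /cons_measure /pushforward -comp_preimage.
rewrite (_ : _ \o _ = id); last by apply/funext => x; exact: cons_rVK.
by rewrite preimage_id product_measure1E// lte_mul_pinfty// ge0_fin_numE.
Qed.

HB.instance Definition _ := Measure_isSigmaFinite.Build _ _ _ cons_measure
  cons_measure_sigma_finite.

End cons_measure.

Fixpoint product_rV (m : {sigma_finite_measure set (measurableTypeR R) -> \bar R})
    n :
    {sigma_finite_measure set 'rV[R]_n -> \bar R} :=
  if n is n'.+1 then cons_measure m (product_rV m n')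
  else \d_(0%R : 'rV[R]_0).

Lemma product_rV_box (m : {sigma_finite_measure set (measurableTypeR R) -> \bar R}) n
    (A : 'I_n -> set (measurableTypeR R)) : (forall i, measurable (A i)) ->
  product_rV m n [set x | forall i, A i (x ord0 i)] = \prod_(i < n) m (A i).
Proof.
elim: n A => [|n IHn] A mA.
  rewrite big_ord0 [LHS]diracE mem_set//=.
  by case.
have mB : measurable [set x : 'rV[R]_n | forall i, A (lift ord0 i) (x ord0 i)].
  rewrite (_ : [set _ | _] = \bigcap_(i in [set: 'I_n])
      ((fun x : 'rV[R]_n => x ord0 i) @^-1` A (lift ord0 i))).
    apply: fin_bigcap_measurable => // i _.
    rewrite -[X in measurable X]setTI.
    exact: (measurable_coord ord0 i measurableT (mA _)).
  by apply/seteqP; split => [x /= xA i _|x xA i]; exact: xA.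
rewrite big_ord_recl -(IHn (fun i => A (lift ord0 i)))//=.
rewrite /cons_measure /pushforward -product_measure1E//.
congr (product_measure1 _ _ _); apply/seteqP; split => [p /= pA|p [/= p1 p2] i].
  rewrite -[p]cons_rVK /=; split; first exact: pA.
  by move=> i; rewrite mxE; exact: pA.
rewrite -[p]cons_rVK in p1 p2.
have [->//|i0] := eqVneq i ord0.
have /= [j ->] : exists j, i = lift ord0 j.
  by case: (unliftP ord0 i) i0 => [j ->|->]; [exists j|rewrite eqxx].
by have := p2 j; rewrite mxE.
Qed.

Definition lebesgue_rV n := product_rV (@lebesgue_measure R) n.

Definition gaussian_rV n := product_rV (normal_prob (0 : R)%R (1 : R)%R) n.

End product_measure_rV.

Section euclidean.
Context {R : realType} (d : nat).
Implicit Types (x y : 'rV[R]_d) (M : 'M[R]_d).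

Definition dotv x y : R := \sum_(i < d) x ord0 i * y ord0 i.

(* The library norm `|x| on 'rV[R]_d is the sup norm. *)
Definition enorm x : R := Num.sqrt (dotv x x).

(* Vectors are rows; [mulv M x] is the column product M x. *)
Definition mulv M x : 'rV[R]_d := x *m M^T.

Definition opnorm M : R :=
  sup [set enorm (mulv M x) | x in [set x | enorm x <= 1]].

Definition posdef M : Prop :=
  M^T = M /\ forall x, x != 0 -> 0 < dotv x (mulv M x).

End euclidean.

Section differential_operators.
Context {R : realType} (d : nat).
Implicit Types (f V : 'rV[R]_d -> R) (b : 'rV[R]_d -> 'rV[R]_d).

Definition partial (i : 'I_d) f : 'rV[R]_d -> R :=
  fun x => 'D_(delta_mx ord0 i) f x.

Definition iter_partial (s : seq 'I_d) f : 'rV[R]_d -> R := foldr partial f s.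

Definition smooth f : Prop :=
  forall s : seq 'I_d, continuous (iter_partial s f) /\
    forall (i : 'I_d) x, derivable (iter_partial s f) x (delta_mx ord0 i).

Definition component b (i : 'I_d) : 'rV[R]_d -> R := fun x => b x ord0 i.

Definition grad f x : 'rV[R]_d := \row_i partial i f x.

Definition hessian f x : 'M[R]_d := \matrix_(i, j) partial i (partial j f) x.

Definition laplacian f x : R := \tr (hessian f x).

Definition jac b x : 'M[R]_d := \matrix_(i, j) partial j (component b i) x.

Definition divergence b x : R := \tr (jac b x).

Definition C1norm b : \bar R :=
  (ereal_sup (range (fun x => (enorm (b x))%:E)) +
   ereal_sup (range (fun x => (opnorm (jac b x))%:E)))%E.

Definition assumptionA V : Prop :=
  [/\ smooth V,
      exists2 H0 : 'M[R]_d, posdef H0 &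
        exists r : R, forall x, r <= enorm x ->
          enorm x ^+ 2 <= dotv x (mulv H0 (grad V x)) &
      forall e : R, 0 < e -> exists r : R, forall x, r <= enorm x ->
        opnorm (hessian V x) <= e * enorm (grad V x)].

Definition assumptionB V b : Prop :=
  [/\ forall i, smooth (component b i),
      (C1norm b < +oo)%E &
      exists c : R, 0 < c < 2^-1 /\
        forall x, dotv (b x) (grad V x) <= c * enorm (grad V x) ^+ 2].

End differential_operators.

Section Linfty.
Context {R : realType} (d : nat).
Local Notation E := 'rV[R]_d.

Definition Linfty (phi : E -> R) : Prop := phi \in Lfun (lebesgue_rV d) +oo%E.

Definition Linfty_norm (phi : E -> R) : R :=
  fine ('N[lebesgue_rV d]_+oo[EFin \o phi])%E.

Definition CLinfty (h : E -> R[i]) : Prop :=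
  Linfty (fun x => complex.Re (h x)) /\ Linfty (fun x => complex.Im (h x)).

Definition complexify (T : (E -> R) -> E -> R) (h : E -> R[i]) : E -> R[i] :=
  fun x => (T (fun y => complex.Re (h y)) x +i* T (fun y => complex.Im (h y)) x)%C.

(* [T - z] is bijective on the complexification of L^oo; elements of L^oo are
   represented by functions, equality being Lebesgue-a.e. equality. *)
Definition in_resolvent (T : (E -> R) -> E -> R) (z : R[i]) : Prop :=
  (forall h, CLinfty h ->
     {ae lebesgue_rV d, forall x, complexify T h x - z * h x = 0} ->
     {ae lebesgue_rV d, forall x, h x = 0}) /\
  (forall g, CLinfty g -> exists2 h, CLinfty h &
     {ae lebesgue_rV d, forall x, complexify T h x - z * h x = g x}).

Definition spectrum (T : (E -> R) -> E -> R) : set R[i] :=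
  [set z | ~ in_resolvent T z].

(* [sup] is 0 on sets that are empty or unbounded above; neither occurs for the
   spectrum of a bounded operator. *)
Definition spectral_radius (T : (E -> R) -> E -> R) : R :=
  sup [set Normc.normc z | z in spectrum T].

End Linfty.

Section feynman_kac.
Context {R : realType} (d : nat).
Local Notation E := 'rV[R]_d.
Variables (eps alpha dt : R) (V : E -> R) (b : E -> E).
Implicit Types (x g : E) (phi : E -> R).

Definition potential x : R :=
  - (4 * eps)^-1 * enorm (grad V x) ^+ 2
  + (2 * eps)^-1 * dotv (b x) (grad V x)
  - alpha * (1 - alpha) / eps * enorm (b x) ^+ 2
  + 2^-1 * laplacian V x
  - alpha * divergence b x.

Definition em_step x g : E :=
  x + ((1 - 2 * alpha) * dt) *: b x + Num.sqrt (2 * eps * dt) *: g.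

(* E[phi(X_(n+1)) | X_n = x], the conditional expectation being the one given
   by the transition kernel of the chain. *)
Definition em_semigroup phi x : R :=
  \int[gaussian_rV d]_g phi (em_step x g).

Definition fk_semigroup phi x : R :=
  expR (potential x * dt) * em_semigroup phi x.

Definition pairing (mu : probability E R) phi : R := \int[mu]_x phi x.

(* The pairing (Phi_k mu, phi). *)
Definition fk_flow (k : nat) (mu : probability E R) phi : R :=
  pairing mu (iter k fk_semigroup phi) /
  pairing mu (iter k fk_semigroup (cst 1)).

Fixpoint em_chain (Omega : Type) (X0 : Omega -> E) (G : nat -> Omega -> E)
    (n : nat) : Omega -> E :=
  fun w => if n is n'.+1 then em_step (em_chain X0 G n' w) (G n' w) else X0 w.

Definition fk_weight (Omega : Type) (X : nat -> Omega -> E) (k : nat)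
    (w : Omega) : R :=
  expR (dt * \sum_(j < k) potential (X j w)).

End feynman_kac.

Section probability.
Context d d' {Omega : measurableType d} {T : measurableType d'} {R : realType}.
Variable P : probability Omega R.

Definition has_law (X : Omega -> T) (mu : set T -> \bar R) : Prop :=
  forall A, measurable A -> P (X @^-1` A) = mu A.

Definition mutually_independent (Z : nat -> Omega -> T) : Prop :=
  forall (s : seq nat) (A : nat -> set T), uniq s ->
    (forall i, measurable (A i)) ->
    P (\bigcap_(i in [set` s]) (Z i @^-1` A i)) =
    (\prod_(i <- s) P (Z i @^-1` A i))%E.

End probability.

Section driving_noise.
Context {R : realType} (d : nat) d' {Omega : measurableType d'}.
Variable P : probability Omega R.

Definition em_noise (mu : probability 'rV[R]_d R)
    (X0 : {RV P >-> 'rV[R]_d}) (G : nat -> {RV P >-> 'rV[R]_d}) : Prop :=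
  [/\ has_law P X0 mu,
      forall n, has_law P (G n) (gaussian_rV d) &
      mutually_independent P
        (fun n => if n is n'.+1 then G n' else X0 : Omega -> 'rV[R]_d)].

End driving_noise.

(* Main.v *)
Require Import Defs.
From HB Require Import structures.
From mathcomp Require Import all_boot all_order all_algebra.
From mathcomp Require Import all_classical all_reals all_analysis.
From mathcomp Require Import finmap ess_sup_inf measurable_realfun complex.
From mathcomp Require Import ring lra.
Set Implicit Arguments.
Unset Strict Implicit.
Unset Printing Implicit Defensive.
Import Order.TTheory GRing.Theory Num.Theory.
Import numFieldNormedType.Exports.
Local Open Scope classical_set_scope.
Local Open Scope ring_scope.

(** The operator [Q = fk_semigroup] is a positive kernel operator. The weight
    [exp (dt * U)] tends to 0 at infinity, since [- |grad V|^2 / (4 eps)]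
    dominates [U] and [grad V] grows at least linearly; on bounded sets the
    Gaussian steps make the rows of the kernel comparable to one fixed law
    [nu]. These two facts, [fk_semigroup_confining], are all that is used, and
    they take the place of compactness.

    Eigenvalue ([eigenfunction_exists]). Split [Q = G + a 1_K \otimes nu] with [G]
    positive and [K] a level set of [Q 1] outside which [Q 1 <= e]. The series
    [h = \sum_n z^-(n+1) G^n (a 1_K)] satisfies [Q h = z h] as soon as
    [nu h = 1]. Let [Lam] be the least [z > e] with [nu h <= 1]. Because [Q] is
    smaller than [Lam] off [K], integrability of the series against [nu] makes it
    bounded, and if [nu h < 1] then a small perturbation of [h] is a
    supersolution for some [z < Lam], which contradicts minimality.

    Gap ([harris_contraction], [spectral_gap_exists]). After the Doob transform
    [f |-> Q (h f) / (Lam h)], the function [1 / h] is a Lyapunov function,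
    because [Q 1 / Lam <= gam + C1 h] with [gam < 1]. The contraction argument of
    Hairer and Mattingly, written without dividing by [h], gives
    [|Q^k f / Lam^k - L f * h| <= C be^k |f|] uniformly in space, with [L] a
    positive functional. The measure in the theorem is [L] normalised
    ([functional_measureP], [stationary_measure]), and the bound on the flow is
    the quotient of this estimate for [f] and for the constant 1. The constant
    depends on the initial law [mu] through [mu (h)], which may be arbitrarily
    small.

    Spectral radius ([spectral_radiusE]). The estimate bounds [Q^k] by a multiple
    of [Lam^k], so the Neumann series inverts [Q - z] for [|z| > Lam], while [h]
    is an eigenfunction for [Lam].

    Logarithmic limit. By [feynman_kac] the expectation equals [mu (Q^k 1)], which
    is [Lam^k] times a sequence with a positive limit. *)

(** * Positive functionals on bounded measurable functions *)

Section bounded_measurable.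
Context {R : realType} d {T : measurableType d}.
Implicit Types (f g : T -> R) (F : nat -> T -> R).

Definition bmeas f : Prop :=
  measurable_fun [set: T] f /\ exists M : R, forall x, `|f x| <= M.

Lemma bmeas_cst (c : R) : bmeas (cst c).
Proof. by split; [exact: measurable_cst|exists `|c|]. Qed.

Lemma bmeas_indic (A : set T) : measurable A -> bmeas (\1_A : T -> R).
Proof.
move=> mA; split; first exact: measurable_indic.
by exists 1 => x; rewrite indicE; case: (_ \in _); rewrite ?normr1 ?normr0 ?ler01.
Qed.

Lemma bmeasD f g : bmeas f -> bmeas g -> bmeas (fun x => f x + g x).
Proof.
move=> [mf [M fM]] [mg [N gN]]; split; first exact: measurable_funD.
by exists (M + N) => x; rewrite (le_trans (ler_normD _ _))// lerD.
Qed.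

Lemma bmeasM f g : bmeas f -> bmeas g -> bmeas (fun x => f x * g x).
Proof.
move=> [mf [M fM]] [mg [N gN]]; split; first exact: measurable_funM.
by exists (M * N) => x; rewrite normrM ler_pM.
Qed.

Lemma bmeasZ (a : R) f : bmeas f -> bmeas (fun x => a * f x).
Proof. by move=> bf; apply: bmeasM => //; exact: bmeas_cst. Qed.

Lemma bmeasN f : bmeas f -> bmeas (fun x => - f x).
Proof.
move=> /(bmeasZ (-1)) bf.
by rewrite (_ : (fun x => - f x) = (fun x => -1 * f x))//; apply/funext => x; rewrite mulN1r.
Qed.

Lemma bmeasB f g : bmeas f -> bmeas g -> bmeas (fun x => f x - g x).
Proof. by move=> bf bg; apply: bmeasD => //; exact: bmeasN. Qed.

Lemma bmeas_ub f : bmeas f -> exists2 B : R, 0 < B & forall x, f x <= B.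
Proof.
move=> [_ [B fB]]; exists (`|B| + 1); first by rewrite ltr_wpDl.
move=> x; rewrite (le_trans (ler_norm _))// (le_trans (fB x))//.
by rewrite (le_trans (ler_norm _))// lerDl.
Qed.

Lemma bmeas_lim F f (M : R) : (forall n, bmeas (F n)) ->
  (forall n x, `|F n x| <= M) -> (forall x, F n x @[n --> \oo] --> f x) ->
  bmeas f.
Proof.
move=> bF FM Ff; split.
  apply: (@measurable_fun_cvg _ _ _ _ F) => [n|x _].
    by case: (bF n).
  exact: Ff.
exists M => x; have /cvg_norm Fx := Ff x.
rewrite -(cvg_lim (@Rhausdorff R) Fx); apply: limr_le; first by apply/cvg_ex; eexists; exact: Fx.
by apply: nearW => n; exact: FM.
Qed.

(** Integration against a finite measure, seen through the three properties
    that the argument uses. Differences such as [Q f x - a * nu f] are again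
    functionals of this kind as soon as they are positive, which is cheaper to
    check than to construct the corresponding difference of measures. *)
Record pos_functional (L : (T -> R) -> R) : Prop := PosFunctional {
  pos_lin : forall a f g, bmeas f -> bmeas g ->
    L (fun x => a * f x + g x) = a * L f + L g;
  pos_ge0 : forall f, bmeas f -> (forall x, 0 <= f x) -> 0 <= L f;
  pos_cvg : forall F f (M : R), (forall n, bmeas (F n)) ->
    (forall n x, `|F n x| <= M) -> (forall x, F n x @[n --> \oo] --> f x) ->
    L (F n) @[n --> \oo] --> L f }.

Section pos_functional_theory.
Context (L : (T -> R) -> R) (pL : pos_functional L).

Lemma pos0 : L (cst 0) = 0.
Proof.
have := pos_lin pL (-1) (bmeas_cst 0) (bmeas_cst 0).
rewrite (_ : (fun x => _) = cst 0); first by move=> ->; rewrite mulN1r addNr.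
by apply/funext => x; rewrite /= mulr0 addr0.
Qed.

Lemma posZ a f : bmeas f -> L (fun x => a * f x) = a * L f.
Proof.
move=> bf; have := pos_lin pL a bf (bmeas_cst 0).
rewrite pos0 addr0 => <-; congr L; apply/funext => x; by rewrite /= addr0.
Qed.

Lemma posD f g : bmeas f -> bmeas g -> L (fun x => f x + g x) = L f + L g.
Proof.
move=> bf bg; rewrite -[L f]mul1r -(pos_lin pL)//.
by congr L; apply/funext => x; rewrite /= mul1r.
Qed.

Lemma posB f g : bmeas f -> bmeas g -> L (fun x => f x - g x) = L f - L g.
Proof.
move=> bf bg; rewrite addrC -mulN1r -(pos_lin pL)//.
by congr L; apply/funext => x; rewrite /= mulN1r addrC.
Qed.

Lemma pos_cst c : L (cst c) = c * L (cst 1).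
Proof.
rewrite -posZ; last exact: bmeas_cst.
by congr L; apply/funext => x; rewrite /= mulr1.
Qed.

Lemma pos_le f g : bmeas f -> bmeas g -> (forall x, f x <= g x) -> L f <= L g.
Proof.
move=> bf bg fg; rewrite -subr_ge0 -posB//; apply: (pos_ge0 pL).
  exact: bmeasB.
by move=> x; rewrite subr_ge0.
Qed.

Lemma pos_abs f g : bmeas f -> bmeas g -> (forall x, `|f x| <= g x) ->
  `|L f| <= L g.
Proof.
move=> bf bg fg; rewrite ler_norml; apply/andP; split.
  rewrite lerNl -mulN1r -posZ//; apply: pos_le => //; first exact: bmeasZ.
  by move=> x; rewrite mulN1r (le_trans _ (fg x))// ler_normr lexx orbT.
by apply: pos_le => // x; rewrite (le_trans _ (fg x))// ler_norm.
Qed.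

End pos_functional_theory.

Lemma pos_functionalZ (a : R) L : 0 <= a -> pos_functional L ->
  pos_functional (fun f => a * L f).
Proof.
move=> a0 pL; split.
- by move=> c f g bf bg; rewrite (pos_lin pL)// mulrDr mulrCA.
- by move=> f bf f0; rewrite mulr_ge0// (pos_ge0 pL).
- by move=> F f M bF FM Ff; apply: cvgMr; exact: (pos_cvg pL bF FM Ff).
Qed.

End bounded_measurable.

(** * A Perron-Frobenius eigenfunction *)

Section kernel_operator.
Context {R : realType} d {T : measurableType d}.
Implicit Types (f g : T -> R) (Q : (T -> R) -> T -> R) (nu : (T -> R) -> R).

Record kernel_op Q : Prop := KernelOp {
  kop_bmeas : forall f, bmeas f -> bmeas (Q f);
  kop_pos : forall x, pos_functional (fun f => Q f x) }.

(** The level sets of [Q (cst 1)] play the role of compact sets. On each of them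
    [conf_minor] is a Doeblin condition, which gives irreducibility and
    aperiodicity, and [conf_major] says that mass landing in the level set is
    controlled by [nu], which stands in for a bounded density. *)
Record confining Q nu : Prop := Confining {
  conf_op : kernel_op Q;
  conf_nu : pos_functional nu;
  conf_nu1 : nu (cst 1) = 1;
  conf_gt0 : forall x, 0 < Q (cst 1) x;
  conf_minor : forall dl, 0 < dl -> exists2 a : R, 0 < a &
    forall f x, bmeas f -> (forall y, 0 <= f y) -> dl <= Q (cst 1) x ->
      a * nu f <= Q f x;
  conf_major : forall dl, 0 < dl -> exists2 C : R, 0 < C &
    forall f x, bmeas f -> (forall y, 0 <= f y) ->
      (forall y, Q (cst 1) y < dl -> f y = 0) -> Q f x <= C * nu f }.

End kernel_operator.

Section eigenfunction.
Context {R : realType} d {T : measurableType d}.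
Context (Q : (T -> R) -> T -> R) (nu : (T -> R) -> R) (kQ : kernel_op Q).
Context (pnu : pos_functional nu) (nu1 : nu (cst 1) = 1).
Context (e b a C M : R) (K0 : set T).
Let K : set T := [set x | e <= Q (cst 1) x].
Context (e0 : 0 < e) (eb : e < b) (a0 : 0 < a) (C0 : 0 < C)
  (Q1M : forall x, Q (cst 1) x <= M)
  (minor : forall f x, bmeas f -> (forall y, 0 <= f y) -> K x ->
      a * nu f <= Q f x)
  (major : forall f x, bmeas f -> (forall y, 0 <= f y) ->
      (forall y, ~ K y -> f y = 0) -> Q f x <= C * nu f)
  (mK0 : measurable K0) (K0K : K0 `<=` K) (K00 : K0 !=set0)
  (K0b : forall x, K0 x -> b <= Q \1_K0 x).
Implicit Types (f g : T -> R).

Let bQ f : bmeas f -> bmeas (Q f). Proof. exact: kop_bmeas. Qed.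
Let pQ x : pos_functional (fun f => Q f x). Proof. exact: kop_pos. Qed.

Let mK : measurable K.
Proof.
have [mQ _] := bQ (bmeas_cst 1).
have -> : K = (Q (cst 1)) @^-1` `[e, +oo[.
  by apply/seteqP; split=> x /=; rewrite in_itv/= andbT.
by rewrite -[X in measurable X]setTI; exact: mQ.
Qed.

Let s : T -> R := fun x => a * \1_K x.
Let bs : bmeas s. Proof. by apply: bmeasZ; exact: bmeas_indic. Qed.
Let sK x : K x -> s x = a.
Proof. by move=> Kx; rewrite /s indicE mem_set// mulr1. Qed.
Let sNK x : ~ K x -> s x = 0.
Proof. by move=> Kx; rewrite /s indicE memNset// mulr0. Qed.
Let s0 x : 0 <= s x.
Proof. by apply: mulr_ge0; [exact: ltW|rewrite indicE]. Qed.

(** Nummelin splitting: [Q = G + s \otimes nu] with [G] positive. If [G] has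
    spectral radius below [z], then [z] is an eigenvalue of [Q] exactly when
    [\sum_n z^-(n+1) nu (G^n s) = 1], and [\sum_n z^-(n+1) G^n s] is then an
    eigenfunction. *)
Let G f : T -> R := fun x => Q f x - s x * nu f.
Let bG f : bmeas f -> bmeas (G f).
Proof.
move=> bf; apply: bmeasB; first exact: bQ.
by apply: bmeasM => //; exact: bmeas_cst.
Qed.

Let pG x : pos_functional (fun f => G f x).
Proof.
split.
- move=> c f g bf bg; rewrite /G (pos_lin (pQ x))// (pos_lin pnu)//; ring.
- move=> f bf f0; rewrite /G subr_ge0; have [Kx|Kx] := pselect (K x).
    by rewrite sK//; exact: minor.
  by rewrite sNK// mul0r; exact: (pos_ge0 (pQ x)).
- move=> F f B bF FB Ff; apply: cvgB; first exact: (pos_cvg (pQ x) bF FB Ff).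
  by apply: cvgMr; exact: (pos_cvg pnu bF FB Ff).
Qed.

Let GleQ f x : bmeas f -> (forall y, 0 <= f y) -> G f x <= Q f x.
Proof.
by move=> bf f0; rewrite /G lerBlDr lerDl mulr_ge0// (pos_ge0 pnu).
Qed.

(** [hN z N] is the partial sum of [\sum_n z^-(n+1) G^n s]. *)
Let step (z : R) f : T -> R := fun x => z^-1 * (G f x + s x).
Let hN z n := iter n (step z) (cst 0).

Let bhN z n : bmeas (hN z n).
Proof.
elim: n => [|n IH] /=; first exact: bmeas_cst.
by apply: bmeasZ; apply: bmeasD => //; exact: bG.
Qed.

Let le_step z f g : 0 < z -> bmeas f -> bmeas g -> (forall x, f x <= g x) ->
  forall x, step z f x <= step z g x.
Proof.
move=> z0 bf bg fg x; rewrite /step ler_pM2l ?invr_gt0// lerD2r.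
exact: (pos_le (pG x)).
Qed.

Let hN_ge0 z n x : 0 < z -> 0 <= hN z n x.
Proof.
move=> z0; elim: n x => [//|n IH] x /=.
rewrite /step; apply: mulr_ge0; first by rewrite invr_ge0 ltW.
by apply: addr_ge0 => //; apply: (pos_ge0 (pG x)) => //; exact: bhN.
Qed.

Let hN_nondec z x : 0 < z -> nondecreasing_seq (fun n => hN z n x).
Proof.
move=> z0; apply/nondecreasing_seqP => n; elim: n x => [|n IH] x.
  exact: (hN_ge0 1).
exact: (le_step z0 (bhN z n) (bhN z n.+1) IH).
Qed.

(** The series converges [nu]-almost everywhere, with [nu]-mass at most 1. *)
Let admissible z : Prop := 0 < z /\ forall n, nu (hN z n) <= 1.

Let supersolution z g : 0 < z -> bmeas g -> (forall x, 0 <= g x) ->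
  (forall x, G g x + s x <= z * g x) -> nu g <= 1 -> admissible z.
Proof.
move=> z0 bg g0 gz nug; split=> // n; apply: le_trans nug.
apply: (pos_le pnu) => //.
elim: n => [//|n IH] x /=.
apply: (@le_trans _ _ (step z g x)); first exact: (le_step z0 (bhN z n) bg IH).
by rewrite /step ler_pdivrMl.
Qed.

(** Outside [K] the operator loses a factor [e / z < 1] at each step, so there
    the partial sums are controlled by the mass that [K] sends out; that mass is
    at most [C * nu (hN z n) <= C]. *)
Let hN_bounded z : admissible z -> e < z ->
  exists2 B : R, 0 < B & forall n x, hN z n x <= B.
Proof.
move=> [z0 zadm] ez.
pose m := C / (z - e).
have m0 : 0 <= m by rewrite divr_ge0 ?(ltW C0)// subr_ge0 ltW.
have mz : z * m = C + m * e.
  have : m * (z - e) = C by rewrite divfK// gt_eqF// subr_gt0.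
  by move=> <-; ring.
have QhN n : (forall y, ~ K y -> hN z n y <= m) ->
    forall x, Q (hN z n) x <= C + m * Q (cst 1) x.
  move=> IH x; pose k y : R := \1_K y * hN z n y.
  have bk : bmeas k by apply: bmeasM => //; exact: bmeas_indic.
  have k0 y : 0 <= k y by rewrite mulr_ge0 ?indicE// hN_ge0.
  have kh y : k y <= hN z n y.
    by rewrite /k indicE; case: (_ \in _); rewrite ?mul1r ?mul0r// hN_ge0.
  have hk y : hN z n y <= m * cst 1 y + k y.
    rewrite /k indicE /= mulr1; have [Ky|Ky] := pselect (K y).
      by rewrite mem_set// mul1r lerDr.
    by rewrite memNset// mul0r addr0 IH.
  apply: (@le_trans _ _ (m * Q (cst 1) x + Q k x)).
    rewrite -(pos_lin (pQ x))//; last exact: bmeas_cst.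
    apply: (pos_le (pQ x)) => //; apply: bmeasD => //; apply: bmeasZ.
    exact: bmeas_cst.
  rewrite addrC lerD2r; apply: (@le_trans _ _ (C * nu k)).
    apply: major => // y Ky; by rewrite /k indicE memNset// mul0r.
  rewrite -[leRHS]mulr1 ler_wpM2l ?(ltW C0)//; apply: le_trans (zadm n).
  by apply: (pos_le pnu).
have off n y : ~ K y -> hN z n y <= m.
  elim: n y => [//|n IH] y Ky /=.
  rewrite /step sNK// addr0 ler_pdivrMl// mz.
  apply: (le_trans (GleQ _ (bhN z n) _)) => [x|]; first exact: hN_ge0.
  apply: (le_trans (QhN _ IH y)); rewrite lerD2l ler_wpM2l//.
  by move/negP : Ky; rewrite -ltNge => /ltW.
have M0 : 0 <= M.
  by have [x _] := K00; apply: le_trans (Q1M x); apply: (pos_ge0 (pQ x)) => //; exact: bmeas_cst.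
exists (z^-1 * (C + m * M + a)).
  apply: mulr_gt0; first by rewrite invr_gt0.
  apply: ltr_wpDl => //; apply: addr_ge0; first exact: ltW.
  exact: mulr_ge0.
move=> [x|n x] /=.
  apply: mulr_ge0; first by rewrite invr_ge0 ltW.
  apply: addr_ge0; last exact: ltW.
  apply: addr_ge0; first exact: ltW.
  exact: mulr_ge0.
rewrite /step ler_pM2l ?invr_gt0// lerD//.
  apply: (le_trans (GleQ _ (bhN z n) _)) => [y|]; first exact: hN_ge0.
  apply: (le_trans (QhN _ (off n) x)); by rewrite lerD2l ler_wpM2l.
by rewrite /s -[leRHS]mulr1 ler_wpM2l ?(ltW a0)// indicE; case: (_ \in _).
Qed.

Let renewal z : admissible z -> e < z ->
  exists h, [/\ bmeas h, forall x, 0 <= h x, nu h <= 1 &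
    forall x, z * h x = G h x + s x].
Proof.
move=> zadm ez; have [B B0 hB] := hN_bounded zadm ez; have [z0 nuz] := zadm.
pose h x := limn (fun n => hN z n x).
have hNh x : hN z n x @[n --> \oo] --> h x.
  apply: nondecreasing_is_cvgn; first exact: hN_nondec.
  by exists B => _ [n _ <-]; exact: hB.
have hNB n x : `|hN z n x| <= B by rewrite ger0_norm ?hN_ge0.
exists h; split.
- exact: (bmeas_lim (bhN z) hNB hNh).
- move=> x; apply: limr_ge; first by apply/cvg_ex; exists (h x); exact: hNh.
  by apply: nearW => n; exact: hN_ge0.
- have nuh := pos_cvg pnu (bhN z) hNB hNh.
  rewrite -(cvg_lim (@Rhausdorff R) nuh); apply: limr_le.
    by apply/cvg_ex; eexists; exact: nuh.
  exact: nearW.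
- move=> x; have Gh := pos_cvg (pG x) (bhN z) hNB hNh.
  have : hN z n.+1 x @[n --> \oo] --> z^-1 * (G h x + s x).
    by apply: cvgMr; apply: cvgD => //; exact: cvg_cst.
  rewrite (cvg_shiftS (fun n => hN z n x)) => /(cvg_unique (@Rhausdorff R) (hNh x)) ->.
  by rewrite mulVKf// gt_eqF.
Qed.

(** The sum of the series is a supersolution [Q h <= z h] bounded below on [K0],
    while [Q] multiplies the indicator of [K0] by at least [b]. *)
Let admissible_ge z : admissible z -> e < z -> b <= z.
Proof.
move=> zadm ez; have [z0 _] := zadm.
have [h [bh h0 nuh hE]] := renewal zadm ez.
pose A := [set h x | x in K0]; pose m := inf A.
have A0 : A !=set0 by have [x K0x] := K00; exists (h x), x.
have hz x : K0 x -> a / z <= h x.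
  move=> K0x; rewrite ler_pdivrMr// mulrC hE sK; last exact: K0K.
  by rewrite lerDr; apply: (pos_ge0 (pG x)).
have lbA y : K0 y -> m <= h y.
  move=> K0y; apply: ge_inf; last by exists y.
  by exists 0 => _ [x _ <-].
have m0 : 0 < m.
  apply: (@lt_le_trans _ _ (a / z)); first by rewrite divr_gt0.
  by apply: lb_le_inf => // _ [x K0x <-]; exact: hz.
have : m * b / z <= m.
  apply: lb_le_inf => // _ [x K0x <-].
  rewrite ler_pdivrMr// (mulrC (h x)) hE.
  apply: (@le_trans _ _ (Q h x)); last first.
    rewrite /G -addrA lerDl addrC subr_ge0 -[leRHS]mulr1.
    by rewrite ler_wpM2l.
  apply: (@le_trans _ _ (m * Q \1_K0 x)).
    by rewrite ler_pM2l//; exact: K0b.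
  rewrite -(posZ (pQ x)); last exact: bmeas_indic.
  apply: (pos_le (pQ x)) => //; first by apply: bmeasZ; exact: bmeas_indic.
  move=> y; rewrite indicE; have [K0y|K0y] := pselect (K0 y).
    by rewrite mem_set// mulr1 lbA.
  by rewrite memNset// mulr0.
by rewrite ler_pdivrMr// ler_pM2l.
Qed.

Let S := [set z | admissible z /\ e < z].
Let L := inf S.

Let S0 : S !=set0.
Proof.
exists (Num.max M (e + 1)); have eM : e < Num.max M (e + 1).
  by rewrite lt_max ltrDl ltr01 orbT.
split=> //; apply: (@supersolution _ (cst 1)) => //.
- exact: lt_trans eM.
- exact: bmeas_cst.
- by move=> x; rewrite /G nu1 /= !mulr1 subrK le_max Q1M.
- by rewrite nu1.
Qed.

Let lbS : lbound S b. Proof. by move=> z [? ?]; exact: admissible_ge. Qed.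

Let bL : b <= L. Proof. exact: lb_le_inf. Qed.
Let eL : e < L. Proof. exact: lt_le_trans bL. Qed.
Let L0 : 0 < L. Proof. exact: lt_trans eL. Qed.

(** Comparison of the partial sums at two parameters; it shows that the
    infimum of the admissible parameters above [e] is admissible. *)
Let hN_scale z n x : L <= z -> hN L n x <= (z / L) ^+ n * hN z n x.
Proof.
move=> Lz; have z0 : 0 < z by exact: lt_le_trans Lz.
have zL1 : 1 <= z / L by rewrite ler_pdivlMr// mul1r.
elim: n x => [|n IH] x; first by rewrite /= expr0 mulr0.
rewrite /= {1}/step ler_pdivrMl//.
have -> : L * ((z / L) ^+ n.+1 * step z (hN z n) x) =
   (z / L) ^+ n * (G (hN z n) x + s x).
  rewrite exprS /step; set t := _ ^+ n; set u := _ + _.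
  by field; rewrite ?gt_eqF.
rewrite mulrDr lerD//.
  rewrite -(posZ (pG x))//; apply: (pos_le (pG x)) => //.
  by apply: bmeasZ; exact: bhN.
by rewrite ler_peMl// exprn_ege1.
Qed.

Let admL : admissible L.
Proof.
split=> // n.
have H t : 1 < t -> nu (hN L n) <= t ^+ n.
  move=> t1.
  have [] := @inf_adherent _ S (L * (t - 1)) _ _.
  - by rewrite mulr_gt0// subr_gt0.
  - by split=> //; exists b.
  move=> z Sz; rewrite -/L => zt.
  have [[z0 za] ez] := Sz.
  have Lz : L <= z by apply: ge_inf => //; exists b.
  apply: (@le_trans _ _ ((z / L) ^+ n * nu (hN z n))).
    rewrite -(posZ pnu)//; apply: (pos_le pnu) => //.
      by apply: bmeasZ; exact: bhN.
    by move=> x; exact: hN_scale.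
  apply: (@le_trans _ _ ((z / L) ^+ n)).
    by rewrite ler_piMr// exprn_ge0// divr_ge0 ?ltW.
  apply: lerXn2r; rewrite ?nnegrE ?divr_ge0 ?ltW//; first exact: lt_trans t1.
  rewrite ltr_pdivrMr//; rewrite (lt_le_trans zt)// mulrBr mulr1 addrC subrK.
  by rewrite mulrC.
have tn : (1 + k.+1%:R^-1 : R) ^+ n @[k --> \oo] --> (1 : R).
  have t1 : (1 + k.+1%:R^-1 : R) @[k --> \oo] --> (1 + 0 : R).
    by apply: cvgD; [exact: cvg_cst|exact: cvg_harmonic].
  rewrite addr0 in t1; rewrite -[X in _ --> X](expr1n R n).
  by apply: (cvg_comp _ (fun t : R => t ^+ n) t1); exact: exprn_continuous.
rewrite -(cvg_lim (@Rhausdorff R) tn); apply: limr_ge.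
  by apply/cvg_ex; eexists; exact: tn.
by apply: nearW => k; apply: H; rewrite ltrDl invr_gt0.
Qed.

(** At the least admissible value [L] above [e] the mass [nu h] equals 1. If it were
    smaller, [(1 + kap) * h + eta] would be a supersolution at some [z < L]: the
    term [kap * h] gains [kap * s] on [K], and [eta] gains [eta * (L - e)] off
    [K], where [Q (cst 1) <= e]. *)
Lemma nummelin_eigenfunction : exists (Lam : R) (h : T -> R), [/\ e < Lam, bmeas h,
  forall x, 0 <= h x, nu h = 1 & forall x, Q h x = Lam * h x].
Proof.
have [h [bh h0 nuh hE]] := renewal admL eL.
suff nuh1 : nu h = 1.
  exists L, h; split => // x; rewrite hE /G nuh1; ring.
apply/eqP; rewrite eq_le nuh /= leNgt; apply/negP => nuh_lt1.
have [B B0 hB] := bmeas_ub bh.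
have M0 : 0 <= M.
  by have [x _] := K00; apply: le_trans (Q1M x); apply: (pos_ge0 (pQ x)) => //; exact: bmeas_cst.
have nuh0 : 0 <= nu h by exact: (pos_ge0 pnu).
pose kap := (1 - nu h) / 2.
have kap0 : 0 < kap by rewrite divr_gt0// subr_gt0.
have kap1 : kap <= 1 by rewrite /kap; lra.
have M1 : 0 < 2 * M + 1 by lra.
pose eta := Num.min kap (kap * a / (2 * M + 1)).
have eta0 : 0 < eta.
  by rewrite lt_min kap0/=; apply: divr_gt0 => //; exact: mulr_gt0.
have etak : eta <= kap by rewrite ge_min lexx.
have etaM : 2 * (eta * M) <= kap * a.
  have : eta * (2 * M + 1) <= kap * a.
    by rewrite -ler_pdivlMr// ge_min lexx orbT.
  by move: eta0 M0; nra.
pose del := Num.min ((L - e) / 2) (Num.min (kap * a / (4 * B))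
              (eta * (L - e) / (4 * B))).
have Le : 0 < L - e by rewrite subr_gt0.
have del0 : 0 < del.
  by rewrite !lt_min; apply/and3P; split; apply: divr_gt0 => //; exact: mulr_gt0.
have del1 : del <= (L - e) / 2 by rewrite ge_min lexx.
have del2 : del * (4 * B) <= kap * a.
  by rewrite -ler_pdivlMr ?mulr_gt0// /del !ge_min lexx orbT.
have del3 : del * (4 * B) <= eta * (L - e).
  by rewrite -ler_pdivlMr ?mulr_gt0// /del !ge_min lexx !orbT.
have Lde : e < L - del by lra.
have : S (L - del).
  split=> //; apply: (@supersolution _ (fun x => (1 + kap) * h x + eta * cst 1 x)).
  - exact: lt_trans Lde.
  - apply: bmeasD; apply: bmeasZ => //; exact: bmeas_cst.
  - move=> x; rewrite /= mulr1; apply: addr_ge0; last exact: ltW.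
    by apply: mulr_ge0 => //; lra.
  - move=> x; rewrite (pos_lin (pG x))//; last by apply: bmeasZ; exact: bmeas_cst.
    rewrite (posZ (pG x)); last exact: bmeas_cst.
    have -> : G h x = L * h x - s x by rewrite hE addrK.
    rewrite /= mulr1.
    have hx0 := h0 x; have hxB := hB x.
    have dh : del * (1 + kap) * h x <= del * (2 * B).
      rewrite -mulrA ler_wpM2l ?(ltW del0)//.
      by apply: ler_pM => //; lra.
    have G1Q : G (cst 1) x <= Q (cst 1) x by apply: GleQ => //; exact: bmeas_cst.
    have [Kx|Kx] := pselect (K x).
      rewrite sK//.
      have : eta * G (cst 1) x <= eta * M.
        by rewrite ler_wpM2l ?(ltW eta0)// (le_trans G1Q).
      have : 0 <= (L - del) * eta by apply: mulr_ge0; [move: Lde e0; lra|exact: ltW].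
      by move: dh; lra.
    rewrite sNK//.
    have Qe : Q (cst 1) x <= e by move/negP : Kx; rewrite -ltNge => /ltW.
    have : eta * G (cst 1) x <= eta * e.
      by rewrite ler_wpM2l ?(ltW eta0)// (le_trans G1Q).
    have : eta * ((L - e) / 2) <= eta * (L - del - e).
      by rewrite ler_wpM2l ?(ltW eta0)//; lra.
    by move: dh; lra.
  - rewrite (pos_lin pnu)//; last by apply: bmeasZ; exact: bmeas_cst.
    rewrite (posZ pnu) ?nu1; last exact: bmeas_cst.
    have : kap * nu h <= kap * 1 by rewrite ler_wpM2l// ltW.
    have : kap * 2 = 1 - nu h by rewrite /kap divfK.
    (* (1 + kap) nu h + eta <= nu h + 2 kap *)
    by move: etak; lra.
move=> /(ge_inf (ex_intro _ b lbS)); rewrite -/L; lra.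
Qed.

End eigenfunction.

Section perron.
Context {R : realType} d {T : measurableType d}.
Context (Q : (T -> R) -> T -> R) (nu : (T -> R) -> R).
Context (cQ : confining Q nu).
Let pQ x : pos_functional (fun f => Q f x).
Proof. exact: (kop_pos (conf_op cQ)). Qed.
Let bQ f : bmeas f -> bmeas (Q f).
Proof. exact: (kop_bmeas (conf_op cQ)). Qed.
Let pnu : pos_functional nu := conf_nu cQ.
Let nu1 : nu (cst 1) = 1 := conf_nu1 cQ.

Let mlev dl : measurable [set x | dl <= Q (cst 1) x].
Proof.
have [mQ _] := bQ (bmeas_cst 1).
have -> : [set x | dl <= Q (cst 1) x] = (Q (cst 1)) @^-1` `[dl, +oo[.
  by apply/seteqP; split=> x /=; rewrite in_itv/= andbT.
by rewrite -[X in measurable X]setTI; exact: mQ.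
Qed.

(** The level sets increase to the whole space because [Q (cst 1)] is
    positive. *)
Lemma level_mass : exists2 dl : R, 0 < dl &
  0 < nu (\1_[set x | dl <= Q (cst 1) x]).
Proof.
pose F n : T -> R := \1_[set x | n.+1%:R^-1 <= Q (cst 1) x].
have bF n : bmeas (F n) by apply: bmeas_indic; exact: mlev.
have F1 n x : `|F n x| <= 1.
  by rewrite /F indicE; case: (_ \in _); rewrite ?normr1 ?normr0.
have Fcvg x : F n x @[n --> \oo] --> (cst 1 x : R).
  apply: cvg_near_cst.
  have [N _ HN] := near_infty_natSinv_lt (PosNum (conf_gt0 cQ x)).
  exists N => // n /= Nn; rewrite /F indicE mem_set//=.
  by apply: ltW; exact: (HN n Nn).
have := pos_cvg pnu bF F1 Fcvg; rewrite nu1 => /cvgrPdist_lt /(_ _ ltr01).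
move=> [N _ HN]; exists N.+1%:R^-1 => //.
have := HN N (leqnn N); rewrite /= ltr_distlC => /andP[+ _].
by rewrite subrr.
Qed.

(** The level set [K0] charged by [nu] supplies a lower bound [b] on the growth
    rate; [e] is chosen below [b], so that outside the level set at height [e]
    the operator is smaller than its own growth rate. *)
Lemma eigenfunction_exists : exists (Lam : R) (h : T -> R) (e : R),
  [/\ 0 < e, e < Lam, bmeas h, forall x, 0 < h x & nu h = 1 /\
      forall x, Q h x = Lam * h x].
Proof.
have [d0 d00 nud0] := level_mass.
pose K0 := [set x | d0 <= Q (cst 1) x].
have [a1 a10 minor0] := conf_minor cQ d00.
pose b := a1 * nu \1_K0.
have b0 : 0 < b by rewrite mulr_gt0.
have bK0 : bmeas (\1_K0 : T -> R) by apply: bmeas_indic; exact: mlev.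
pose e := Num.min (b / 2) d0.
have e0 : 0 < e by rewrite lt_min d00 divr_gt0.
have eb : e < b.
  by rewrite gt_min ltr_pdivrMr// mulr_natr mulr2n ltrDl b0.
have [a a0 minor] := conf_minor cQ e0.
have [C C0 major] := conf_major cQ e0.
have [M _ Q1M] := bmeas_ub (bQ (bmeas_cst 1)).
have [] := @nummelin_eigenfunction _ _ _ Q nu (conf_op cQ) pnu nu1
  e b a C M K0 e0 eb a0 C0 Q1M.
- by move=> f x bf f0 Kx; exact: minor.
- move=> f x bf f0 fK; apply: major => // y ye; apply: fK => /=.
  by apply/negP; rewrite -ltNge.
- exact: mlev.
- by move=> x /= K0x; apply: le_trans K0x; rewrite ge_min lexx orbT.
- apply: contrapT => K0E; move: nud0; rewrite (_ : \1_K0 = cst 0).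
    by rewrite (pos0 pnu) ltxx.
  apply/funext => x; rewrite indicE memNset// => K0x.
  by apply: K0E; exists x.
- by move=> x K0x; apply: minor0 => // y; rewrite indicE.
move=> Lam [h [eLam bh h0 nuh hE]]; exists Lam, h, e; split => // x.
have Lam0 : 0 < Lam by exact: lt_trans eLam.
have [a' a'0 minor'] := conf_minor cQ (conf_gt0 cQ x).
have : 0 < Lam * h x.
  rewrite -hE; apply: lt_le_trans (minor' h x bh h0 _) => //.
  by rewrite nuh mulr1.
by rewrite pmulr_rgt0.
Qed.

End perron.

(** * Harris contraction *)

Section harris.
Context {R : realType} d {T : measurableType d}.
Context (Q : (T -> R) -> T -> R) (nu : (T -> R) -> R).
Context (cQ : confining Q nu).
Context (Lam e : R) (h : T -> R).
Context (e0 : 0 < e) (eLam : e < Lam) (bh : bmeas h) (h0 : forall x, 0 < h x)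
  (nuh : nu h = 1) (hE : forall x, Q h x = Lam * h x).
Implicit Types (f g : T -> R).

Let pQ x : pos_functional (fun f => Q f x).
Proof. exact: (kop_pos (conf_op cQ)). Qed.
Let bQ f : bmeas f -> bmeas (Q f).
Proof. exact: (kop_bmeas (conf_op cQ)). Qed.
Let pnu : pos_functional nu := conf_nu cQ.
Let Lam0 : 0 < Lam. Proof. exact: lt_trans eLam. Qed.
Let gam := e / Lam.
Let gam0 : 0 < gam. Proof. by rewrite divr_gt0. Qed.
Let gam1 : gam < 1. Proof. by rewrite ltr_pdivrMr// mul1r. Qed.
Let h_ge0 x : 0 <= h x. Proof. exact: ltW. Qed.
Let b1 : bmeas (cst 1 : T -> R). Proof. exact: bmeas_cst. Qed.

(** Divided by [Lam * h x], this is the Lyapunov condition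
    [P W <= gam * W + C1] for the Markov operator [P f = Q (h f) / (Lam h)] and
    [W = 1 / h]. *)
Lemma lyapunov_drift : exists2 C1 : R, 0 < C1 &
  forall x, Q (cst 1) x <= Lam * (gam + C1 * h x).
Proof.
have [a a0 minor] := conf_minor cQ e0.
have [M M0 Q1M] := bmeas_ub (bQ b1).
exists (M / a); first exact: divr_gt0.
have gE : Lam * gam = e by rewrite mulrC divfK// gt_eqF.
move=> x; rewrite mulrDr gE.
have [ex|/ltW xe] := leP e (Q (cst 1) x); last first.
  apply: le_trans xe _; rewrite lerDl; apply: mulr_ge0; first exact: ltW.
  by apply: mulr_ge0 => //; apply: divr_ge0; exact: ltW.
apply: (le_trans (Q1M x)).
have := minor h x bh h_ge0 ex; rewrite nuh mulr1 hE => ah.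
apply: (@le_trans _ _ (Lam * (M / a * h x))); last by rewrite lerDr ltW.
have -> : Lam * (M / a * h x) = M * (Lam * h x) / a by ring.
by rewrite ler_pdivlMr// ler_pM2l.
Qed.

(** Harris' theorem in the form of Hairer and Mattingly, for the weight
    [h + eta], modulo multiples of [h]. It rests on a bound for
    [q x - q y], where [q = Q g / (Lam h)]: if [h] is at least [r] at both
    points, the common part [s0 * nu g] cancels; otherwise [W x + W y >= 1 / r]
    is large and the drift absorbs the constant terms. *)
Lemma harris_contraction : exists eta be : R, [/\ 0 < eta, 0 < be < 1 &
  forall f c N, bmeas f -> 0 <= N ->
    (forall x, `|f x - c * h x| <= N * (h x + eta)) ->
    exists c' : R, forall x,
      `|Q f x - Lam * c' * h x| <= be * Lam * N * (h x + eta)].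
Proof.
have [C1 C10 Q1C] := lyapunov_drift.
have [B B0 hB] := bmeas_ub bh.
pose r := (1 - gam) / (2 * (2 * C1 + 1)).
have C11 : 0 < 2 * C1 + 1 by lra.
have r0 : 0 < r by rewrite divr_gt0 ?mulr_gt0// subr_gt0.
have rE : (1 - gam) / 2 = r * (2 * C1 + 1).
  by rewrite /r; field; rewrite gt_eqF.
have dl0 : 0 < Lam * r / B by rewrite divr_gt0// mulr_gt0.
have [a a0 minor] := conf_minor cQ dl0.
pose s0 := Num.min (2^-1) (a / (Lam * B)).
have s00 : 0 < s0 by rewrite lt_min invr_gt0 ltr0n divr_gt0// mulr_gt0.
have s01 : s0 <= 2^-1 by rewrite ge_min lexx.
have s0a : s0 * Lam * B <= a.
  by rewrite -mulrA -ler_pdivlMr ?mulr_gt0// ge_min lexx orbT.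
have [eta eta0 etaE] : exists2 eta : R, 0 < eta & eta * (2 * C1 + 1) = s0.
  exists (s0 / (2 * C1 + 1)); first by rewrite divr_gt0.
  by rewrite divfK// gt_eqF.
pose th := Num.min (eta / 2) (Num.min ((1 - gam) / 2) (s0 / 2)).
have g10 : 0 < 1 - gam by rewrite subr_gt0.
have th0 : 0 < th by rewrite !lt_min !divr_gt0.
have th1 : th <= eta / 2 by rewrite ge_min lexx.
have th2 : th <= (1 - gam) / 2 by rewrite /th !ge_min lexx orbT.
have th3 : th <= s0 / 2 by rewrite /th !ge_min lexx !orbT.
exists eta, (1 - th); split => //.
  by apply/andP; split; lra.
move=> f c N bf N0 fch.
have bch : bmeas (fun x => c * h x) by exact: bmeasZ.
pose g x := f x - c * h x.
have bg : bmeas g by exact: bmeasB.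
pose w x := h x + eta.
have bw : bmeas w by apply: bmeasD => //; exact: bmeas_cst.
have w0 x : 0 <= w x by rewrite addr_ge0// ltW.
have bNw : bmeas (fun x => N * w x) by exact: bmeasZ.
have QwE x : Q w x = Lam * h x + eta * Q (cst 1) x.
  rewrite (posD (pQ x))//; last exact: bmeas_cst.
  by rewrite hE -/(cst eta) (pos_cst (pQ x)).
have Qgw x : `|Q g x| <= N * Q w x.
  by rewrite -(posZ (pQ x))//; apply: (pos_abs (pQ x)).
pose W x := (h x)^-1.
have W0 x : 0 < W x by rewrite invr_gt0.
have hW x : h x * W x = 1 by rewrite divff// gt_eqF.
pose q x := Q g x / (Lam * h x).
have Lh0 x : 0 < Lam * h x by rewrite mulr_gt0.
have qE x : q x * (Lam * h x) = Q g x by rewrite divfK// gt_eqF.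
have Q1W x : Q (cst 1) x / (Lam * h x) <= gam * W x + C1.
  rewrite ler_pdivrMr//; apply: (le_trans (Q1C x)).
  have -> : (gam * W x + C1) * (Lam * h x) = Lam * (gam * (h x * W x) + C1 * h x).
    by ring.
  by rewrite hW mulr1.
have qb x : `|q x| <= N * (1 + eta * (gam * W x + C1)).
  rewrite /q normrM normfV (gtr0_norm (Lh0 x)) ler_pdivrMr//.
  apply: (le_trans (Qgw x)); rewrite QwE -[leRHS]mulrA ler_wpM2l//.
  rewrite mulrDl mul1r lerD2l -[leRHS]mulrA ler_pM2l//.
  by rewrite -ler_pdivrMr.
have qD x : r <= h x -> `|q x - s0 * nu g| <= N * (1 - s0 + eta * (gam * W x + C1)).
  move=> rx.
  have lev : Lam * r / B <= Q (cst 1) x.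
    rewrite ler_pdivrMr//; apply: (@le_trans _ _ (Lam * h x)).
      by rewrite ler_pM2l.
    rewrite -hE mulrC -(posZ (pQ x))//; apply: (pos_le (pQ x)) => //.
      by apply: bmeasZ; exact: b1.
    by move=> y; rewrite /= mulr1.
  pose k := s0 * (Lam * h x).
  have k0 : 0 <= k by apply: mulr_ge0; exact: ltW.
  have pG : pos_functional (fun u => Q u x - k * nu u).
    split.
    - move=> t u v bu bv; rewrite (pos_lin (pQ x))// (pos_lin pnu)//; ring.
    - move=> u bu u0; rewrite subr_ge0; apply: le_trans (minor u x bu u0 lev).
      rewrite ler_wpM2r//; first exact: (pos_ge0 pnu).
      by apply: le_trans s0a; rewrite /k mulrA ler_pM2l// mulr_gt0.
    - move=> F u M bF FM Fu; apply: cvgB; first exact: (pos_cvg (pQ x) bF FM Fu).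
      by apply: cvgMr; exact: (pos_cvg pnu bF FM Fu).
  have Gg : `|Q g x - k * nu g| <= N * (Q w x - k * nu w).
    by rewrite -(posZ pG N bw); apply: (pos_abs pG).
  have nuw : 1 <= nu w.
    rewrite -[leLHS]nuh; apply: (pos_le pnu) => // y.
    by rewrite lerDl ltW.
  have -> : q x - s0 * nu g = (Q g x - k * nu g) / (Lam * h x).
    by rewrite mulrBl -/(q x) /k; congr (_ - _); field; rewrite !gt_eqF.
  rewrite normrM normfV (gtr0_norm (Lh0 x)) ler_pdivrMr//.
  apply: (le_trans Gg); rewrite -[leRHS]mulrA ler_wpM2l// QwE.
  have : k <= k * nu w by rewrite ler_peMr.
  have : eta * Q (cst 1) x <= eta * (gam * W x + C1) * (Lam * h x).
    by rewrite -[leRHS]mulrA ler_pM2l// -ler_pdivrMr.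
  rewrite /k; lra.
have two x y : q x - q y <= (1 - th) * N * ((1 + eta * W x) + (1 + eta * W y)).
  have half z : 0 <= eta * W z by apply: mulr_ge0; exact: ltW.
  have key S' : 0 <= S' -> r^-1 <= S' ->
      2 + eta * (gam * S' + 2 * C1) <= (1 - th) * (2 + eta * S').
    move=> S0 rS.
    have rS1 : 2 * C1 + 1 <= (1 - gam) / 2 * S'.
      rewrite rE -mulrA mulrCA; apply: ler_peMr; first exact: ltW.
      by rewrite mulrC -ler_pdivrMr// mul1r.
    have : eta * (2 * C1 + 1) <= eta * ((1 - gam) / 2 * S') by rewrite ler_pM2l.
    have : th * (eta * S') <= (1 - gam) / 2 * (eta * S').
      by rewrite ler_wpM2r//; apply: mulr_ge0 => //; exact: ltW.
    move: th1; lra.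
  have far : r^-1 <= W x + W y ->
      q x - q y <= (1 - th) * N * ((1 + eta * W x) + (1 + eta * W y)).
    move=> rW.
    have /ler_normlP[_ q1] := qb x; have /ler_normlP[q2 _] := qb y.
    have := key (W x + W y) _ rW; rewrite addr_ge0 ?(ltW (W0 _))// => /(_ isT) kk.
    have := ler_wpM2l N0 kk; move: q1 q2; lra.
  have [hx|hx] := leP r (h x); last first.
    apply: far; apply: (@le_trans _ _ (W x)); last by rewrite lerDl ltW.
    by rewrite lef_pV2 ?posrE// ltW.
  have [hy|hy] := leP r (h y); last first.
    apply: far; apply: (@le_trans _ _ (W y)); last by rewrite lerDr ltW.
    by rewrite lef_pV2 ?posrE// ltW.
  have /ler_normlP[_ q1] := qD x hx; have /ler_normlP[q2 _] := qD y hy.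
  have kk : 2 * (1 - s0) + eta * (gam * (W x + W y) + 2 * C1) <=
      (1 - th) * (2 + eta * (W x + W y)).
    have : th * (eta * (W x + W y)) <= (1 - gam) * (eta * (W x + W y)).
      rewrite ler_wpM2r//; last by lra.
      by rewrite mulrDr addr_ge0.
    move: etaE eta0 th3; lra.
  have := ler_wpM2l N0 kk; move: q1 q2; lra.
pose A := [set q x - (1 - th) * N * (1 + eta * W x) | x in [set: T]].
have Aub y : ubound A (q y + (1 - th) * N * (1 + eta * W y)).
  by move=> _ [x _ <-]; have := two x y; lra.
(* every element of A is below every q y + (1 - th) N (1 + eta W y), so the
   constant sup A fits between the two families *)
exists (sup A + c) => x.
have sA1 : q x - (1 - th) * N * (1 + eta * W x) <= sup A.
  apply: ub_le_sup; last by exists x.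
  by exists (q x + (1 - th) * N * (1 + eta * W x)); exact: Aub.
have sA2 : sup A <= q x + (1 - th) * N * (1 + eta * W x).
  apply: ge_sup; last exact: Aub.
  by eexists; exists x.
have -> : Q f x - Lam * (sup A + c) * h x = (q x - sup A) * (Lam * h x).
  rewrite mulrBl qE (posB (pQ x))// (posZ (pQ x))// hE; ring.
have -> : (1 - th) * Lam * N * (h x + eta) =
    (1 - th) * N * (1 + eta * W x) * (Lam * h x).
  have -> : (1 - th) * N * (1 + eta * W x) * (Lam * h x) =
    (1 - th) * Lam * N * (h x + eta * (h x * W x)) by ring.
  by rewrite hW mulr1.
rewrite normrM (gtr0_norm (Lh0 x)) ler_pM2r//.
by rewrite ler_distl; move: sA1 sA2; rewrite lerBlDr => -> /= ; lra.
Qed.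

End harris.

(** * Convergence to the rank one limit *)

Lemma geometric_cauchy {R : realType} (u : nat -> R) (D be : R) : 0 < be < 1 ->
  (forall k m, (k <= m)%N -> `|u m - u k| <= D * be ^+ k) ->
  exists2 l : R, u n @[n --> \oo] --> l & forall k, `|u k - l| <= D * be ^+ k.
Proof.
move=> /andP[b0 b1] H.
have D0 : 0 <= D by have := H 0 0 isT; rewrite subrr normr0 expr0 mulr1.
have Db : D * be ^+ k @[k --> \oo] --> (0 : R).
  rewrite -(mulr0 D); apply: cvgMr; apply: cvg_expr.
  by rewrite ger0_norm// ltW.
have cu : cvgn u.
  apply/cauchy_cvgP/cauchy_ballP => ep ep0.
  have ep2 : 0 < ep / 2 by rewrite divr_gt0.
  have /cvgrPdist_lt /(_ _ ep2) [N _ HN] := Db.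
  have {}HN : D * be ^+ N < ep / 2.
    have := HN N (leqnn N).
    by rewrite /= sub0r normrN ger0_norm// mulr_ge0// exprn_ge0// ltW.
  exists (u @` [set n | (N <= n)%N], u @` [set n | (N <= n)%N]).
    by split; exists N => // n Nn; exists n.
  move=> [_ _] /= [[m /= Nm <-] [n /= Nn <-]]; rewrite /ball/=.
  rewrite -(subrKA (u N)) (le_lt_trans (ler_normD _ _))// (splitr ep) ltrD//.
    exact: le_lt_trans (H _ _ Nm) _.
  by rewrite distrC; exact: le_lt_trans (H _ _ Nn) _.
exists (limn u) => // k.
have uk : `|u k - u m| @[m --> \oo] --> `|u k - limn u|.
  by apply: cvg_norm; apply: cvgB => //; exact: cvg_cst.
rewrite -(cvg_lim (@Rhausdorff R) uk); apply: limr_le.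
  by apply/cvg_ex; eexists; exact: uk.
by exists k => // m /= km; rewrite distrC; exact: H.
Qed.

Section iterates.
Context {R : realType} d {T : measurableType d}.
Context (Q : (T -> R) -> T -> R) (kQ : kernel_op Q).

Lemma kernel_op_iter k : kernel_op (iter k Q).
Proof.
elim: k => [|k [bk pk]].
  split=> // x; split=> // F f M bF FM Ff; exact: Ff.
split=> [f bf|x]; first by rewrite iterS; apply: (kop_bmeas kQ); exact: bk.
have pQ := kop_pos kQ.
split=> [a f g bf bg|f bf f0|F f M bF FM Ff].
- rewrite !iterS -(pos_lin (pQ x)); [|exact: bk|exact: bk].
  by congr (Q _ x); apply/funext => y; exact: (pos_lin (pk y)).
- rewrite iterS; apply: (pos_ge0 (pQ x)); first exact: bk.
  by move=> y; exact: (pos_ge0 (pk y)).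
- have [_ [B hB]] := bk _ (bmeas_cst 1).
  apply: (pos_cvg (pQ x) (M := `|M| * B)) => [n|n y|y].
  + exact: bk.
  + apply: (@le_trans _ _ (iter k Q (fun=> `|M|) y)).
      apply: (pos_abs (pk y)) => //; first exact: bmeas_cst.
      by move=> z; rewrite (le_trans (FM n z))// ler_norm.
    rewrite -/(cst `|M|) (pos_cst (pk y)) ler_wpM2l//.
    by rewrite (le_trans (ler_norm _)).
  + exact: (pos_cvg (pk y) bF FM Ff).
Qed.

Lemma iter_eigenfunction (lam : R) (h : T -> R) : bmeas h ->
  (forall x, Q h x = lam * h x) ->
  forall k x, iter k Q h x = lam ^+ k * h x.
Proof.
move=> bh hE; elim=> [|k IH] x; first by rewrite mul1r.
rewrite iterS (_ : iter k Q h = (fun y => lam ^+ k * h y)); last exact/funext.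
by rewrite (posZ (kop_pos kQ x))// hE exprSr mulrA.
Qed.

End iterates.

Section spectral_gap.
Context {R : realType} d {T : measurableType d}.

(** [Lam] is an isolated simple eigenvalue: up to a geometric error in operator
    norm, [Q^k / Lam^k] is the rank one projection [f |-> L f * h]. *)
Record spectral_gap (Q : (T -> R) -> T -> R) (Lam : R) (h : T -> R)
    (L : (T -> R) -> R) (be C : R) : Prop := SpectralGap {
  gap_Lam : 0 < Lam;
  gap_bh : bmeas h;
  gap_h : forall x, 0 < h x;
  gap_eig : forall x, Q h x = Lam * h x;
  gap_L : pos_functional L;
  gap_Lh : L h = 1;
  gap_inv : forall f, bmeas f -> L (Q f) = Lam * L f;
  gap_be : 0 < be < 1;
  gap_C : 0 < C;
  gap_cvg : forall f M, bmeas f -> (forall x, `|f x| <= M) ->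
    forall k x, `|iter k Q f x / Lam ^+ k - L f * h x| <= C * be ^+ k * M }.

(** Iterating the contraction gives constants [c_k] with
    [Q^k f / Lam^k] within [O(be^k)] of [c_k * h], and the drift bounds
    [Q^j (h + eta) / Lam^j], so this closeness persists for all later times.
    Hence the iterates are Cauchy, and their limit is proportional to [h]. *)
Lemma spectral_gap_exists (Q : (T -> R) -> T -> R) nu : confining Q nu ->
  exists (Lam : R) (h : T -> R) (L : (T -> R) -> R) (be C : R), spectral_gap Q Lam h L be C.
Proof.
move=> cQ; have kQ := conf_op cQ; have pQ := kop_pos kQ.
have bQ f : bmeas f -> bmeas (Q f) by exact: kop_bmeas.
have [Lam [h [e [e0 eLam bh h0 [nuh hE]]]]] := eigenfunction_exists cQ.
have [x0 _] : exists x0 : T, True.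
  apply: contrapT => noT; have := conf_nu1 cQ.
  rewrite (_ : cst 1 = cst 0) ?(pos0 (conf_nu cQ)).
    by move/eqP; rewrite eq_sym oner_eq0.
  by apply/funext => x; exfalso; apply: noT; exists x.
have Lam0 : 0 < Lam by exact: lt_trans eLam.
have Lk0 k : 0 < Lam ^+ k by exact: exprn_gt0.
have [eta [be [eta0 be01 con]]] := harris_contraction cQ e0 eLam bh h0 nuh hE.
have /andP[be0 be1] := be01.
have [C1 C10 Q1C] := lyapunov_drift cQ e0 eLam bh h0 nuh hE.
have [B B0 hB] := bmeas_ub bh.
have kk k := kernel_op_iter kQ k.
have pk k x := kop_pos (kk k) x.
have bk k f : bmeas f -> bmeas (iter k Q f) by exact: (kop_bmeas (kk k)).
have b1 : bmeas (cst 1 : T -> R) by exact: bmeas_cst.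
pose gam := e / Lam.
have gam0 : 0 < gam by rewrite divr_gt0.
have gam1 : gam < 1 by rewrite ltr_pdivrMr// mul1r.
pose C2 := C1 / (1 - gam).
have C20 : 0 < C2 by rewrite divr_gt0// subr_gt0.
have C2E : C1 = C2 * (1 - gam) by rewrite divfK// gt_eqF// subr_gt0.
have {}Q1C x : Q (cst 1) x <= Lam * (gam + C1 * h x) by exact: Q1C.
clearbody C2; clearbody gam.
have hk := iter_eigenfunction kQ bh hE.
have Q1k k x : iter k Q (cst 1) x <= Lam ^+ k * (1 + C2 * h x).
  elim: k x => [|k IH] x.
    by rewrite expr0 mul1r /= lerDl mulr_ge0// ltW.
  rewrite iterSr; apply: (@le_trans _ _ (iter k Q (fun y => Lam * C1 * h y + (Lam * gam) * cst 1 y) x)).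
    apply: (pos_le (pk k x)) => [||y]; first exact: bQ.
      by apply: bmeasD; exact: bmeasZ.
    by rewrite (le_trans (Q1C y))//= mulr1 mulrDr addrC mulrA.
  rewrite (pos_lin (pk k x))//; last exact: bmeasZ.
  rewrite (posZ (pk k x))// hk exprS.
  have : Lam * gam * iter k Q (cst 1) x <= Lam * gam * (Lam ^+ k * (1 + C2 * h x)).
    by rewrite ler_pM2l// mulr_gt0.
  have : 0 <= Lam * Lam ^+ k * (1 - gam).
    by apply: mulr_ge0; [rewrite mulr_ge0 ?(ltW Lam0)// ltW|rewrite subr_ge0 ltW].
  have aux (X l g c y I : R) : 0 <= l * X * (1 - g) ->
    l * g * I <= l * g * (X * (1 + c * y)) ->
    l * (c * (1 - g)) * (X * y) + l * g * I <= l * X * (1 + c * y) by lra.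
  by rewrite C2E; exact: aux.
pose w x := h x + eta.
have bw : bmeas w by apply: bmeasD => //; exact: bmeas_cst.
pose C3 := B + eta * (1 + C2 * B).
have C30 : 0 < C3.
  apply: addr_gt0 => //; apply: mulr_gt0 => //.
  by apply: addr_gt0 => //; exact: mulr_gt0.
have wk k x : iter k Q w x <= Lam ^+ k * C3.
  rewrite (posD (pk k x))//; last exact: bmeas_cst.
  rewrite -/(cst eta) (pos_cst (pk k x)) hk mulrDr lerD//.
    by rewrite ler_pM2l.
  rewrite mulrCA ler_pM2l// (le_trans (Q1k k x))// ler_pM2l// lerD2l ler_pM2l//.
pose u f x k := iter k Q f x / Lam ^+ k.
(* the constant c is the same for all later times m *)
have close (f : T -> R) (M : R) : bmeas f -> (forall x, `|f x| <= M) -> 0 <= M -> forall k, exists c : R,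
    forall m x, (k <= m)%N -> `|u f x m - c * h x| <= M / eta * C3 * be ^+ k.
  move=> bf fM M0 k.
  have [c cE] : exists c : R, forall x,
      `|iter k Q f x - c * h x| <= be ^+ k * Lam ^+ k * (M / eta) * (h x + eta).
    elim: k => [|k [c cE]].
      exists 0 => x; rewrite mul0r subr0 !expr0 !mul1r (le_trans (fM x))//.
      rewrite mulrDr divfK ?gt_eqF// lerDr; apply: mulr_ge0; last exact: ltW.
      by apply: divr_ge0 => //; exact: ltW.
    have N0 : 0 <= be ^+ k * Lam ^+ k * (M / eta).
      apply: mulr_ge0; last by apply: divr_ge0 => //; exact: ltW.
      by apply: mulr_ge0; apply: exprn_ge0; exact: ltW.
    have [c' c'E] := con _ c _ (bk k f bf) N0 cE.
    exists (Lam * c') => x; rewrite iterS; apply: (le_trans (c'E x)).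
    by rewrite !exprS le_eqVlt; apply/orP; left; apply/eqP; ring.
  exists (c / Lam ^+ k) => m x km.
  have -> : u f x m - c / Lam ^+ k * h x =
      iter (m - k) Q (fun y => iter k Q f y - c * h y) x / Lam ^+ m.
    rewrite (posB (pk _ x)); [|exact: bk|exact: bmeasZ].
    rewrite (posZ (pk _ x))// hk -iterD subnK// mulrBl; congr (_ - _).
    rewrite -{2}(subnK km) exprD; field; by rewrite !gt_eqF.
  rewrite normrM normfV (gtr0_norm (Lk0 m)) ler_pdivrMr//.
  apply: (@le_trans _ _ (iter (m - k) Q (fun y => be ^+ k * Lam ^+ k * (M / eta) * w y) x)).
    apply: (pos_abs (pk _ x)) => //; last exact: bmeasZ.
    by apply: bmeasB; [exact: bk|exact: bmeasZ].
  rewrite (posZ (pk _ x))//.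
  have -> : M / eta * C3 * be ^+ k * Lam ^+ m =
     be ^+ k * Lam ^+ k * (M / eta) * (Lam ^+ (m - k) * C3).
    by rewrite -{1}(subnK km) exprD; ring.
  rewrite ler_wpM2l//.
  apply: mulr_ge0; last by apply: divr_ge0 => //; exact: ltW.
  by apply: mulr_ge0; apply: exprn_ge0; exact: ltW.
pose D := 2 * (C3 / eta).
have D0 : 0 < D by rewrite mulr_gt0// divr_gt0.
have cau (f : T -> R) (M : R) x : bmeas f -> (forall x, `|f x| <= M) -> 0 <= M ->
    forall k m, (k <= m)%N -> `|u f x m - u f x k| <= D * M * be ^+ k.
  move=> bf fM M0 k m km; have [c cE] := close f M bf fM M0 k.
  rewrite -(subrKA (c * h x)) (le_trans (ler_normD _ _))//.
  have -> : D * M * be ^+ k =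
      M / eta * C3 * be ^+ k + M / eta * C3 * be ^+ k by rewrite /D; ring.
  by rewrite lerD// ?cE// distrC cE.
pose ell f x := limn (u f x).
have ellP (f : T -> R) (M : R) x : bmeas f -> (forall x, `|f x| <= M) -> 0 <= M ->
    u f x n @[n --> \oo] --> ell f x /\
    forall k, `|u f x k - ell f x| <= D * M * be ^+ k.
  move=> bf fM M0; have [l ul lE] := geometric_cauchy be01 (cau f M x bf fM M0).
  by rewrite /ell (cvg_lim (@Rhausdorff R) ul).
have bndP (f : T -> R) : bmeas f -> exists2 M : R, 0 <= M & forall x, `|f x| <= M.
  move=> [_ [M fM]]; exists M => //.
  by rewrite (le_trans (normr_ge0 (f x0))).
have ell_cvg f x : bmeas f -> u f x n @[n --> \oo] --> ell f x.
  by move=> bf; have [M M0 fM] := bndP f bf; have [] := ellP f M x bf fM M0.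
pose L f := ell f x0 / h x0.
have bek (c : R) : c * be ^+ k @[k --> \oo] --> (0 : R).
  rewrite -(mulr0 c); apply: cvgMr; apply: cvg_expr.
  by rewrite ger0_norm// ltW.
have ellE f x : bmeas f -> ell f x = L f * h x.
  move=> bf; have [M M0 fM] := bndP f bf.
  have ellc k c y : (forall m x, (k <= m)%N ->
      `|u f x m - c * h x| <= M / eta * C3 * be ^+ k) ->
      `|ell f y - c * h y| <= M / eta * C3 * be ^+ k.
    move=> cE.
    have lc : `|u f y m - c * h y| @[m --> \oo] --> `|ell f y - c * h y|.
      by apply: cvg_norm; apply: cvgB; [exact: ell_cvg|exact: cvg_cst].
    rewrite -(cvg_lim (@Rhausdorff R) lc); apply: limr_le.
      by apply/cvg_ex; eexists; exact: lc.
    by exists k => // m /= km; exact: cE.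
  apply/eqP; rewrite -subr_eq0 -normr_le0.
  pose E := (1 + h x / h x0) * (M / eta * C3).
  rewrite -(cvg_lim (@Rhausdorff R) (bek E)); apply: limr_ge.
    by apply/cvg_ex; eexists; exact: (bek E).
  apply: nearW => k; have [c cE] := close f M bf fM M0 k.
  have -> : ell f x - L f * h x = (ell f x - c * h x) -
      (h x / h x0) * (ell f x0 - c * h x0).
    by rewrite /L; field; rewrite gt_eqF.
  have -> : E * be ^+ k = M / eta * C3 * be ^+ k +
      h x / h x0 * (M / eta * C3 * be ^+ k) by rewrite /E; ring.
  rewrite (le_trans (ler_normB _ _))// lerD ?ellc//.
  rewrite normrM ger0_norm; last by apply: divr_ge0; exact: ltW.
  by rewrite ler_wpM2l ?ellc//; apply: divr_ge0; exact: ltW.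
have Luniq f l : bmeas f -> u f x0 n @[n --> \oo] --> l * h x0 -> L f = l.
  move=> bf ul; rewrite /L /ell (cvg_lim (@Rhausdorff R) ul) mulfK//.
  by rewrite gt_eqF.
have Lcvg f : bmeas f -> u f x0 n @[n --> \oo] --> L f * h x0.
  by move=> bf; rewrite -ellE//; exact: ell_cvg.
have gapcvg (f : T -> R) (M : R) : bmeas f -> (forall x, `|f x| <= M) ->
    forall k x, `|u f x k - L f * h x| <= D * be ^+ k * M.
  move=> bf fM k x; have M0 : 0 <= M by rewrite (le_trans (normr_ge0 _) (fM x)).
  by rewrite -ellE// mulrAC; have [_] := ellP f M x bf fM M0; exact.
have pL : pos_functional L.
  split.
  - move=> a f g bf bg; apply: Luniq; first by apply: bmeasD => //; exact: bmeasZ.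
    rewrite mulrDl -mulrA.
    rewrite (_ : u _ x0 = (fun n => a * u f x0 n + u g x0 n)).
      by apply: cvgD; [apply: cvgMr; exact: Lcvg|exact: Lcvg].
    by apply/funext => n; rewrite /u (pos_lin (pk n x0))// mulrDl mulrA.
  - move=> f bf f0; apply: divr_ge0; last exact: ltW.
    apply: limr_ge; first by apply/cvg_ex; eexists; exact: ell_cvg.
    apply: nearW => n; apply: divr_ge0; last exact: ltW.
    exact: (pos_ge0 (pk n x0)).
  - move=> F f M bF FM Ff.
    have bf : bmeas f := bmeas_lim bF FM Ff.
    have M0 : 0 <= M by rewrite (le_trans (normr_ge0 _) (FM 0%N x0)).
    have fM x : `|f x| <= M.
      have lc : `|F n x| @[n --> \oo] --> `|f x| by apply: cvg_norm; exact: Ff.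
      rewrite -(cvg_lim (@Rhausdorff R) lc); apply: limr_le.
        by apply/cvg_ex; eexists; exact: lc.
      by apply: nearW => m; exact: FM.
    suff Lh : L (F n) * h x0 @[n --> \oo] --> L f * h x0.
      have hx : h x0 != 0 by rewrite gt_eqF.
      rewrite -[L f](mulfK hx); under eq_fun do rewrite -[L (F _)](mulfK hx).
      by apply: cvgMl.
    apply/cvgrPdist_le => ep ep0.
    have ep3 : 0 < ep / 3 by rewrite divr_gt0.
    have /cvgrPdist_le /(_ _ ep3) [k _ Hk] := bek (D * M).
    have {}Hk : D * be ^+ k * M <= ep / 3.
      have := Hk k (leqnn k); rewrite /= sub0r normrN ger0_norm; first by rewrite mulrAC.
      by apply: mulr_ge0; [apply: mulr_ge0 => //|apply: exprn_ge0]; exact: ltW.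
    have uF : u (F n) x0 k @[n --> \oo] --> u f x0 k.
      by apply: cvgMl; exact: (pos_cvg (pk k x0) bF FM Ff).
    have /cvgrPdist_le /(_ _ ep3) [N _ HN] := uF.
    exists N => // n /= Nn.
    have H1 := gapcvg f M bf fM k x0.
    have H2 := gapcvg (F n) M (bF n) (FM n) k x0.
    have H3 := HN n Nn.
    have -> : L f * h x0 - L (F n) * h x0 = - (u f x0 k - L f * h x0)
       + ((u f x0 k - u (F n) x0 k) + (u (F n) x0 k - L (F n) * h x0)) by ring.
    rewrite (le_trans (ler_normD _ _))// normrN.
    have := ler_normD (u f x0 k - u (F n) x0 k) (u (F n) x0 k - L (F n) * h x0).
    by move: H1 H2 H3 Hk => /=; lra.
exists Lam, h, L, be, D; split => //.
- apply: Luniq => //; rewrite mul1r.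
  rewrite (_ : u h x0 = cst (h x0)); first exact: cvg_cst.
  by apply/funext => n; rewrite /u hk mulrAC divff ?mul1r// gt_eqF.
- move=> f bf; apply: Luniq; first exact: bQ.
  have : u f x0 n.+1 @[n --> \oo] --> L f * h x0.
    by rewrite (cvg_shiftS (u f x0)); exact: Lcvg.
  move=> uS; rewrite -mulrA.
  rewrite (_ : u (Q f) x0 = fun n => Lam * u f x0 n.+1); first exact: cvgMr.
  apply/funext => n; rewrite /u -iterSr exprS; field.
  by rewrite !gt_eqF.
Qed.

End spectral_gap.

(** * From functionals to measures *)

Section integral_functional.
Context {R : realType} d {T : measurableType d}.
Implicit Types (f g : T -> R).

Lemma bmeas_integrable (mu : {measure set T -> \bar R}) f :
  (mu setT < +oo)%E -> bmeas f -> mu.-integrable [set: T] (EFin \o f).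
Proof.
move=> mufin [mf [M fM]].
apply: (@le_integrable _ _ _ mu _ measurableT _ (EFin \o cst M)) => //.
- exact/measurable_EFinP.
- by move=> x _ /=; rewrite lee_fin (le_trans (fM x))// ler_norm.
- apply/integrableP; split.
    exact: (@measurable_cst _ _ _ _ _ M%:E).
  by rewrite /= integral_cst//= lte_mul_pinfty.
Qed.

Lemma bmeas_integralE (mu : {measure set T -> \bar R}) f :
  (mu setT < +oo)%E -> bmeas f ->
  (\int[mu]_x (f x)%:E = (\int[mu]_x f x)%:E)%E.
Proof.
move=> mufin bf; rewrite /Rintegral fineK//.
by apply: (@integral_fune_fin_num _ _ _ mu) => //; exact: bmeas_integrable.
Qed.

Lemma pos_functional_integral (mu : {measure set T -> \bar R}) :
  (mu setT < +oo)%E -> pos_functional (fun f => \int[mu]_x f x).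
Proof.
move=> mufin.
have I f : bmeas f -> mu.-integrable [set: T] (EFin \o f).
  exact: bmeas_integrable.
split=> [a f g bf bg|f bf f0|F f M bF FM Ff].
- rewrite RintegralD// ?RintegralZl//; [exact: I|exact: (I (fun x => a * f x) (bmeasZ a bf))|exact: I].
- by apply: Rintegral_ge0 => x _.
- have bf := bmeas_lim bF FM Ff.
  have [] := @dominated_convergence _ _ _ mu _ measurableT
    (fun n x => (F n x)%:E) (fun x => (f x)%:E) (cst M%:E).
  - by move=> n; apply/measurable_EFinP; case: (bF n).
  - by apply/measurable_EFinP; case: bf.
  - by apply: aeW => x _; apply: cvg_EFin; [exact: nearW|exact: Ff].
  - exact: (I (cst M) (bmeas_cst M)).
  - by apply: aeW => x n _; rewrite /= lee_fin.
  move=> _ _; rewrite bmeas_integralE//.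
  under eq_fun do rewrite bmeas_integralE//.
  by move=> /fine_cvg.
Qed.

Lemma Rintegral_cst1 (mu : probability T R) : \int[mu]_x (cst 1 x : R) = 1.
Proof. by rewrite Rintegral_cst// mul1r [X in fine X](probability_setT mu). Qed.

End integral_functional.

Lemma pos_functional_comp {R : realType} d1 d2 {T1 : measurableType d1}
    {T2 : measurableType d2} (L : (T1 -> R) -> R) (F : T1 -> T2) :
  measurable_fun [set: T1] F -> pos_functional L ->
  pos_functional (fun f : T2 -> R => L (f \o F)).
Proof.
move=> mF pL.
have bF f : bmeas f -> bmeas (f \o F).
  by move=> [mf [M fM]]; split; [exact: measurableT_comp|exists M => x; exact: fM].
split=> [a f g bf bg|f bf f0|G f M bG GM Gf].
- by rewrite -(pos_lin pL)//; exact: bF.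
- by apply: (pos_ge0 pL) => [|x]; [exact: bF|exact: f0].
- apply: (pos_cvg pL (M := M)) => [n|n x|x].
  + exact: bF.
  + exact: GM.
  + exact: Gf.
Qed.

Section functional_extensionality_on_sets.
Context {R : realType} d {T : measurableType d}.
Implicit Types (f g : T -> R) (L : (T -> R) -> R).
Import HBNNSimple.

Lemma pos_sum L (I : Type) (s : seq I) (F : I -> T -> R) :
  pos_functional L -> (forall i, bmeas (F i)) ->
  bmeas (fun x => \sum_(i <- s) F i x) /\
  L (fun x => \sum_(i <- s) F i x) = \sum_(i <- s) L (F i).
Proof.
move=> pL bF; elim: s => [|i s [bs IH]].
  rewrite big_nil; split.
    by under eq_fun do rewrite big_nil; exact: bmeas_cst.
  by under eq_fun do rewrite big_nil; exact: pos0.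
split; first by under eq_fun do rewrite big_cons; exact: bmeasD.
by rewrite big_cons -IH -posD//; congr L; apply/funext => x; rewrite big_cons.
Qed.

(** A functional is determined by its values on indicators, by monotone
    approximation with simple functions. *)
Lemma eq_pos_functional L L' : pos_functional L -> pos_functional L' ->
  (forall A, measurable A -> L \1_A = L' \1_A) ->
  forall f, bmeas f -> L f = L' f.
Proof.
move=> pL pL' LL' f [mf [M fM]].
have eqs (g : {nnsfun T >-> R}) : bmeas g /\ L g = L' g.
  have gE : (g : T -> R) = (fun x => \sum_(y <- fset_set (range g)) y * \1_(g @^-1` [set y]) x).
    by apply/funext => x; rewrite fimfunE fsbig_finite.
  have bi y : bmeas (fun x => y * \1_(g @^-1` [set y]) x : R).
    by apply: bmeasZ; exact: bmeas_indic.
  have [bg Lg] := pos_sum (fset_set (range g)) pL bi.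
  have [_ L'g] := pos_sum (fset_set (range g)) pL' bi.
  rewrite gE; split=> //; rewrite Lg L'g; apply: eq_bigr => y _.
  by rewrite !posZ ?LL'//; exact: bmeas_indic.
have bf : bmeas f by split=> //; exists M.
pose f' x := f x + M.
have f'0 x : 0 <= f' x.
  by rewrite -lerBlDr sub0r; have := fM x; rewrite ler_norml => /andP[].
have bf' : bmeas f' by apply: bmeasD => //; exact: bmeas_cst.
have mf' : measurable_fun [set: T] (EFin \o f').
  by apply/measurable_EFinP; case: bf'.
pose g := nnsfun_approx measurableT mf'.
have gf x : g n x @[n --> \oo] --> f' x.
  have := @cvg_nnsfun_approx _ _ _ _ measurableT _ mf' _ x I.
  by move=> /(_ (fun x _ => f'0 x)) /fine_cvg.
have gM n x : `|g n x| <= M + M.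
  rewrite ger0_norm//; apply: (@le_trans _ _ (f' x)).
    rewrite -(cvg_lim (@Rhausdorff R) (gf x)).
    apply: nondecreasing_cvgn_le; last by apply/cvg_ex; eexists; exact: gf.
    by move=> m k mk; exact/lefP/nd_nnsfun_approx.
  by rewrite lerD2r (le_trans (ler_norm _)).
have bg n : bmeas (g n) by have [] := eqs (g n).
have H1 := pos_cvg pL bg gM gf; have H2 := pos_cvg pL' bg gM gf.
have Lf' : L f' = L' f'.
  apply: (cvg_unique (@Rhausdorff R) H1).
  rewrite (_ : (fun n => L (g n)) = (fun n => L' (g n)))//.
  by apply/funext => n; have [] := eqs (g n).
have fE : f = (fun x => f' x - cst M x) by apply/funext => x; rewrite /f' addrK.
rewrite fE (posB pL)//; last exact: bmeas_cst.
rewrite (posB pL')//; last exact: bmeas_cst.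
rewrite Lf' (pos_cst pL) (pos_cst pL') -indicT LL'//.
Qed.

End functional_extensionality_on_sets.

Section measure_of_functional.
Context {R : realType} d {T : measurableType d}.
Context (L : (T -> R) -> R) (pL : pos_functional L) (L1 : L (cst 1) = 1).
Local Open Scope ereal_scope.

(** The absolute value keeps the set function nonnegative on non-measurable sets,
    where nothing is known about [L]. *)
Definition functional_measure of (pos_functional L) & (L (cst 1%R) = 1%R) :
  set T -> \bar R := fun A => (`|L \1_A|%R)%:E.
Local Notation m := (functional_measure pL L1).

Let mE A : measurable A -> m A = (L \1_A)%:E.
Proof.
move=> mA; rewrite /functional_measure ger0_norm//.
by apply: (pos_ge0 pL) => [|x]; [exact: bmeas_indic|rewrite indicE].
Qed.

Let m0 : m set0 = 0.
Proof. by rewrite mE// indic0 (pos0 pL). Qed.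

Let m_ge0 A : 0 <= m A. Proof. by rewrite lee_fin. Qed.

Let m_sigma_additive : semi_sigma_additive m.
Proof.
move=> F mF tF mUF; rewrite mE//.
have bF i : bmeas (\1_(F i) : T -> R) by exact: bmeas_indic.
pose g n (x : T) : R := (\sum_(i <- index_iota 0 n) \1_(F i) x)%R.
have bg n : bmeas (g n) by have [] := pos_sum (index_iota 0 n) pL bF.
have Fk k x i : F k x -> \1_(F i) x = (i == k)%:R :> R.
  move=> Fkx; rewrite indicE; have [->|ik] := eqVneq i k; first by rewrite mem_set.
  rewrite memNset// => Fix.
  by move/eqP : ik; apply; apply: (tF i k) => //; exists x.
have gk k x n : F k x -> g n x = (k < n)%N%:R.
  move=> Fkx; rewrite /g; elim: n => [|n IH]; first by rewrite big_geq.
  rewrite big_nat_recr//= IH (Fk k)// ltnS.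
  by case: (ltngtP k n) => _ /=; rewrite ?addr0 ?add0r.
have gN x n : (forall k, ~ F k x) -> g n x = 0%R.
  by move=> Fx; rewrite /g big1_seq// => i _; rewrite indicE memNset.
have g1 n x : (`|g n x| <= 1)%R.
  have [[k Fkx]|Fx] := pselect (exists k, F k x).
    by rewrite (gk k)//; case: (k < n)%N; rewrite ?normr1 ?normr0.
  by rewrite gN ?normr0// => k Fkx; apply: Fx; exists k.
have gU x : g n x @[n --> \oo] --> (\1_(\bigcup_i F i) x : R).
  rewrite indicE; have [[k Fkx]|Fx] := pselect (exists k, F k x).
    rewrite mem_set; last by exists k.
    by apply: cvg_near_cst; exists k.+1 => // n /= kn; rewrite (gk k)// kn.
  rewrite memNset; last by move=> [k _ Fkx]; apply: Fx; exists k.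
  apply: cvg_near_cst; apply: nearW => n; apply: gN => k Fkx.
  by apply: Fx; exists k.
apply: cvg_EFin; first by apply: nearW => n; rewrite sum_fin_num; apply/allP => r /mapP[i _ ->].
have := pos_cvg pL bg g1 gU; apply: cvg_trans; apply: near_eq_cvg.
apply: nearW => n /=.
have [_ ->] := pos_sum (index_iota 0 n) pL bF.
by under eq_bigr do rewrite mE//; rewrite sumEFin.
Qed.

HB.instance Definition _ := isMeasure.Build _ _ _ m m0 m_ge0 m_sigma_additive.

Let mT : m setT = 1.
Proof. by rewrite mE// indicT L1. Qed.

HB.instance Definition _ := @Measure_isProbability.Build _ _ _ m mT.

(** A Riesz representation for functionals that are continuous under bounded
    pointwise convergence. *)
Lemma functional_measureP : exists mu : probability T R,
  forall f : T -> R, bmeas f -> (\int[mu]_x f x)%R = L f.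
Proof.
exists m => f bf; apply: eq_pos_functional bf => //.
  by apply: pos_functional_integral; rewrite [X in (X < _)%E]mT ltry.
move=> A mA; rewrite /Rintegral integral_indic// setIT.
by rewrite [X in fine X]mE.
Qed.

End measure_of_functional.

(** * The density of a scaled and shifted Gaussian vector *)

Section density.
Local Open Scope ereal_scope.
Context d (T : measurableType d) (R : realType).
Context (mu nu : {measure set T -> \bar R}) (p : T -> R).
Context (mp : measurable_fun [set: T] p) (p0 : forall x, (0 <= p x)%R).
Context (nuE : forall A, measurable A -> nu A = \int[mu]_(x in A) (p x)%:E).
Import HBNNSimple.

Lemma ge0_integral_density (f : T -> \bar R) :
  measurable_fun [set: T] f -> (forall x, 0 <= f x) ->
  \int[nu]_x f x = \int[mu]_x (f x * (p x)%:E).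
Proof.
move=> mf f0; pose g := nnsfun_approx measurableT mf.
have mpE : measurable_fun [set: T] (EFin \o p) by exact/measurable_EFinP.
have mg n : measurable_fun [set: T] (fun x => (g n x)%:E).
  exact/measurable_EFinP.
have gnd x : nondecreasing_seq (fun n => (g n x)%:E).
  by move=> m n mn; rewrite lee_fin; exact/lefP/nd_nnsfun_approx.
have gf x : (g n x)%:E @[n --> \oo] --> f x.
  exact: (@cvg_nnsfun_approx _ _ _ _ measurableT _ mf (fun x _ => f0 x) x I).
have gE n : \int[nu]_x (g n x)%:E = \int[mu]_x ((g n x)%:E * (p x)%:E).
  under eq_integral do rewrite fimfunE -fsumEFin//.
  rewrite ge0_integral_fsum//; last 2 first.
  - by move=> y; exact/measurable_EFinP/measurable_funM.
  - by move=> y x _; rewrite nnfun_muleindic_ge0.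
  transitivity (\sum_(r \in range (g n)) \int[mu]_x
      ((r * \1_(g n @^-1` [set r]) x)%:E * (p x)%:E)).
    apply: eq_fsbigr => r /set_mem[x0 _ rE].
    have r0 : (0 <= r)%R by rewrite -rE.
    under eq_integral do rewrite EFinM.
    rewrite ge0_integralZl//; last first.
      by apply/measurable_EFinP.
    rewrite integral_indic// setIT nuE//.
    under [in RHS]eq_integral do rewrite EFinM -muleA.
    rewrite ge0_integralZl//; last 2 first.
    - by apply: emeasurable_funM => //; apply/measurable_EFinP.
    - by move=> x _; rewrite mule_ge0// lee_fin.
    congr (_ * _); rewrite integral_mkcond; apply: eq_integral => x _.
    rewrite patchE indicE; case: ifPn => xg; rewrite ?mul1e ?mul0e//.
  rewrite -ge0_integral_fsum//.
  - apply: eq_integral => x _; rewrite [in RHS]fimfunE -fsumEFin//.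
    by rewrite -ge0_mule_fsuml// => r; rewrite nnfun_muleindic_ge0.
  - move=> r; apply: emeasurable_funM => //.
    by apply/measurable_EFinP/measurable_funM.
  - by move=> r x _; apply: mule_ge0; rewrite ?lee_fin// -lee_fin EFinM nnfun_muleindic_ge0.
have H1 : \int[nu]_x (g n x)%:E @[n --> \oo] --> \int[nu]_x f x.
  rewrite (eq_integral (fun x => limn (fun n => (g n x)%:E))); last first.
    by move=> x _; apply/esym/cvg_lim => //; exact: gf.
  apply: cvg_monotone_convergence => //.
  by move=> n x _; rewrite lee_fin.
have H2 : \int[mu]_x ((g n x)%:E * (p x)%:E) @[n --> \oo] --> \int[mu]_x (f x * (p x)%:E).
  rewrite (eq_integral (fun x => limn (fun n => (g n x)%:E * (p x)%:E))); last first.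
    move=> x _; apply/esym/cvg_lim => //.
    by apply: cvgeZr => //; exact: gf.
  apply: cvg_monotone_convergence => //.
  - by move=> n; exact: emeasurable_funM.
  - by move=> n x _; rewrite mule_ge0 ?lee_fin.
  - by move=> x _ m n mn; rewrite lee_wpmul2r ?lee_fin//; exact: gnd.
move: H1; under eq_fun do rewrite gE.
by move=> /(cvg_unique _ H2) ->.
Qed.

End density.

Section gaussian_density.
Local Open Scope ereal_scope.
Context {R : realType}.
Local Notation leb := (@lebesgue_measure R).

Definition affine (m s : R) : measurableTypeR R -> measurableTypeR R :=
  fun t => (m + s * t)%R.

Lemma measurable_affine m s : measurable_fun setT (affine m s).
Proof. by apply: measurable_funD => //; exact: measurable_funM. Qed.

Let affine_push m s : {measure set (measurableTypeR R) -> \bar R} :=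
  measure_function_pushforward__canonical__measure_function_Measure leb
    (measurable_affine m s).

(** Lebesgue measure on the line is determined by its values on the intervals
    [`]a, b]], whose preimages under an affine map are again intervals. *)
Lemma lebesgue_affine (m s : R) (s0 : (0 < s)%R) (A : set (measurableTypeR R)) :
  measurable A ->
  mscale (NngNum (ltW s0)) (affine_push m s) A = leb A.
Proof.
move=> mA; apply/esym/lebesgue_measure_unique => //= _ [[a b]] _ <-.
rewrite [RHS](_ : _ = s%:E * leb (affine m s @^-1` `]a, b]%classic))//.
have -> : affine m s @^-1` `]a, b]%classic = `](((a - m) / s)%R), (((b - m) / s)%R)]%classic.
  apply/seteqP; split=> t /=; rewrite !in_itv/= /affine.
    by rewrite ltr_pdivrMr// ler_pdivlMr// ltrBlDl lerBrDl mulrC.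
  by rewrite ltr_pdivrMr// ler_pdivlMr// ltrBlDl lerBrDl mulrC.
rewrite !lebesgue_measure_itv/= !lte_fin ltr_pM2r ?invr_gt0// ltrD2r.
case: ifPn => ab; last by rewrite mule0.
by congr EFin; field; rewrite gt_eqF.
Qed.

Lemma ge0_integral_affine (m s : R) (f : R -> \bar R) : (0 < s)%R ->
  measurable_fun [set: measurableTypeR R] f -> (forall x, 0 <= f x) ->
  \int[leb]_t (f (m + s * t)%R * s%:E) = \int[leb]_y f y.
Proof.
move=> s0 mf f0.
rewrite -[RHS](eq_measure_integral _ (fun A mA _ => lebesgue_affine m s0 mA)).
rewrite [RHS]ge0_integral_mscale//=.
rewrite [X in _ = _ * X](_ : _ = \int[leb]_t f (affine m s t)); last first.
  by rewrite [LHS]ge0_integral_pushforward//; exact: measurable_affine.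
under eq_integral do rewrite muleC.
rewrite ge0_integralZl//; last exact: ltW.
by apply: measurableT_comp => //; exact: measurable_affine.
Qed.

Lemma ge0_integral_normal_affine (m s : R) (f : R -> \bar R) : (0 < s)%R ->
  measurable_fun [set: measurableTypeR R] f -> (forall x, 0 <= f x) ->
  \int[normal_prob (0%R : R) 1%R]_t f (m + s * t)%R =
  \int[leb]_y (f y * (normal_pdf m s y)%:E).
Proof.
move=> s0 mf f0.
have maf : measurable_fun [set: measurableTypeR R] (fun t => f (m + s * t)%R).
  by apply: measurableT_comp => //; exact: measurable_affine.
have normalE (A : set (measurableTypeR R)) : measurable A ->
    normal_prob (0%R : R) 1%R A = \int[leb]_(x in A) (normal_pdf 0%R 1%R x)%:E.
  by [].
rewrite [LHS](@ge0_integral_density _ (measurableTypeR R) R leb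
  (normal_prob 0%R 1%R) (normal_pdf 0%R 1%R) (measurable_normal_pdf 0%R 1%R)
  (normal_pdf_ge0 0%R 1%R) normalE _ maf (fun t => f0 _)).
rewrite -(@ge0_integral_affine m s)//; last 2 first.
- by apply: emeasurable_funM => //; apply/measurable_EFinP; exact: measurable_normal_pdf.
- by move=> y; rewrite mule_ge0// lee_fin normal_pdf_ge0.
apply: eq_integral => t _; rewrite -muleA -EFinM; congr (_ * EFin _).
have s1 : s != 0%R by rewrite gt_eqF.
rewrite !normal_pdfE ?oner_neq0//= mulrAC; congr (_ * _)%R.
  rewrite /normal_peak expr1n mul1r -mulrnAr sqrtrM ?sqr_ge0// sqrtr_sqr gtr0_norm//.
  by rewrite invfM mulrAC mulVf// mul1r.
by rewrite /normal_fun; congr expR; field.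
Qed.

Lemma cons_rV0 n (p : measurableTypeR R * 'rV[R]_n) : cons_rV p ord0 ord0 = p.1.
Proof. by rewrite -[in RHS](cons_rVK p). Qed.

Lemma cons_rVS n (p : measurableTypeR R * 'rV[R]_n) j :
  cons_rV p ord0 (lift ord0 j) = p.2 ord0 j.
Proof. by rewrite -[in RHS](cons_rVK p) [RHS]mxE. Qed.

Definition gauss_pdf n (m : 'rV[R]_n) (s : R) (y : 'rV[R]_n) : R :=
  \prod_(i < n) normal_pdf (m ord0 i) s (y ord0 i).

Lemma gauss_pdf_ge0 n (m : 'rV[R]_n) s y : (0 <= gauss_pdf m s y)%R.
Proof. by apply: prodr_ge0 => i _; exact: normal_pdf_ge0. Qed.

Lemma measurable_gauss_pdf n (m : 'rV[R]_n) s :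
  measurable_fun [set: 'rV[R]_n] (gauss_pdf m s).
Proof.
apply: measurable_prod => i _.
by apply: measurableT_comp; [exact: measurable_normal_pdf|exact: measurable_coord].
Qed.

Lemma ge0_integral_product_rV (m : {sigma_finite_measure set (measurableTypeR R) -> \bar R})
    n (f : 'rV[R]_n.+1 -> \bar R) :
  measurable_fun [set: 'rV[R]_n.+1] f -> (forall x, 0 <= f x) ->
  \int[product_rV m n.+1]_x f x =
  \int[m]_a \int[product_rV m n]_y f (cons_rV (a, y)).
Proof.
move=> mf f0; rewrite /= /cons_measure.
rewrite (ge0_integral_pushforward (@measurable_cons_rV R n))//.
rewrite fubini_tonelli1//.
  by apply: measurableT_comp => //; exact: measurable_cons_rV.
by move=> x; exact: f0.
Qed.

(** Peeling off the first coordinate reduces the claim to Tonelli's theorem and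
    the scalar case. *)
Lemma ge0_integral_gaussian_rV n (m : 'rV[R]_n) (s : R) (f : 'rV[R]_n -> \bar R) :
  (0 < s)%R -> measurable_fun [set: 'rV[R]_n] f -> (forall x, 0 <= f x) ->
  \int[gaussian_rV n]_g f (m + s *: g)%R =
  \int[lebesgue_rV n]_y (f y * (gauss_pdf m s y)%:E).
Proof.
move=> s0; elim: n m f => [|n IH] m f mf f0.
  have d0 (g : 'rV[R]_0 -> \bar R) : measurable_fun setT g ->
      (forall x, 0 <= g x) -> \int[\d_(0%R : 'rV[R]_0)]_x g x = g 0%R.
    by move=> mg g0; rewrite integral_dirac// diracT mul1e.
  have f0E x : f x = f 0%R by rewrite (thinmx0 x).
  rewrite /gaussian_rV /lebesgue_rV/= !d0//.
  - by rewrite /gauss_pdf big_ord0 mule1 f0E.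
  - apply: emeasurable_funM => //; apply/measurable_EFinP.
    exact: measurable_gauss_pdf.
  - by move=> x; rewrite mule_ge0// lee_fin gauss_pdf_ge0.
  - by rewrite (_ : (fun x => _) = cst (f 0%R)) //; apply/funext => x; exact: f0E.
pose m' := (uncons_rV m).2.
have gE a y : gauss_pdf m s (cons_rV (a, y)) =
    (normal_pdf (m ord0 ord0) s a * gauss_pdf m' s y)%R.
  rewrite /gauss_pdf big_ord_recl cons_rV0; congr (_ * _)%R.
  by apply: eq_bigr => i _; rewrite cons_rVS mxE.
have mg : measurable_fun setT (fun y => (gauss_pdf m' s y)%:E).
  by apply/measurable_EFinP; exact: measurable_gauss_pdf.
have mfc : measurable_fun [set: measurableTypeR R * 'rV[R]_n] (fun z => f (cons_rV z)).
  by apply: measurableT_comp => //; exact: measurable_cons_rV.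
have mfc1 a : measurable_fun [set: 'rV[R]_n] (fun y => f (cons_rV (a, y))).
  by apply: (measurableT_comp mfc); exact: pair1_measurable.
rewrite [LHS]ge0_integral_product_rV//; last first.
  apply: measurableT_comp => //; apply: measurable_mx => i j.
  under eq_fun do rewrite !mxE.
  by apply: measurable_funD => //; apply: measurable_funM => //; exact: measurable_coord.
rewrite [RHS]ge0_integral_product_rV//; last 2 first.
- by apply: emeasurable_funM => //; apply/measurable_EFinP; exact: measurable_gauss_pdf.
- by move=> x; rewrite mule_ge0// lee_fin gauss_pdf_ge0.
pose Phi a := \int[lebesgue_rV n]_y (f (cons_rV (a, y)) * (gauss_pdf m' s y)%:E).
transitivity (\int[normal_prob (0%R : R) 1%R]_a Phi (m ord0 ord0 + s * a)%R).
  apply: eq_integral => a _; rewrite /Phi -IH//.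
  apply: eq_integral => y _; congr f; apply/rowP => j.
  rewrite [LHS]mxE [X in (_ + X)%R]mxE.
  case: (unliftP ord0 j) => [i|] ->; last by rewrite !cons_rV0.
  by rewrite !cons_rVS/= [RHS]mxE [X in (_ = X + _)%R]mxE [X in (_ = _ + X)%R]mxE.
have mF : measurable_fun [set: measurableTypeR R * 'rV[R]_n]
    (fun z => f (cons_rV z) * (gauss_pdf m' s z.2)%:E).
  by apply: emeasurable_funM => //; exact: (measurableT_comp mg).
rewrite ge0_integral_normal_affine//.
- apply: eq_integral => a _; rewrite muleC -ge0_integralZl//.
  + by apply: eq_integral => y _; rewrite gE EFinM muleCA.
  + by apply: emeasurable_funM.
  + by move=> y _; rewrite mule_ge0// lee_fin gauss_pdf_ge0.
  + by rewrite lee_fin normal_pdf_ge0.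
- have := @measurable_fun_fubini_tonelli_F _ _ _ _ R (lebesgue_rV n) _ mF.
  move=> H; apply: H.
  by move=> z; rewrite mule_ge0// lee_fin gauss_pdf_ge0.
- by move=> a; apply: integral_ge0 => y _; rewrite mule_ge0// lee_fin gauss_pdf_ge0.
Qed.

End gaussian_density.

(** * Gaussian steps weighted by a function vanishing at infinity *)

Section gaussian_kernel.
Context {R : realType} (n : nat).
Local Notation E := 'rV[R]_n.
Local Notation gam := (@gaussian_rV R n).

Lemma gaussian_rV_setT : gam [set: E] = 1%E.
Proof.
have := @product_rV_box R (normal_prob (0 : R) (1 : R)) n (fun=> setT)
  (fun=> measurableT).
rewrite (_ : [set x | _] = setT); last exact/seteqP.
by move=> ->; rewrite big1// => i _; exact: probability_setT.
Qed.

Let gam_fin : (gam [set: E] < +oo)%E.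
Proof. by rewrite gaussian_rV_setT ltry. Qed.

Lemma measurable_shift_scale (m : E) (s : R) :
  measurable_fun [set: E] (fun g : E => m + s *: g).
Proof.
apply: measurable_mx => i j; under eq_fun do rewrite !mxE.
apply: measurable_funD => //; apply: measurable_funM => //.
exact: measurable_coord.
Qed.

Definition gauss_mean (m : E) (s : R) (f : E -> R) : R :=
  \int[gam]_g f (m + s *: g).

Lemma pos_gauss_mean m s : pos_functional (gauss_mean m s).
Proof.
exact: (pos_functional_comp (measurable_shift_scale m s)
  (pos_functional_integral gam_fin)).
Qed.

Lemma gauss_mean1 m s : gauss_mean m s (cst 1) = 1.
Proof.
by rewrite /gauss_mean (Rintegral_cst gam)// mul1r [X in fine X]gaussian_rV_setT.
Qed.

Lemma gauss_meanE m s f : 0 < s -> bmeas f -> (forall y, 0 <= f y) ->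
  (gauss_mean m s f)%:E =
  (\int[lebesgue_rV n]_y ((f y)%:E * (gauss_pdf m s y)%:E))%E.
Proof.
move=> s0 bf f0.
have bfm : bmeas (fun g : E => f (m + s *: g)).
  have [mf [M fM]] := bf; split; last by exists M => x; exact: fM.
  by apply: measurableT_comp => //; exact: measurable_shift_scale.
rewrite /gauss_mean -bmeas_integralE//.
rewrite (ge0_integral_gaussian_rV m (f := EFin \o f))//.
by apply/measurable_EFinP; case: bf.
Qed.

Lemma gauss_mean_le (m m' : E) (s s' c : R) f : 0 < s -> 0 < s' -> 0 <= c ->
  bmeas f -> (forall y, 0 <= f y) ->
  (forall y, f y * gauss_pdf m s y <= f y * (c * gauss_pdf m' s' y)) ->
  gauss_mean m s f <= c * gauss_mean m' s' f.
Proof.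
move=> s0 s'0 c0 bf f0 H; rewrite -lee_fin EFinM !gauss_meanE//.
have mf : measurable_fun [set: E] (EFin \o f) by apply/measurable_EFinP; case: bf.
have mfp m1 s1 : measurable_fun [set: E] (fun y => (f y)%:E * (gauss_pdf m1 s1 y)%:E)%E.
  by apply: emeasurable_funM => //; apply/measurable_EFinP; exact: measurable_gauss_pdf.
have p0 m1 s1 y : (0 <= (f y)%:E * (gauss_pdf m1 s1 y)%:E)%E.
  by rewrite mule_ge0// lee_fin// gauss_pdf_ge0.
rewrite -ge0_integralZl//.
apply: ge0_le_integral => //.
- by apply: measurable_funeM; exact: mfp.
- by move=> y _; rewrite -!EFinM lee_fin (le_trans (H y))// mulrCA.
Qed.

(** Absolute continuity of the Gaussian law: operators built on [gauss_mean] act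
    on classes of functions modulo null sets. *)
Lemma gauss_mean_ae m s (f g : E -> R) : 0 < s ->
  measurable_fun [set: E] f -> measurable_fun [set: E] g ->
  {ae lebesgue_rV n, forall x, f x = g x} ->
  gauss_mean m s f = gauss_mean m s g.
Proof.
move=> s0 mf mg [N [mN N0 fgN]].
congr fine; apply: ae_eq_integral => //.
- by apply/measurable_EFinP; apply: measurableT_comp => //; exact: measurable_shift_scale.
- by apply/measurable_EFinP; apply: measurableT_comp => //; exact: measurable_shift_scale.
exists ((fun x : E => m + s *: x) @^-1` N); split.
- rewrite -[X in measurable X]setTI.
  exact: measurable_shift_scale.
- have := @ge0_integral_gaussian_rV R n m s (fun x => (\1_N x)%:E) s0.
  move=> /(_ _ _)/wrap[|x|].
  + by apply/measurable_EFinP; exact: measurable_indic.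
  + by rewrite lee_fin indicE.
  rewrite (_ : (fun g0 => _) = (fun x => (\1_((fun x : E => m + s *: x) @^-1` N) x)%:E)); last by [].
  rewrite integral_indic//=; last first.
    by rewrite -[X in measurable X]setTI; exact: measurable_shift_scale.
  rewrite setIT => ->.
  rewrite (ae_eq_integral (cst 0%E))//; first exact: integral0.
  + apply: emeasurable_funM; apply/measurable_EFinP; [exact: measurable_indic|exact: measurable_gauss_pdf].
  + exists N; split => // x /= H; apply: contrapT => Nx; apply: H => _.
    by rewrite indicE memNset// mul0e.
- move=> x /= H; apply: fgN => /= fg; apply: H => _; by rewrite /= fg.
Qed.

Section pdf_bounds.
Context (s : R) (s0 : 0 < s).
Let tau := s / Num.sqrt 2.
Let tau0 : 0 < tau. Proof. by rewrite divr_gt0// sqrtr_gt0. Qed.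
Let tau2 : tau ^+ 2 *+ 2 = s ^+ 2.
Proof. by rewrite expr_div_n sqr_sqrtr// -mulr_natr divfK. Qed.
Let peak_gt0 (t : R) : 0 < t -> 0 < normal_peak t.
Proof. by move=> t0; apply: normal_peak_gt0; rewrite gt_eqF. Qed.

(** The reference law has standard deviation [s / sqrt 2]. It is narrower than
    the noise, so that [(y - m)^2 <= 2 y^2 + 2 m^2] bounds each Gaussian density
    of deviation [s] from below by a multiple of the reference density, uniformly
    in [y] and in bounded [m]. *)
Definition reference_std := tau.
Lemma reference_std_gt0 : 0 < reference_std. Proof. exact: tau0. Qed.

Let rat := normal_peak s / normal_peak tau.
Let rat0 : 0 < rat. Proof. by rewrite divr_gt0// peak_gt0. Qed.

Let pdf_lower (r m y : R) : `|m| <= r ->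
  rat * expR (- (r ^+ 2 / s ^+ 2)) * normal_pdf 0 tau y <= normal_pdf m s y.
Proof.
move=> mr; rewrite !normal_pdfE ?gt_eqF//.
have -> : rat * expR (- (r ^+ 2 / s ^+ 2)) * (normal_peak tau * normal_fun 0 tau y)
   = normal_peak s * (expR (- (r ^+ 2 / s ^+ 2)) * normal_fun 0 tau y).
  by rewrite /rat; field; rewrite gt_eqF// peak_gt0.
rewrite ler_pM2l ?peak_gt0// /normal_fun -expRD ler_expR tau2 subr0.
have s20 : 0 < s ^+ 2 by exact: exprn_gt0.
rewrite !mulNr -opprD lerN2 -mulrDl -[in leRHS](mulr1 (s ^+ 2)) .
have -> : (y - m) ^+ 2 / (s ^+ 2 *+ 2) = ((y - m) ^+ 2 / 2) / s ^+ 2.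
  by rewrite -mulr_natr; field; rewrite gt_eqF.
rewrite mulr1 ler_pM2r ?invr_gt0// ler_pdivrMr//.
have mr2 : m ^+ 2 <= r ^+ 2.
  by rewrite -real_normK ?num_real// lerXn2r ?nnegrE// (le_trans _ mr).
have := sqr_ge0 (y + m); rewrite sqrrD sqrrB; move: mr2; lra.
Qed.

Let pdf_upper (r m y : R) : `|y| <= r ->
  normal_pdf m s y <= rat * expR (r ^+ 2 / s ^+ 2) * normal_pdf 0 tau y.
Proof.
move=> yr; apply: (le_trans (normal_pdf_ub _ _ _)); first by rewrite gt_eqF.
rewrite !normal_pdfE ?gt_eqF//.
have -> : rat * expR (r ^+ 2 / s ^+ 2) * (normal_peak tau * normal_fun 0 tau y)
   = normal_peak s * (expR (r ^+ 2 / s ^+ 2) * normal_fun 0 tau y).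
  by rewrite /rat; field; rewrite gt_eqF// peak_gt0.
rewrite ler_peMr ?(ltW (peak_gt0 _))// /normal_fun -expRD -[leLHS]expR0 ler_expR.
rewrite tau2 subr0 mulNr subr_ge0 ler_pM2r ?invr_gt0 ?exprn_gt0//.
by rewrite -real_normK ?num_real// lerXn2r ?nnegrE// (le_trans _ yr).
Qed.

Lemma gauss_pdf_lower (r : R) : exists2 c, 0 < c & forall (m y : E),
  (forall i, `|m ord0 i| <= r) ->
  c * gauss_pdf 0 reference_std y <= gauss_pdf m s y.
Proof.
exists ((rat * expR (- (r ^+ 2 / s ^+ 2))) ^+ n).
  by rewrite exprn_gt0// mulr_gt0// expR_gt0.
move=> m y mr; rewrite /gauss_pdf.
rewrite -[X in _ ^+ X]card_ord -prodr_const -big_split/=.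
apply: ler_prod => i _; rewrite mxE pdf_lower// andbT.
apply: mulr_ge0; last exact: normal_pdf_ge0.
by apply: mulr_ge0; [exact: ltW|exact: expR_ge0].
Qed.

Lemma gauss_pdf_upper (r : R) : exists2 c, 0 < c & forall (m y : E),
  (forall i, `|y ord0 i| <= r) ->
  gauss_pdf m s y <= c * gauss_pdf 0 reference_std y.
Proof.
exists ((rat * expR (r ^+ 2 / s ^+ 2)) ^+ n).
  by rewrite exprn_gt0// mulr_gt0// expR_gt0.
move=> m y yr; rewrite /gauss_pdf.
rewrite -[X in _ ^+ X]card_ord -prodr_const -big_split/=.
by apply: ler_prod => i _; rewrite mxE normal_pdf_ge0 pdf_upper.
Qed.

End pdf_bounds.

Section confining_gaussian.
Context (mean : E -> E) (s : R) (w : E -> R).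
Context (mmean : measurable_fun [set: E] mean) (s0 : 0 < s).
Context (mw : measurable_fun [set: E] w) (w0 : forall x, 0 < w x).
Context (W : R) (wW : forall x, w x <= W).
Context (wr : forall dl, 0 < dl -> exists r : R, forall x, dl <= w x ->
  forall i, `|x ord0 i| <= r /\ `|mean x ord0 i| <= r).

Let Q (f : E -> R) x := w x * gauss_mean (mean x) s f.

Let measurable_mean_plus :
  measurable_fun [set: E * E] (fun z : E * E => mean z.1 + s *: z.2).
Proof.
apply: measurable_mx => i j; under eq_fun do rewrite !mxE.
apply: measurable_funD => //.
  apply: (measurableT_comp (measurable_coord i j)).
  exact: measurableT_comp.
apply: measurable_funM => //.
by apply: (measurableT_comp (measurable_coord i j)).
Qed.

Let bQ f : bmeas f -> bmeas (Q f).
Proof.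
move=> bf; have [mf [M fM]] := bf.
have fM0 x : 0 <= f x + M.
  by rewrite -lerBlDr sub0r; have := fM x; rewrite ler_norml => /andP[].
have bfM : bmeas (fun x => f x + cst M x) by apply: bmeasD => //; exact: bmeas_cst.
have mi : measurable_fun [set: E] (fun x => gauss_mean (mean x) s f).
  rewrite (_ : (fun x => _) = (fun x => gauss_mean (mean x) s (fun y => f y + cst M y) - M)); last first.
    apply/funext => x; rewrite (posD (pos_gauss_mean _ _))//; last exact: bmeas_cst.
    by rewrite (pos_cst (pos_gauss_mean _ _)) gauss_mean1 mulr1 addrK.
  apply: measurable_funB => //.
  apply: (measurableT_comp (fine_measurable measurableT)).
  have mF : measurable_fun [set: E * E]
      (fun z : E * E => (f (mean z.1 + s *: z.2) + M)%:E).
    apply/measurable_EFinP; apply: measurable_funD => //.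
    exact: measurableT_comp.
  have := @measurable_fun_fubini_tonelli_F _ _ _ _ R gam _ mF.
  by move=> H; apply: H => z; rewrite lee_fin.
split; first exact: measurable_funM.
exists (W * M) => x; rewrite /Q normrM ler_pM//.
  by rewrite gtr0_norm.
rewrite (_ : M = gauss_mean (mean x) s (cst M)).
  apply: (pos_abs (pos_gauss_mean _ _)) => //; exact: bmeas_cst.
by rewrite (pos_cst (pos_gauss_mean _ _)) gauss_mean1 mulr1.
Qed.

Let pQ x : pos_functional (fun f => Q f x).
Proof. by apply: pos_functionalZ; [exact: ltW|exact: pos_gauss_mean]. Qed.

Let Q1 x : Q (cst 1) x = w x.
Proof. by rewrite /Q gauss_mean1 mulr1. Qed.

(** A weight that tends to 0 at infinity has bounded level sets; there the centre
    of the Gaussian step stays bounded, which gives the minorization, and the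
    reference density is bounded below, which gives the majorization. *)
Lemma confining_gaussian : confining Q (gauss_mean 0 (reference_std s)).
Proof.
have tau0 := reference_std_gt0 s0.
split.
- by split.
- exact: pos_gauss_mean.
- exact: gauss_mean1.
- by move=> x; rewrite Q1.
- move=> dl dl0; have [r rP] := wr dl0.
  have [c c0 cP] := gauss_pdf_lower s0 r.
  exists (dl * c); first exact: mulr_gt0.
  move=> f x bf f0; rewrite Q1 => dlx.
  rewrite -mulrA; apply: ler_pM => //; first exact: ltW.
    by apply: mulr_ge0; [exact: ltW|exact: (pos_ge0 (pos_gauss_mean _ _))].
  have := @gauss_mean_le 0 (mean x) (reference_std s) s c^-1 f tau0 s0.
  rewrite invr_ge0 (ltW c0) => /(_ isT bf f0) H.
  rewrite -ler_pdivlMl//; apply: H => y; rewrite ler_wpM2l// ler_pdivlMl//.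
  by apply: cP => i; have [] := rP x dlx i.
- move=> dl dl0; have [r rP] := wr dl0.
  have [c c0 cP] := gauss_pdf_upper s0 r.
  exists (`|W| * c + 1).
    by apply: ltr_wpDl => //; apply: mulr_ge0 => //; exact: ltW.
  move=> f x bf f0 fdl.
  have nu0 : 0 <= gauss_mean 0 (reference_std s) f by exact: (pos_ge0 (pos_gauss_mean _ _)).
  apply: (@le_trans _ _ (`|W| * (c * gauss_mean 0 (reference_std s) f))); last first.
    by rewrite mulrA ler_wpM2r// lerDl.
  apply: ler_pM => //.
  + exact: ltW.
  + exact: (pos_ge0 (pos_gauss_mean _ _)).
  + by rewrite (le_trans (wW x))// ler_norm.
  apply: gauss_mean_le => //; first exact: ltW.
  move=> y; have [wy|wy] := leP dl (w y).
    by rewrite ler_wpM2l//; apply: cP => i; have [] := rP y wy i.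
  by rewrite fdl ?mul0r// Q1.
Qed.

End confining_gaussian.

End gaussian_kernel.

(** * Growth of the potential *)

Section euclidean_norm.
Context {R : realType} (n : nat).
Local Notation E := 'rV[R]_n.
Implicit Types (x y : E) (M : 'M[R]_n).

Lemma dotv_ge0 x : 0 <= dotv x x.
Proof. by apply: sumr_ge0 => i _; rewrite -expr2 sqr_ge0. Qed.

Lemma enorm_ge0 x : 0 <= enorm x. Proof. exact: sqrtr_ge0. Qed.

Lemma coord_le_enorm x i : `|x ord0 i| <= enorm x.
Proof.
rewrite -sqrtr_sqr; apply: ler_wsqrtr; rewrite /dotv (bigD1 i)//= -expr2 lerDl.
by apply: sumr_ge0 => j _; rewrite -expr2 sqr_ge0.
Qed.

Lemma enorm_le_sum x : enorm x <= \sum_i `|x ord0 i|.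
Proof.
have S0 : 0 <= \sum_i `|x ord0 i| by apply: sumr_ge0.
rewrite -[leRHS](ger0_norm S0) -sqrtr_sqr; apply: ler_wsqrtr.
rewrite expr2 mulr_suml; apply: ler_sum => i _.
rewrite -expr2 -real_normK ?num_real// expr2 ler_wpM2l//.
by rewrite (bigD1 i)//= lerDl; apply: sumr_ge0.
Qed.

Lemma dotv_mulv_le x y M :
  dotv x (mulv M y) <= enorm x * ((\sum_i \sum_j `|M i j|) * enorm y).
Proof.
rewrite mulr_suml mulr_sumr; apply: ler_sum => i _.
rewrite (le_trans (ler_norm _))// normrM; apply: ler_pM => //.
  exact: coord_le_enorm.
rewrite mxE (le_trans (ler_norm_sum _ _ _))// mulr_suml; apply: ler_sum => j _.
by rewrite normrM mxE mulrC ler_wpM2l// coord_le_enorm.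
Qed.

Lemma trace_le_opnorm M : `|\tr M| <= n%:R * opnorm M.
Proof.
rewrite (le_trans (ler_norm_sum _ _ _))//.
rewrite -[X in X%:R]card_ord -sum1_card natr_sum mulr_suml; apply: ler_sum => i _.
rewrite mul1r; pose e : E := delta_mx ord0 i.
have e1 : enorm e <= 1.
  rewrite (le_trans (enorm_le_sum _))// (bigD1 i)//= mxE !eqxx normr1.
  by rewrite big1 ?addr0// => j /negbTE ji; rewrite mxE ji andbF normr0.
apply: (@le_trans _ _ (enorm (mulv M e))).
  apply: le_trans (coord_le_enorm _ i); rewrite mxE (bigD1 i)//= !mxE !eqxx mul1r.
  by rewrite big1 ?addr0// => j /negbTE ji; rewrite !mxE ji andbF mul0r.
apply: ub_le_sup; last by exists e.
exists (\sum_i \sum_j `|M i j|) => _ [x /= x1 <-].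
rewrite (le_trans (enorm_le_sum _))//; apply: ler_sum => j _.
rewrite mxE (le_trans (ler_norm_sum _ _ _))//; apply: ler_sum => k _.
rewrite normrM mxE -[leRHS]mul1r ler_wpM2r//.
by rewrite (le_trans (coord_le_enorm _ _)).
Qed.

Lemma continuous_measurable_mx (f : E -> R) : continuous f ->
  measurable_fun [set: E] f.
Proof.
move=> cf; apply: (measurability _ (RGenOpens.measurableE R)).
move=> _ [_ [x [y ->]] <-]; rewrite setTI; apply: sub_sigma_algebra.
by apply: open_comp; [move=> ? _; exact: cf|exact: interval_open].
Qed.

Lemma continuous_bounded_ball (f : E -> R) (r : R) : continuous f ->
  exists B : R, forall x, enorm x <= r -> f x <= B.
Proof.
move=> cf.
have cK : compact [set x : E | forall i, `[- `|r|, `|r|]%classic (x ord0 i)].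
  apply: (@rV_compact R n (fun=> `[- `|r|, `|r|]%classic)) => i.
  exact: segment_compact.
have := continuous_compact (continuous_subspaceT cf) cK.
move=> /compact_bounded [M [_ HM]]; exists (`|M| + 1) => x xr.
have := HM (`|M| + 1); rewrite (le_lt_trans (ler_norm M)) ?ltrDl// => /(_ isT (f x)).
move=> H; rewrite (le_trans (ler_norm _))//; apply: H; exists x => //=.
by move=> i; rewrite /= in_itv/= -ler_norml (le_trans (coord_le_enorm _ _))// (le_trans xr)// ler_norm.
Qed.

End euclidean_norm.

Section potential_bounds.
Context {R : realType} (d : nat) (eps alpha dt : R).
Context (V : 'rV[R]_d -> R) (b : 'rV[R]_d -> 'rV[R]_d).
Context (eps0 : 0 < eps) (dt0 : 0 < dt) (hA : assumptionA V)
  (hB : assumptionB V b).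
Local Notation E := 'rV[R]_d.
Local Notation U := (potential eps alpha V b).

Let cV : smooth V. Proof. by case: hA. Qed.
Let cb i : smooth (component b i). Proof. by case: hB. Qed.

Lemma b_bounded : exists B : R,
  [/\ 0 <= B, forall x, enorm (b x) <= B & forall x, opnorm (jac b x) <= B].
Proof.
have [_ + _] := hB; rewrite /C1norm.
set s1 := ereal_sup _; set s2 := ereal_sup _ => s12.
have u1 x : ((enorm (b x))%:E <= s1)%E by apply: ereal_sup_ubound; exists x.
have u2 x : ((opnorm (jac b x))%:E <= s2)%E by apply: ereal_sup_ubound; exists x.
have s1N : (-oo < s1)%E by apply: lt_le_trans (u1 0); rewrite ltNyr.
have s2N : (-oo < s2)%E by apply: lt_le_trans (u2 0); rewrite ltNyr.
have s1f : s1 \is a fin_num.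
  rewrite fin_real// s1N/= ltey; apply/eqP => sy; move: s12.
  by rewrite sy addye ?ltxx// gt_eqF.
have s2f : s2 \is a fin_num.
  rewrite fin_real// s2N/= ltey; apply/eqP => sy; move: s12.
  by rewrite sy addey ?ltxx// gt_eqF.
exists (Num.max (fine s1) (fine s2)); split => [|x|x].
- rewrite le_max -lee_fin fineK// (le_trans _ (u1 0))// lee_fin.
  exact: enorm_ge0.
- by rewrite le_max -lee_fin fineK// u1.
- by rewrite le_max -[X in _ || X]lee_fin fineK// u2 orbT.
Qed.

Lemma measurable_b : measurable_fun [set: E] b.
Proof.
apply: measurable_mx => i j; rewrite ord1.
apply: (@continuous_measurable_mx _ _ (component b j)).
by have [+ _] := cb j [::].
Qed.

Lemma measurable_partial i (f : E -> R) : smooth f ->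
  measurable_fun [set: E] (partial i f).
Proof.
by move=> /(_ [:: i]) [+ _]; exact: continuous_measurable_mx.
Qed.

Lemma continuous_laplacian : continuous (laplacian V).
Proof.
rewrite (_ : laplacian V = fun x => \sum_(i < d) iter_partial [:: i; i] V x).
  elim: (index_enum _) => [|i r IH].
    rewrite (_ : (fun x => _) = cst 0); first exact: cst_continuous.
    by apply/funext => x; rewrite big_nil.
  rewrite (_ : (fun x => _) = fun x => iter_partial [:: i; i] V x +
      \sum_(i <- r) iter_partial [:: i; i] V x).
    have [ci _] := cV [:: i; i]; move=> x.
    exact: (@cvgD _ _ _ _ _ _ _ _ _ (ci x) (IH x)).
  by apply/funext => x; rewrite big_cons.
by apply/funext => x; apply: eq_bigr => i _; rewrite mxE.
Qed.

Lemma measurable_dotv (f g : E -> E) :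
  measurable_fun [set: E] f -> measurable_fun [set: E] g ->
  measurable_fun [set: E] (fun x => dotv (f x) (g x)).
Proof.
move=> mf mg; apply: measurable_sum => i; apply: measurable_funM.
  exact: (measurableT_comp (measurable_coord ord0 i)).
exact: (measurableT_comp (measurable_coord ord0 i)).
Qed.

Lemma measurable_enorm_sq (f : E -> E) : measurable_fun [set: E] f ->
  measurable_fun [set: E] (fun x => enorm (f x) ^+ 2).
Proof.
move=> mf; rewrite (_ : (fun x => _) = fun x => dotv (f x) (f x)).
  exact: measurable_dotv.
by apply/funext => x; rewrite sqr_sqrtr// dotv_ge0.
Qed.

Lemma measurable_potential : measurable_fun [set: E] U.
Proof.
have mg : measurable_fun [set: E] (grad V).
  apply: measurable_mx => i j; under eq_fun do rewrite mxE.
  exact: measurable_partial.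
have mb := measurable_b.
apply: measurable_funB; first apply: measurable_funD.
- apply: measurable_funB; first apply: measurable_funD.
  + by apply: measurable_funM => //; exact: measurable_enorm_sq.
  + by apply: measurable_funM => //; exact: measurable_dotv.
  + by apply: measurable_funM => //; exact: measurable_enorm_sq.
- by apply: measurable_funM => //; exact: (continuous_measurable_mx continuous_laplacian).
- apply: measurable_funM => //; apply: measurable_sum => i.
  under eq_fun do rewrite mxE; exact: measurable_partial.
Qed.

(** The cross term of the potential eats only the fraction [2 c < 1] of
    [|grad V|^2 / (4 eps)]; the terms in [b] alone are bounded. *)
Lemma potential_le : exists k K : R, 0 < k /\ forall x,
  U x <= - k * enorm (grad V x) ^+ 2 + 2^-1 * laplacian V x + K.
Proof.
have [_ _ [c [/andP[c0 c2] bV]]] := hB.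
have [B [B0 bB jB]] := b_bounded.
exists ((1 - 2 * c) / (4 * eps)), (`|alpha * (1 - alpha) / eps| * B ^+ 2 + `|alpha| * (d%:R * B)).
split.
  apply: divr_gt0; last by rewrite mulr_gt0.
  by move: c2; rewrite -[X in _ < X]mul1r ltr_pdivlMr//; lra.
move=> x; rewrite /potential.
have t1 : (2 * eps)^-1 * dotv (b x) (grad V x) <= (2 * eps)^-1 * (c * enorm (grad V x) ^+ 2).
  by rewrite ler_pM2l ?invr_gt0 ?mulr_gt0.
have t2 : - (alpha * (1 - alpha) / eps * enorm (b x) ^+ 2) <=
    `|alpha * (1 - alpha) / eps| * B ^+ 2.
  rewrite (le_trans (ler_norm _))// normrN normrM ler_wpM2l//.
  rewrite ger0_norm ?sqr_ge0// lerXn2r ?nnegrE ?enorm_ge0//.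
have t3 : - (alpha * divergence b x) <= `|alpha| * (d%:R * B).
  rewrite (le_trans (ler_norm _))// normrN normrM ler_wpM2l//.
  by rewrite (le_trans (trace_le_opnorm _))// ler_wpM2l.
have -> : - ((1 - 2 * c) / (4 * eps)) * enorm (grad V x) ^+ 2 =
   - (4 * eps)^-1 * enorm (grad V x) ^+ 2 + (2 * eps)^-1 * (c * enorm (grad V x) ^+ 2).
  by field; rewrite gt_eqF.
move: t1 t2 t3; lra.
Qed.

(** By Cauchy-Schwarz, [|x|^2 <= <x, H0 grad V>] forces [grad V] to grow at least
    linearly, and [D^2 V = o(|grad V|)] makes the Laplacian linear in
    [|grad V|], hence negligible against the quadratic term. *)
Lemma potential_far : exists r k K : R, 0 < k /\ forall x, r <= enorm x ->
  U x <= K - k * enorm x ^+ 2.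
Proof.
have [k [K [k0 UkK]]] := potential_le.
have [_ [H0 _ [r1 Hr1]] /(_ 1 ltr01)[r2 Hr2]] := hA.
pose S := \sum_i \sum_j `|H0 i j|.
have S0 : 0 <= S by apply: sumr_ge0 => i _; apply: sumr_ge0.
exists (Num.max 1 (Num.max r1 r2)), (k / 2 / (S ^+ 2 + 1)), (K + d%:R ^+ 2 / (8 * k)).
have S1 : 0 < S ^+ 2 + 1 by rewrite ltr_wpDl// sqr_ge0.
split; first by rewrite !divr_gt0.
move=> x; rewrite !ge_max => /and3P[x1 xr1 xr2].
set G := enorm (grad V x).
have x0 : 0 < enorm x by exact: lt_le_trans x1.
have G0 : 0 <= G by exact: enorm_ge0.
have xG : enorm x <= S * G.
  have := Hr1 x xr1; move=> /le_trans /(_ (dotv_mulv_le _ _ _)).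
  by rewrite expr2 ler_pM2l.
have lapl : laplacian V x <= d%:R * G.
  rewrite (le_trans (ler_norm _))// (le_trans (trace_le_opnorm _))//.
  by rewrite ler_wpM2l// -[leRHS]mul1r; exact: Hr2.
have x2 : enorm x ^+ 2 <= (S ^+ 2 + 1) * G ^+ 2.
  apply: (@le_trans _ _ ((S * G) ^+ 2)); first by rewrite lerXn2r ?nnegrE ?mulr_ge0// ltW.
  by rewrite exprMn ler_wpM2r ?sqr_ge0// lerDl.
have kx : k / 2 / (S ^+ 2 + 1) * enorm x ^+ 2 <= k / 2 * G ^+ 2.
  rewrite -mulrA ler_pM2l ?divr_gt0// ler_pdivrMl//.
have sq : 2^-1 * (d%:R * G) <= k / 2 * G ^+ 2 + d%:R ^+ 2 / (8 * k).
  rewrite -subr_ge0.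
  have -> : k / 2 * G ^+ 2 + d%:R ^+ 2 / (8 * k) - 2^-1 * (d%:R * G) =
     (2 * k * G - d%:R) ^+ 2 / (8 * k).
    by field; rewrite gt_eqF.
  by rewrite divr_ge0 ?sqr_ge0// mulr_ge0// ltW.
have := UkK x; rewrite -/G; move: lapl kx sq; lra.
Qed.

Lemma potential_bounded : exists M : R, forall x, U x <= M.
Proof.
have [r [k [K [k0 far]]]] := potential_far.
have [k1 [K1 [k10 UkK]]] := potential_le.
have [B lB] := continuous_bounded_ball r continuous_laplacian.
exists (Num.max K (2^-1 * B + K1)) => x; rewrite le_max.
have [xr|rx] := leP (enorm x) r; last first.
  rewrite (le_trans (far x (ltW rx)))// gerBl.
  by rewrite mulr_ge0 ?sqr_ge0// ltW.
apply/orP; right; apply: (le_trans (UkK x)).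
have : 0 <= k1 * enorm (grad V x) ^+ 2 by rewrite mulr_ge0 ?sqr_ge0// ltW.
by move: (lB x xr); lra.
Qed.

Lemma potential_levels (t : R) : exists r : R, forall x, t <= U x -> enorm x <= r.
Proof.
have [r [k [K [k0 far]]]] := potential_far.
exists (Num.max r ((K - t) / k + 1)) => x tU; rewrite le_max.
have [//|rx] := leP (enorm x) r; rewrite /=.
have := le_trans tU (far x (ltW rx)) => H.
have : enorm x ^+ 2 <= (K - t) / k by rewrite ler_pdivlMr//; move: H; lra.
have := sqr_ge0 (enorm x - 2^-1).
have -> : (enorm x - 2^-1) ^+ 2 = enorm x ^+ 2 - enorm x + 4^-1 by field.
lra.
Qed.

Local Notation s := (Num.sqrt (2 * eps * dt)).

Lemma noise_std_gt0 : 0 < s.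
Proof. by rewrite sqrtr_gt0 !mulr_gt0. Qed.

(** The weight [exp (dt * U)] has bounded level sets because [U] tends to minus
    infinity, and on them the centre of a step stays bounded because [b] is
    bounded. *)
Lemma fk_semigroup_confining :
  confining (fk_semigroup eps alpha dt V b) (gauss_mean 0 (reference_std s)).
Proof.
have [M UM] := potential_bounded.
have [B [B0 bB _]] := b_bounded.
have mb := measurable_b.
apply: (@confining_gaussian R d (fun x => x + ((1 - 2 * alpha) * dt) *: b x) s
  (fun x => expR (U x * dt)) _ noise_std_gt0 _ _ (expR (M * dt))).
- apply: measurable_mx => i j; under eq_fun do rewrite !mxE.
  apply: measurable_funD; first exact: measurable_coord.
  by apply: measurable_funM => //; exact: (measurableT_comp (measurable_coord i j)).
- apply: measurableT_comp => //; apply: measurable_funM => //.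
  exact: measurable_potential.
- by move=> x; exact: expR_gt0.
- by move=> x; rewrite ler_expR ler_pM2r.
- move=> dl dl0; have [r rP] := potential_levels (ln dl / dt).
  exists (r + `|(1 - 2 * alpha) * dt| * B) => x dlx i.
  have xr : enorm x <= r.
    by apply: rP; rewrite ler_pdivrMr// -ler_expR lnK.
  have xi := le_trans (coord_le_enorm x i) xr.
  have cB : 0 <= `|(1 - 2 * alpha) * dt| * B by rewrite mulr_ge0.
  split; first by rewrite (le_trans xi)// lerDl.
  rewrite !mxE (le_trans (ler_normD _ _))// lerD// normrM ler_wpM2l//.
  by rewrite (le_trans (coord_le_enorm _ _)).
Qed.

End potential_bounds.

(** * The Feynman-Kac formula *)

Section chain_measurability.
Context {R : realType} (d : nat) (eps alpha dt : R).
Context (V : 'rV[R]_d -> R) (b : 'rV[R]_d -> 'rV[R]_d).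
Context (hA : assumptionA V) (hB : assumptionB V b).
Local Notation E := 'rV[R]_d.

Lemma measurable_em_step d' (S : measurableType d') (X G : S -> E) :
  measurable_fun [set: S] X -> measurable_fun [set: S] G ->
  measurable_fun [set: S] (fun w => em_step eps alpha dt b (X w) (G w)).
Proof.
move=> mX mG; have mb := measurable_b hB.
have mc (Y : S -> E) i j : measurable_fun [set: S] Y -> measurable_fun [set: S] (fun w => Y w i j).
  by move=> mY; exact: (measurableT_comp (measurable_coord i j)).
apply: measurable_mx => i j; under eq_fun do rewrite !mxE.
apply: measurable_funD; first apply: measurable_funD.
- exact: mc.
- by apply: measurable_funM => //; apply: (mc (b \o X)); exact: measurableT_comp.
- by apply: measurable_funM => //; exact: mc.
Qed.

Lemma measurable_em_chain d' (S : measurableType d') (X0 : S -> E)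
    (G : nat -> S -> E) k : measurable_fun [set: S] X0 ->
  (forall i, (i < k)%N -> measurable_fun [set: S] (G i)) ->
  measurable_fun [set: S] (em_chain eps alpha dt b X0 G k).
Proof.
move=> mX; elim: k => [//|k IH] mG.
apply: measurable_em_step; last exact: mG.
by apply: IH => i ik; apply: mG; exact: ltnW.
Qed.

Lemma measurable_fk_weight d' (S : measurableType d') (X : nat -> S -> E) k :
  (forall i, (i < k)%N -> measurable_fun [set: S] (X i)) ->
  measurable_fun [set: S] (fk_weight eps alpha dt V b X k).
Proof.
move=> mX; apply: measurableT_comp => //; apply: measurable_funM => //.
apply: measurable_sum => i.
by apply: measurableT_comp; [exact: measurable_potential|exact: mX].
Qed.

End chain_measurability.

Section past_independent.
Context {R : realType} d' (Omega : measurableType d') (P : probability Omega R).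
Context d1 {T : measurableType d1} (Z : nat -> Omega -> T).
Context (mZ : forall n, measurable_fun [set: Omega] (Z n))
  (iZ : mutually_independent P Z).
Local Open Scope ereal_scope.

(** A pi-system generating the past of the noise before time [k]. *)
Definition past_cylinder (k : nat) : set (set Omega) :=
  [set S | exists2 A : nat -> set T, (forall i, measurable (A i)) &
    S = \bigcap_(i in [set` iota 0 k]) (Z i @^-1` A i)].

Let mZA i A : measurable A -> measurable (Z i @^-1` A).
Proof. by move=> mA; rewrite -[X in measurable X]setTI; exact: mZ. Qed.

Let past_measurable k : past_cylinder k `<=` measurable.
Proof.
move=> S [A mA ->]; apply: fin_bigcap_measurable => // i _; exact: mZA.
Qed.

Lemma past_coordinate k i : (i < k)%N ->
  measurable_fun [set: g_sigma_algebraType (past_cylinder k)]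
    (Z i : g_sigma_algebraType (past_cylinder k) -> T).
Proof.
move=> ik _ A mA; rewrite setTI; apply: sub_sigma_algebra.
exists (fun j => if j == i then A else setT) => [j|]; first by case: ifP.
apply/seteqP; split=> w /=.
  by move=> ZA j _ /=; case: eqP => // ->.
by move=> /(_ i); rewrite /= mem_iota add0n ik eqxx; exact.
Qed.

(** The product rule for finite families gives the claim on cylinders, and two
    finite measures that agree on a pi-system agree on the sigma-algebra it
    generates. *)
Lemma past_indep k S B : <<s past_cylinder k >> S -> measurable B ->
  P (S `&` Z k @^-1` B) = P S * P (Z k @^-1` B).
Proof.
move=> sS mB.
have mZB : measurable (Z k @^-1` B) by exact: mZA.
have fP A : measurable A -> P A \is a fin_num by exact: fin_num_measure.
pose r : {nonneg R} := NngNum (fine_ge0 (measure_ge0 P (Z k @^-1` B))).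
have H : mrestr P mZB S = mscale r P S.
  apply: (g_sigma_algebra_measure_unique (past_cylinder k) _ (fun=> setT)) => //.
  - move=> i; exists (fun=> setT) => //; apply/esym/seteqP; split => //.
  - by rewrite bigcup_const.
  - move=> X Y [A mA ->] [A' mA' ->].
    exists (fun i => A i `&` A' i) => [i|]; first exact: measurableI.
    by rewrite -bigcapI; apply: eq_bigcapr.
  - move=> X [A mA ->]; rewrite -[LHS]/(P (_ `&` Z k @^-1` B)).
    rewrite -[RHS]/((fine (P (Z k @^-1` B)))%:E * P _) fineK ?fP//.
    pose A' i := if i == k then B else A i.
    have mA' i : measurable (A' i) by rewrite /A'; case: ifP.
    have E1 := iZ (iota_uniq 0 k) mA.
    have E2 := iZ (iota_uniq 0 k.+1) mA'.
    have prodE : \prod_(i <- iota 0 k) P (Z i @^-1` A' i) =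
        \prod_(i <- iota 0 k) P (Z i @^-1` A i).
      apply: eq_big_seq => i; rewrite mem_iota add0n => /= ik.
      by rewrite /A' ltn_eqF.
    have A'k : A' k = B by rewrite /A' eqxx.
    rewrite E1 muleC; move: E2; rewrite -addn1 iotaD add0n big_cat/= big_seq1.
    rewrite prodE A'k => <-; congr (P _); apply/seteqP; split=> w /=.
      move=> [H1 H2] i /=; rewrite mem_cat mem_iota add0n mem_seq1 /A'.
      case: eqP => [-> //|ik]; rewrite orbF => /= ik'.
      by apply: H1; rewrite /= mem_iota add0n.
    move=> H1; split.
      move=> i /= ik; have := H1 i; rewrite /= mem_cat ik /A' => /(_ isT).
      by move: ik; rewrite mem_iota add0n => /= ik; rewrite ltn_eqF.
    by have := H1 k; rewrite /= mem_cat mem_seq1 eqxx orbT /A' eqxx; exact.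
  - move=> n; rewrite -ge0_fin_numE//= /mrestr; apply: fP; exact: measurableI.
by move: H; rewrite /mrestr /mscale /r/= fineK ?fP// muleC.
Qed.

(** Freezing lemma: a variable independent of the past can be integrated out
    first. *)
Lemma past_integral k d2 (S : measurableType d2) (Y : Omega -> S)
    (F : S * T -> \bar R) :
  measurable_fun [set: g_sigma_algebraType (past_cylinder k)]
    (Y : g_sigma_algebraType (past_cylinder k) -> S) ->
  measurable_fun [set: S * T] F -> (forall z, 0 <= F z) ->
  forall (g : {sigma_finite_measure set T -> \bar R}), has_law P (Z k) g ->
  \int[P]_w F (Y w, Z k w) = \int[P]_w \int[g]_z F (Y w, z).
Proof.
move=> mY mF F0 g Zg.
have mY' : measurable_fun [set: Omega] Y.
  move=> _ A mA; have := mY measurableT A mA.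
  exact: (smallest_sub (@sigma_algebra_measurable _ Omega) (@past_measurable k)).
have mYZ : measurable_fun [set: Omega] (fun w => (Y w, Z k w)).
  exact: measurable_fun_pair.
pose law1 : {measure set S -> \bar R} :=
  measure_function_pushforward__canonical__measure_function_Measure P mY'.
pose law2 : {measure set (S * T) -> \bar R} :=
  measure_function_pushforward__canonical__measure_function_Measure P mYZ.
have law1T : law1 setT = 1 by exact: probability_setT.
pose p1 : probability S R := HB.pack_for (probability S R) (Measure.sort law1)
   (Measure_isProbability.Build _ _ _ (Measure.sort law1) law1T).
have prodE A : measurable A -> law2 A = (p1 \x g) A.
  move=> mA; apply/esym; apply: product_measure_unique => // X Y' mX mY0.
  rewrite [LHS](_ : _ = P (Y @^-1` X `&` Z k @^-1` Y'))//.
  rewrite past_indep//; last by have := mY measurableT X mX; rewrite setTI.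
  by rewrite Zg.
transitivity (\int[law2]_z F z).
  by rewrite [RHS]ge0_integral_pushforward.
rewrite (eq_measure_integral (p1 \x g)); last by move=> A mA _; exact: prodE.
rewrite fubini_tonelli1//.
transitivity (\int[law1]_y \int[g]_z F (y, z)); first by [].
rewrite [LHS]ge0_integral_pushforward//.
- have := @measurable_fun_fubini_tonelli_F _ _ _ _ R g _ mF.
  by move=> H; apply: H.
- by move=> y _; apply: integral_ge0.
Qed.

End past_independent.

Section feynman_kac_formula.
Context {R : realType} (d : nat) (eps alpha dt : R).
Context (V : 'rV[R]_d -> R) (b : 'rV[R]_d -> 'rV[R]_d).
Context (eps0 : 0 < eps) (dt0 : 0 < dt) (hA : assumptionA V)
  (hB : assumptionB V b).
Local Notation E := 'rV[R]_d.
Local Notation Q := (fk_semigroup eps alpha dt V b).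
Local Notation U := (potential eps alpha V b).
Context (mu : probability E R) d' (Omega : measurableType d')
  (P : probability Omega R) (X0 : {RV P >-> E}) (G : nat -> {RV P >-> E}).
Context (noise : em_noise mu X0 G).
Local Notation X := (em_chain eps alpha dt b X0 G).
Local Notation wt := (fk_weight eps alpha dt V b X).

Let kQ := conf_op (fk_semigroup_confining alpha eps0 dt0 hA hB).

(** Induction on [k]: the last noise increment is independent of the earlier
    ones, so integrating it out turns the last step into one application of
    [Q] to [f]. *)
Lemma feynman_kac k (f : E -> R) : bmeas f -> (forall x, 0 <= f x) ->
  (\int[P]_w (wt k w * f (X k w))%:E = \int[mu]_x (iter k Q f x)%:E)%E.
Proof.
have [lX0 lG iZ] := noise.
pose Z n : Omega -> E := if n is n'.+1 then G n' else X0.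
have mZ n : measurable_fun [set: Omega] (Z n) by case: n.
elim: k f => [|k IH] f bf f0.
  have mf : measurable_fun [set: E] (EFin \o f) by apply/measurable_EFinP; case: bf.
  transitivity (\int[P]_w (EFin \o f) (X0 w))%E.
    by apply: eq_integral => w _; rewrite /fk_weight big_ord0 mulr0 expR0 mul1r.
  have mX0 : measurable_fun [set: Omega] X0 by [].
  transitivity (\int[pushforward P X0]_x (EFin \o f) x)%E.
    by rewrite (ge0_integral_pushforward mX0)//= => x _; rewrite lee_fin.
  by apply: eq_measure_integral => A mA _; exact: lX0.
have bQf : bmeas (Q f) by exact: (kop_bmeas kQ).
have Qf0 x : 0 <= Q f x by exact: (pos_ge0 (kop_pos kQ x)).
rewrite iterSr -IH//.
pose Y w : measurableTypeR R * E := (wt k w, X k w).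
(* the absolute value keeps F nonnegative where the first coordinate is
   negative, a region that Y never visits *)
pose F (z : (measurableTypeR R * E) * E) : \bar R :=
  (`|z.1.1 * expR (U z.1.2 * dt) * f (em_step eps alpha dt b z.1.2 z.2)|)%:E.
have mF : measurable_fun setT F.
  apply/measurable_EFinP; apply: measurableT_comp => //.
  apply: measurable_funM; first apply: measurable_funM.
  - exact: (measurableT_comp measurable_fst measurable_fst).
  - apply: measurableT_comp => //; apply: measurable_funM => //.
    apply: measurableT_comp; first exact: measurable_potential.
    exact: (measurableT_comp measurable_snd measurable_fst).
  - apply: measurableT_comp; first by case: bf.
    apply: (measurable_em_step eps alpha dt hB
      (X := fun z : (measurableTypeR R * E) * E => z.1.2) (G := snd)) => //.
    exact: (measurableT_comp measurable_snd measurable_fst).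
have F0 z : (0 <= F z)%E by rewrite lee_fin.
have mY : measurable_fun [set: g_sigma_algebraType (past_cylinder Z k.+1)]
    (Y : g_sigma_algebraType (past_cylinder Z k.+1) -> measurableTypeR R * E).
  have mZi i : (i < k.+1)%N ->
     measurable_fun [set: g_sigma_algebraType (past_cylinder Z k.+1)]
    (Z i : g_sigma_algebraType (past_cylinder Z k.+1) -> E).
    exact: past_coordinate.
  have mXi i : (i <= k)%N ->
     measurable_fun [set: g_sigma_algebraType (past_cylinder Z k.+1)]
    (X i : g_sigma_algebraType (past_cylinder Z k.+1) -> E).
    move=> ik; apply: (measurable_em_chain _ _ _ hB (S := g_sigma_algebraType (past_cylinder Z k.+1))).
      exact: (mZi 0%N).
    by move=> j ji; apply: (mZi j.+1); rewrite ltnS (leq_trans ji).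
  apply: (@measurable_fun_pair _ _ _ (g_sigma_algebraType (past_cylinder Z k.+1))).
    apply: (measurable_fk_weight _ _ _ hA hB (S := g_sigma_algebraType (past_cylinder Z k.+1))).
    by move=> i ik; apply: mXi; exact: ltnW.
  exact: mXi.
have := past_integral mZ iZ mY mF F0 (lG k).
have wt0 w : 0 <= wt k w by exact: expR_ge0.
have FE w z : F (Y w, z) =
    (wt k w * (expR (U (X k w) * dt) * f (em_step eps alpha dt b (X k w) z)))%:E.
  by rewrite /F /= ger0_norm ?mulrA// mulr_ge0// mulr_ge0 ?expR_ge0.
move=> H; transitivity (\int[P]_w F (Y w, Z k.+1 w))%E.
  apply: eq_integral => w _; rewrite FE /= mulrA; congr (_ * _)%:E.
  by rewrite /fk_weight big_ord_recr/= mulrDr expRD [X in _ * expR X]mulrC.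
rewrite H; apply: eq_integral => w _.
rewrite /fk_semigroup EFinM EFinM /em_semigroup.
have bfe : bmeas (fun g => f (em_step eps alpha dt b (X k w) g)).
  have [mf [M fM]] := bf; split; last by exists M => x; exact: fM.
  apply: measurableT_comp => //.
  exact: measurable_shift_scale.
have gfin : (gaussian_rV d [set: E] < +oo)%E by rewrite gaussian_rV_setT ltry.
rewrite -bmeas_integralE//.
rewrite [LHS](eq_integral (fun g => (wt k w * expR (U (X k w) * dt))%:E *
  (f (em_step eps alpha dt b (X k w) g))%:E))%E; last first.
  by move=> g _; rewrite -EFinM -mulrA; exact: FE.
rewrite ge0_integralZl//.
- by rewrite EFinM muleA.
- by apply/measurable_EFinP; case: bfe.
- by move=> g _; rewrite lee_fin.
- by rewrite lee_fin mulr_ge0// expR_ge0.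
Qed.

End feynman_kac_formula.

(** * The spectrum on essentially bounded functions *)

Section essentially_bounded.
Context {R : realType} (d : nat).
Local Notation E := 'rV[R]_d.
Local Notation leb := (@lebesgue_rV R d).

(** Otherwise the Gaussian law, which has a density, would vanish. *)
Lemma lebesgue_rV_gt0 : (0 < leb [set: E])%E.
Proof.
rewrite lt0e measure_ge0 andbT; apply/eqP => leb0.
have b1 : bmeas (cst 1 : E -> R) by exact: bmeas_cst.
have := @gauss_meanE R d 0 1 (cst 1) ltr01 b1 (fun=> ler01).
rewrite gauss_mean1 null_set_integral//; first by move=> /eqP; rewrite eqe oner_eq0.
apply: emeasurable_funM; apply/measurable_EFinP; first exact: measurable_cst.
exact: measurable_gauss_pdf.
Qed.

Lemma bmeas_Linfty (f : E -> R) : bmeas f -> Linfty f.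
Proof.
move=> [mf [M fM]]; rewrite /Linfty; apply/andP; split; apply/mem_set => //=.
rewrite /finite_norm unlock lebesgue_rV_gt0.
apply: (@le_lt_trans _ _ M%:E); last exact: ltry.
by apply/ess_supP; apply: aeW => x /=; rewrite lee_fin.
Qed.

Lemma Linfty_norm_ge0 (f : E -> R) : 0 <= Linfty_norm f.
Proof. by rewrite fine_ge0// Lnorm_ge0. Qed.

Lemma Linfty_ae_le (f : E -> R) : Linfty f ->
  measurable_fun [set: E] f /\ {ae leb, forall x, `|f x| <= Linfty_norm f}.
Proof.
rewrite /Linfty => /andP[/set_mem mf /set_mem /=].
rewrite /finite_norm /Linfty_norm => fN; split=> //.
have Nf : 'N[leb]_+oo[EFin \o f]%E \is a fin_num by rewrite ge0_fin_numE ?Lnorm_ge0.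
have := ess_sup_ge leb (abse \o (EFin \o f)).
apply: filterS => x /=; rewrite -lee_fin fineK//.
by rewrite unlock lebesgue_rV_gt0.
Qed.

(** Truncation at the essential supremum; the operators of interest do not see
    the change on a null set. *)
Lemma Linfty_bmeas (f : E -> R) : Linfty f -> exists2 g : E -> R,
  bmeas g /\ (forall x, `|g x| <= Linfty_norm f) &
  {ae leb, forall x, f x = g x}.
Proof.
move=> Lf; have [mf fN] := Linfty_ae_le Lf; set N := Linfty_norm f in fN *.
have N0 : 0 <= N := Linfty_norm_ge0 f.
pose g x := Num.max (- N) (Num.min N (f x)).
have gN x : `|g x| <= N.
  rewrite ler_norml /g le_max lexx/= ge_max ge_min lexx/= andbT.
  by rewrite (le_trans _ N0)// oppr_le0.
exists g; first split=> //.
- split; last by exists N.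
  by apply: measurable_maxr => //; exact: measurable_minr.
- apply: filterS fN => x; rewrite ler_norml => /andP[Nf fN].
  by rewrite /g (min_idPr fN) (max_idPr Nf).
Qed.

End essentially_bounded.

Section complex_resolvent.
Context {R : realType} (d : nat).
Local Notation E := 'rV[R]_d.
Local Notation leb := (@lebesgue_rV R d).
Context (Q : (E -> R) -> E -> R) (kQ : kernel_op Q).
Context (Q_ae : forall f g : E -> R, measurable_fun [set: E] f ->
  measurable_fun [set: E] g -> {ae leb, forall x, f x = g x} ->
  forall x, Q f x = Q g x).
Context (Lam : R) (h : E -> R) (L : (E -> R) -> R) (be C : R).
Context (gap : spectral_gap Q Lam h L be C).

Let pQ x : pos_functional (fun f => Q f x). Proof. exact: (kop_pos kQ). Qed.
Let bk k f : bmeas f -> bmeas (iter k Q f).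
Proof. exact: (kop_bmeas (kernel_op_iter kQ k)). Qed.
Let Lam0 : 0 < Lam := gap_Lam gap.

Lemma power_bound : exists2 D : R, 0 < D & forall f (M : R) k x, bmeas f ->
  (forall x, `|f x| <= M) -> `|iter k Q f x| <= D * M * Lam ^+ k.
Proof.
have [_ [B hB]] := gap_bh gap; have pL := gap_L gap.
have b1 : bmeas (cst 1 : E -> R) by exact: bmeas_cst.
have L10 : 0 <= L (cst 1) by exact: (pos_ge0 pL).
have B0 : 0 <= B by rewrite (le_trans (normr_ge0 _) (hB 0)).
have C0 := gap_C gap.
exists (C + L (cst 1) * B); first by rewrite ltr_wpDr// mulr_ge0.
move=> f M k x bf fM.
have M0 : 0 <= M by rewrite (le_trans (normr_ge0 _) (fM 0)).
have Lk : 0 < Lam ^+ k by exact: exprn_gt0.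
rewrite -ler_pdivrMr//.
have -> : `|iter k Q f x| / Lam ^+ k = `|iter k Q f x / Lam ^+ k|.
  by rewrite normrM normfV (gtr0_norm Lk).
rewrite -(subrK (L f * h x) (_ / _)) (le_trans (ler_normD _ _))//.
rewrite mulrDl lerD//.
  apply: (le_trans (gap_cvg gap bf fM k x)); rewrite ler_wpM2r//.
  have /andP[be0 be1] := gap_be gap.
  by rewrite ler_piMr ?(ltW C0)// exprn_ile1 ?ltW.
rewrite normrM mulrAC ler_pM//.
rewrite mulrC -(pos_cst pL); apply: (pos_abs pL) => //; exact: bmeas_cst.
Qed.

Lemma eigenvalue_in_spectrum : spectrum Q (Lam%:C)%C.
Proof.
move=> [inj _]; have := lebesgue_rV_gt0 (R := R) d; rewrite lt0e => /andP[/eqP + _].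
apply; have bh := gap_bh gap.
have /= := inj (fun x => (h x)%:C%C) _ _.
case.
- by split; [exact: bmeas_Linfty|exact: (bmeas_Linfty (bmeas_cst 0))].
- apply: aeW => x; rewrite /complexify /= (gap_eig gap) (pos0 (pQ x)).
  by rewrite complexr0 -rmorphM subrr.
- move=> N [mN N0 hN]; rewrite -N0; congr (leb _); apply/seteqP; split=> // x _.
  apply: hN => /= hx0; have := gap_h gap x.
  by case: hx0 => ->; rewrite ltxx.
Qed.

Section large_z.
Context (z : R[i]) (zL : Lam < Normc.normc z).
Let nz := Normc.normc z.
Let nz0 : 0 < nz. Proof. exact: lt_trans zL. Qed.
Let rho := Lam / nz.
Let rho0 : 0 < rho. Proof. by rewrite divr_gt0. Qed.
Let rho1 : rho < 1. Proof. by rewrite ltr_pdivrMr// mul1r. Qed.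
Let z0 : z != 0.
Proof.
apply/eqP => zE; have := nz0.
by rewrite /nz zE (@Normc.normc0 R) ltxx.
Qed.

Let normcX (w : R[i]) k : Normc.normc (w ^+ k) = Normc.normc w ^+ k.
Proof.
elim: k => [|k IH]; first by rewrite !expr0 (@Normc.normc1 R).
by rewrite !exprS Normc.normcM IH.
Qed.

Let norm_Re_le (w : R[i]) : `|complex.Re w| <= Normc.normc w.
Proof.
case: w => a c /=; rewrite -sqrtr_sqr; apply: ler_wsqrtr.
by rewrite lerDl sqr_ge0.
Qed.

Let norm_Im_le (w : R[i]) : `|complex.Im w| <= Normc.normc w.
Proof.
case: w => a c /=; rewrite -sqrtr_sqr; apply: ler_wsqrtr.
by rewrite lerDr sqr_ge0.
Qed.

Let normc_le (a c : R) : Normc.normc (a +i* c)%C <= `|a| + `|c|.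
Proof.
rewrite /= -[leRHS]ger0_norm ?addr_ge0// -sqrtr_sqr; apply: ler_wsqrtr.
rewrite -(real_normK (num_real a)) -(real_normK (num_real c)) sqrrD.
have : 0 <= `|a| * `|c| by exact: mulr_ge0.
by rewrite mulr2n; lra.
Qed.

Let complex_mulE (p q a c : R) :
  ((p +i* q) * (a +i* c) = (p * a - q * c) +i* (p * c + q * a))%C.
Proof. by []. Qed.

Let H (u v : E -> R) k x : R[i] := (iter k Q u x +i* iter k Q v x)%C.

Let H_bound u v (M : R) : bmeas u -> bmeas v -> (forall x, `|u x| <= M) ->
  (forall x, `|v x| <= M) -> exists2 D : R, 0 <= D &
  forall k x, Normc.normc (H u v k x) <= D * Lam ^+ k.
Proof.
move=> bu bv uM vM; have [D D0 HD] := power_bound.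
have M0 : 0 <= M by rewrite (le_trans (normr_ge0 _) (uM 0)).
exists (2 * (D * M)); first by rewrite mulr_ge0// mulr_ge0// ltW.
move=> k x; rewrite (le_trans (normc_le _ _))//.
rewrite -mulrA mulr_natl mulr2n lerD//; exact: HD.
Qed.

(** If [Q f = z f], then [z^k f = Q^k f = O(Lam^k)], which is impossible for
    [|z| > Lam] unless [f] vanishes. *)
Lemma resolvent_injective (f : E -> R[i]) : CLinfty f ->
  {ae leb, forall x, complexify Q f x - z * f x = 0} ->
  {ae leb, forall x, f x = 0}.
Proof.
move=> [Lu Lv] Tf.
have [u [bu uM] uE] := Linfty_bmeas Lu; have [v [bv vM] vE] := Linfty_bmeas Lv.
have [mu_ _] := Linfty_ae_le Lu; have [mv_ _] := Linfty_ae_le Lv.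
pose M := Num.max (Linfty_norm (fun x => complex.Re (f x)))
  (Linfty_norm (fun x => complex.Im (f x))).
have uM' x : `|u x| <= M by rewrite le_max uM.
have vM' x : `|v x| <= M by rewrite le_max vM orbT.
have [D D0 HD] := H_bound bu bv uM' vM'.
have QuE x : Q (fun x => complex.Re (f x)) x = Q u x.
  by apply: Q_ae => //; case: bu.
have QvE x : Q (fun x => complex.Im (f x)) x = Q v x.
  by apply: Q_ae => //; case: bv.
have fE : {ae leb, forall x, f x = H u v 0 x}.
  apply: filterS2 uE vE => x ux vx; apply/eqP; rewrite eq_complex /=.
  by rewrite ux vx !eqxx.
have H1 : {ae leb, forall x, H u v 1 x = z * H u v 0 x}.
  apply: filterS2 Tf fE => x + fx; rewrite fx => /eqP; rewrite subr_eq0 => /eqP <-.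
  by rewrite /H /complexify /= QuE QvE.
have Hk k : {ae leb, forall x, H u v k x = z ^+ k * H u v 0 x}.
  elim: k => [|k IH]; first by apply: aeW => x; rewrite expr0 mul1r.
  apply: filterS H1 => x Hx; rewrite exprSr -mulrA -Hx.
  case E: (z ^+ k) => [p q].
  have b1 : bmeas (fun y => p * u y - q * v y) by apply: bmeasB; exact: bmeasZ.
  have b2 : bmeas (fun y => p * v y + q * u y) by apply: bmeasD; exact: bmeasZ.
  rewrite /H !iterS /= (Q_ae (f := iter k Q u) (g := fun y => p * u y - q * v y)); last 3 first.
  - by case: (bk k bu).
  - by case: b1.
  - by apply: filterS IH => y; rewrite E /H complex_mulE => -[].
  rewrite (Q_ae (f := iter k Q v) (g := fun y => p * v y + q * u y)); last 3 first.
  - by case: (bk k bv).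
  - by case: b2.
  - by apply: filterS IH => y; rewrite E /H complex_mulE => -[].
  rewrite complex_mulE (posB (pQ x)) ?(posD (pQ x)) ?(posZ (pQ x))//; exact: bmeasZ.
have /ae_foralln Hall := Hk.
apply: filterS2 fE Hall => x -> Hx.
apply: (@Normc.eq0_normc R); apply/eqP; rewrite eq_le; apply/andP; split; last first.
  by rewrite /H /= sqrtr_ge0.
have rk : D * rho ^+ k @[k --> \oo] --> (0 : R).
  rewrite -(mulr0 D); apply: cvgMr; apply: cvg_expr.
  by rewrite ger0_norm// ltW.
rewrite -(cvg_lim (@Rhausdorff R) rk); apply: limr_ge.
  by apply/cvg_ex; eexists; exact: rk.
apply: nearW => k; rewrite /rho expr_div_n mulrA ler_pdivlMr ?exprn_gt0// mulrC.
by rewrite /nz -normcX -Normc.normcM -Hx.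
Qed.

(** The Neumann series [- \sum_k z^-(k+1) Q^k g]; its partial sums telescope to
    [g - z^-N Q^N g] under [Q - z]. Real and imaginary parts are summed
    separately because [Q] acts on real functions. *)
Lemma resolvent_surjective (g : E -> R[i]) : CLinfty g ->
  exists2 f, CLinfty f &
    {ae leb, forall x, complexify Q f x - z * f x = g x}.
Proof.
move=> [Lu Lv].
have [u [bu uM] uE] := Linfty_bmeas Lu; have [v [bv vM] vE] := Linfty_bmeas Lv.
pose M := Num.max (Linfty_norm (fun x => complex.Re (g x)))
  (Linfty_norm (fun x => complex.Im (g x))).
have uM' x : `|u x| <= M by rewrite le_max uM.
have vM' x : `|v x| <= M by rewrite le_max vM orbT.
have [D D0 HD] := H_bound bu bv uM' vM'.
have gE : {ae leb, forall x, g x = H u v 0 x}.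
  apply: filterS2 uE vE => x ux vx; apply/eqP; rewrite eq_complex /=.
  by rewrite ux vx !eqxx.
pose wt k : R[i] := (z ^+ k)^-1.
pose t k x : R[i] := wt k.+1 * H u v k x.
have tb k x : Normc.normc (t k x) <= D / nz * rho ^+ k.
  rewrite /t Normc.normcM Normc.normcV normcX -/nz.
  rewrite mulrC ler_pdivrMr ?exprn_gt0// (le_trans (HD k x))//.
  rewrite /rho expr_div_n exprS le_eqVlt; apply/orP; left; apply/eqP.
  by field; rewrite ?expf_neq0 gt_eqF.
have bt k : bmeas (fun x => complex.Re (t k x)) /\ bmeas (fun x => complex.Im (t k x)).
  rewrite /t; case: (wt k.+1) => p q /=; split.
    by apply: bmeasB; apply: bmeasZ; exact: bk.
  by apply: bmeasD; apply: bmeasZ; exact: bk.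
pose a N x := - \sum_(k <- index_iota 0 N) complex.Re (t k x).
pose c N x := - \sum_(k <- index_iota 0 N) complex.Im (t k x).
have aS N x : a N.+1 x = a N x - complex.Re (t N x).
  by rewrite /a big_nat_recr//= opprD.
have cS N x : c N.+1 x = c N x - complex.Im (t N x).
  by rewrite /c big_nat_recr//= opprD.
have ba N : bmeas (a N).
  elim: N => [|N IH].
    by rewrite (_ : a 0%N = cst 0); [exact: bmeas_cst|apply/funext => x; rewrite /a big_geq// oppr0].
  rewrite (_ : a N.+1 = (fun x => a N x - complex.Re (t N x))); last exact/funext.
  by apply: bmeasB => //; case: (bt N).
have bc N : bmeas (c N).
  elim: N => [|N IH].
    by rewrite (_ : c 0%N = cst 0); [exact: bmeas_cst|apply/funext => x; rewrite /c big_geq// oppr0].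
  rewrite (_ : c N.+1 = (fun x => c N x - complex.Im (t N x))); last exact/funext.
  by apply: bmeasB => //; case: (bt N).
pose K := D / nz / (1 - rho).
have r1 : 0 < 1 - rho by rewrite subr_gt0.
have K0 : 0 <= K by rewrite /K !divr_ge0// ltW.
have KE : D / nz = K * (1 - rho) by rewrite /K divfK// gt_eqF.
have rk_ge0 k : 0 <= rho ^+ k by rewrite exprn_ge0// ltW.
have cau (s : nat -> R) : (forall k, `|s k.+1 - s k| <= D / nz * rho ^+ k) ->
    forall k m, (k <= m)%N -> `|s m - s k| <= K * rho ^+ k.
  move=> sS k m km.
  suff : `|s m - s k| <= K * (rho ^+ k - rho ^+ m).
    move=> /le_trans; apply; rewrite ler_wpM2l// gerBl.
    exact: rk_ge0.
  elim: m km => [|m IH]; first by rewrite leqn0 => /eqP ->; rewrite !subrr normr0 mulr0.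
  rewrite leq_eqVlt => /orP[/eqP ->|]; first by rewrite !subrr normr0 mulr0.
  rewrite ltnS => km; rewrite -(subrKA (s m)) (le_trans (ler_normD _ _))//.
  have -> : K * (rho ^+ k - rho ^+ m.+1) =
      D / nz * rho ^+ m + K * (rho ^+ k - rho ^+ m) by rewrite KE exprS; ring.
  by rewrite lerD// IH.
have rho01 : 0 < rho < 1 by rewrite rho0.
have aI x k : `|a k.+1 x - a k x| <= D / nz * rho ^+ k.
  rewrite aS addrAC subrr add0r normrN; exact: le_trans (norm_Re_le _) (tb k x).
have cI x k : `|c k.+1 x - c k x| <= D / nz * rho ^+ k.
  rewrite cS addrAC subrr add0r normrN; exact: le_trans (norm_Im_le _) (tb k x).
pose fr x := limn (fun N => a N x); pose fi x := limn (fun N => c N x).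
have afr x : a N x @[N --> \oo] --> fr x.
  by have [l al _] := geometric_cauchy rho01 (cau (fun N => a N x) (aI x)); rewrite /fr (cvg_lim (@Rhausdorff R) al).
have cfi x : c N x @[N --> \oo] --> fi x.
  by have [l cl _] := geometric_cauchy rho01 (cau (fun N => c N x) (cI x)); rewrite /fi (cvg_lim (@Rhausdorff R) cl).
have a0 x : a 0%N x = 0 by rewrite /a big_geq// oppr0.
have c0 x : c 0%N x = 0 by rewrite /c big_geq// oppr0.
have aK N x : `|a N x| <= K.
  have := cau (fun N => a N x) (aI x) 0%N N isT.
  by rewrite a0 subr0 expr0 mulr1.
have cK N x : `|c N x| <= K.
  have := cau (fun N => c N x) (cI x) 0%N N isT.
  by rewrite c0 subr0 expr0 mulr1.
have bfr := bmeas_lim ba aK afr; have bfi := bmeas_lim bc cK cfi.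
exists (fun x => fr x +i* fi x)%C.
  by split; exact: bmeas_Linfty.
have eqN N x : ((Q (a N) x +i* Q (c N) x) - z * (a N x +i* c N x) =
    H u v 0 x - wt N * H u v N x)%C.
  elim: N => [|N IH].
    rewrite a0 c0 (_ : a 0%N = cst 0); last exact/funext.
    rewrite (_ : c 0%N = cst 0); last exact/funext.
    by rewrite (pos0 (pQ x)) mulr0 subr0 /wt expr0 invr1 mul1r subrr.
  rewrite (_ : a N.+1 = (fun y => a N y - complex.Re (t N y))); last exact/funext.
  rewrite (_ : c N.+1 = (fun y => c N y - complex.Im (t N y))); last exact/funext.
  have [bt1 bt2] := bt N.
  rewrite (posB (pQ x))// (posB (pQ x))//.
  have QtE : (Q (fun y => complex.Re (t N y)) x +i* Q (fun y => complex.Im (t N y)) x =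
      wt N.+1 * H u v N.+1 x)%C.
    rewrite /t; case: (wt N.+1) => p q.
    rewrite /H !iterS /= complex_mulE (posB (pQ x)); last 2 first.
    - exact: (bmeasZ p (bk N bu)).
    - exact: (bmeasZ q (bk N bv)).
    rewrite (posD (pQ x)); last 2 first.
    - exact: (bmeasZ p (bk N bv)).
    - exact: (bmeasZ q (bk N bu)).
    by rewrite !(posZ (pQ x))//; exact: bk.
  have split2 (a1 c1 a2 c2 : R) : ((a1 - a2) +i* (c1 - c2) =
     (a1 +i* c1) - (a2 +i* c2))%C by [].
  rewrite !split2 QtE mulrBr.
  have tE : (complex.Re (t N x) +i* complex.Im (t N x) = t N x)%C by case: (t N x).
  rewrite tE.
  have ztE : z * t N x = wt N * H u v N x.
    rewrite /t /wt exprS invfM; field.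
    by rewrite expf_neq0.
  rewrite ztE.
  have := IH; set A := (_ +i* _)%C; set B := z * _ => IH'.
  transitivity ((A - B) - wt N.+1 * H u v N.+1 x + wt N * H u v N x); first by ring.
  by rewrite IH'; ring.
have wH N x : Normc.normc (wt N * H u v N x) <= D * rho ^+ N.
  rewrite Normc.normcM Normc.normcV normcX -/nz mulrC ler_pdivrMr ?exprn_gt0//.
  rewrite (le_trans (HD N x))// /rho expr_div_n le_eqVlt; apply/orP; left; apply/eqP.
  by field; apply: expf_neq0; rewrite gt_eqF.
have rkc : D * rho ^+ k @[k --> \oo] --> (0 : R).
  rewrite -(mulr0 D); apply: cvgMr; apply: cvg_expr.
  by rewrite ger0_norm// ltW.
have Qa x : Q (a N) x @[N --> \oo] --> Q fr x by exact: (pos_cvg (pQ x) ba aK afr).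
have Qc x : Q (c N) x @[N --> \oo] --> Q fi x by exact: (pos_cvg (pQ x) bc cK cfi).
have err0 (s : nat -> R) : (forall N, `|s N| <= D * rho ^+ N) -> s N @[N --> \oo] --> (0 : R).
  move=> sD; apply/norm_cvg0P.
  apply: (@squeeze_cvgr _ _ _ _ (cst 0) (fun N => D * rho ^+ N)) => //; last exact: cvg_cst.
  by apply: nearW => N; rewrite normr_ge0 sD.
apply: filterS gE => x ->.
case Ez : z => [p q]; rewrite /complexify /=.
rewrite /H /=; apply/eqP; rewrite eq_complex; apply/andP; split; apply/eqP => /=.
- have l1 : Q (a N) x - (p * a N x - q * c N x) @[N --> \oo] -->
      Q fr x - (p * fr x - q * fi x).
    apply: cvgB => //; apply: cvgB; exact: cvgMr.
  have l2 : u x - complex.Re (wt N * H u v N x) @[N --> \oo] --> u x - 0.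
    apply: cvgB; first exact: cvg_cst.
    by apply: err0 => N; exact: le_trans (norm_Re_le _) (wH N x).
  rewrite subr0 in l2; apply: (cvg_unique (@Rhausdorff R) l1).
  rewrite (_ : (fun N => _) = (fun N => u x - complex.Re (wt N * H u v N x)))//.
  apply/funext => N; have := eqN N x; rewrite {1}Ez => /(congr1 (@complex.Re R)).
  by rewrite !raddfB /=.
- have l1 : Q (c N) x - (p * c N x + q * a N x) @[N --> \oo] -->
      Q fi x - (p * fi x + q * fr x).
    apply: cvgB => //; apply: cvgD; exact: cvgMr.
  have l2 : v x - complex.Im (wt N * H u v N x) @[N --> \oo] --> v x - 0.
    apply: cvgB; first exact: cvg_cst.
    by apply: err0 => N; exact: le_trans (norm_Im_le _) (wH N x).
  rewrite subr0 in l2; apply: (cvg_unique (@Rhausdorff R) l1).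
  rewrite (_ : (fun N => _) = (fun N => v x - complex.Im (wt N * H u v N x)))//.
  apply/funext => N; have := eqN N x; rewrite {1}Ez => /(congr1 (@complex.Im R)).
  by rewrite !raddfB /=.
Qed.

End large_z.

(** The eigenfunction [h] is positive everywhere, so [Lam] belongs to the
    spectrum, and nothing of larger modulus does. *)
Lemma spectral_radiusE : spectral_radius Q = Lam.
Proof.
apply/eqP; rewrite eq_le; apply/andP; split.
  apply: ge_sup.
    by eexists; exists (Lam%:C)%C => //; exact: eigenvalue_in_spectrum.
  move=> _ [z zS <-]; rewrite leNgt; apply/negP => zL; apply: zS; split.
    exact: resolvent_injective.
  exact: resolvent_surjective.
apply: ub_le_sup.
  exists Lam => _ [z zS <-]; rewrite leNgt; apply/negP => zL; apply: zS; split.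
    exact: resolvent_injective.
  exact: resolvent_surjective.
exists (Lam%:C)%C; first exact: eigenvalue_in_spectrum.
by rewrite /= expr0n/= addr0 sqrtr_sqr gtr0_norm.
Qed.

End complex_resolvent.

(** * Long-time behaviour of the Feynman-Kac flow *)

Lemma positive_cvg_bounded_below {R : realType} (u : nat -> R) (l : R) : 0 < l ->
  (forall k, 0 < u k) -> u k @[k --> \oo] --> l ->
  exists2 m : R, 0 < m & forall k, m <= u k.
Proof.
move=> l0 u0 ul; have l2 : 0 < l / 2 by rewrite divr_gt0.
have /cvgrPdist_lt /(_ _ l2) [N _ HN] := ul.
have [m m0 mu_] : exists2 m : R, 0 < m & forall k, (k < N)%N -> m <= u k.
  elim: (N) => [|n [m m0 IH]]; first by exists 1.
  exists (Num.min m (u n)); first by rewrite lt_min m0 u0.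
  move=> k; rewrite ltnS leq_eqVlt => /orP[/eqP ->|kn].
    by rewrite ge_min lexx orbT.
  by rewrite ge_min IH.
exists (Num.min m (l / 2)); first by rewrite lt_min m0 l2.
move=> k; rewrite ge_min; have [kN|Nk] := ltnP k N; first by rewrite mu_.
apply/orP; right; have := HN k Nk; rewrite /= ltr_distlC => /andP[+ _].
by move=> /ltW; apply: le_trans; lra.
Qed.

Section feynman_kac_gap.
Context {R : realType} (d : nat) (eps alpha dt : R).
Context (V : 'rV[R]_d -> R) (b : 'rV[R]_d -> 'rV[R]_d).
Context (eps0 : 0 < eps) (dt0 : 0 < dt) (hA : assumptionA V)
  (hB : assumptionB V b).
Local Notation E := 'rV[R]_d.
Local Notation leb := (@lebesgue_rV R d).
Local Notation Q := (fk_semigroup eps alpha dt V b).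

Let kQ : kernel_op Q :=
  conf_op (fk_semigroup_confining alpha eps0 dt0 hA hB).
Let bk k f : bmeas f -> bmeas (iter k Q f).
Proof. exact: (kop_bmeas (kernel_op_iter kQ k)). Qed.

Lemma fk_semigroup_ae (f g : E -> R) : measurable_fun [set: E] f ->
  measurable_fun [set: E] g -> {ae leb, forall x, f x = g x} ->
  forall x, Q f x = Q g x.
Proof.
move=> mf mg fg x; congr (_ * _).
by apply: (gauss_mean_ae _ (noise_std_gt0 eps0 dt0)).
Qed.

Context (Lam : R) (h : E -> R) (L : (E -> R) -> R) (be C : R).
Context (gap : spectral_gap Q Lam h L be C).

Let pL : pos_functional L := gap_L gap.
Let Lam0 : 0 < Lam := gap_Lam gap.
Let b1 : bmeas (cst 1 : E -> R). Proof. exact: bmeas_cst. Qed.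

Lemma L1_gt0 : 0 < L (cst 1).
Proof.
have bh := gap_bh gap; have [B B0 hB'] := bmeas_ub bh.
rewrite -(pmulr_rgt0 _ B0); apply: (lt_le_trans ltr01).
rewrite -[leLHS](gap_Lh gap) -(pos_cst pL).
by apply: (pos_le pL) => //; exact: bmeas_cst.
Qed.

(** [L] normalised to a probability. It does not charge null sets, since
    [Lam * L f = L (Q f)] and [Q f = 0] when [f] is null. *)
Lemma stationary_measure : exists mustar : probability E R,
  (forall f, bmeas f -> pairing mustar f = L f / L (cst 1)) /\
  (forall f g : E -> R, measurable_fun [set: E] f -> measurable_fun [set: E] g ->
     {ae leb, forall x, f x = g x} -> pairing mustar f = pairing mustar g).
Proof.
have p1 : pos_functional (fun f => (L (cst 1))^-1 * L f).
  by apply: pos_functionalZ => //; rewrite invr_ge0 ltW// L1_gt0.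
have [|mus musE] := functional_measureP p1; first by rewrite mulVf// gt_eqF// L1_gt0.
exists mus; split; first by move=> f bf; rewrite /pairing musE// mulrC.
move=> f g mf mg [N [mN N0 fgN]].
have bN : bmeas (\1_N : E -> R) by exact: bmeas_indic.
have LN : L \1_N = 0.
  have : Lam * L \1_N = 0.
    rewrite -(gap_inv gap)// (_ : Q \1_N = cst 0) ?(pos0 pL)//.
    apply/funext => x; rewrite (fk_semigroup_ae (g := cst 0)).
    - exact: (pos0 (kop_pos kQ x)).
    - exact: measurable_indic.
    - exact: measurable_cst.
    exists N; split => // y /= H; apply: contrapT => Ny; apply: H.
    by rewrite indicE memNset.
  by move/eqP; rewrite mulf_eq0 gt_eqF//= => /eqP.
have musN : mus N = 0%E.
  have := musE _ bN; rewrite LN mulr0 /Rintegral integral_indic// setIT.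
  by move=> mN0; rewrite -(fineK (fin_num_measure mus N mN)) mN0.
congr fine; apply: ae_eq_integral => //.
- exact/measurable_EFinP.
- exact/measurable_EFinP.
exists N; split => // x /= H; apply: fgN => /= fg; apply: H => _.
by rewrite /= fg.
Qed.

Lemma probability_finite (mu : probability E R) : (mu [set: E] < +oo)%E.
Proof. by rewrite [X in (X < _)%E](probability_setT mu) ltry. Qed.

Let pmu (mu : probability E R) : pos_functional (pairing mu).
Proof. exact: pos_functional_integral (probability_finite mu). Qed.

Lemma pairing_cst (mu : probability E R) (c : R) : pairing mu (cst c) = c.
Proof. by rewrite (pos_cst (pmu mu)) [pairing mu _]Rintegral_cst1 mulr1. Qed.

Lemma pairing_gt0 (mu : probability E R) (f : E -> R) : bmeas f ->
  (forall x, 0 < f x) -> 0 < pairing mu f.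
Proof.
move=> bf f0; rewrite lt_neqAle (pos_ge0 (pmu mu))// ?andbT; last by move=> x; exact: ltW.
apply/eqP => muf0.
have mf : measurable_fun [set: E] (EFin \o f) by apply/measurable_EFinP; case: bf.
have [+ _] := ae_eq_integral_abs mu measurableT mf; case.
  rewrite (eq_integral (EFin \o f)); last by move=> x _; rewrite /= gtr0_norm.
  by rewrite (bmeas_integralE (probability_finite mu) bf) -[X in X%:E]muf0.
move=> N [mN N0 fN]; have : mu [set: E] = 0%E.
  rewrite -N0; congr (mu _); apply/seteqP; split => // x _; apply: fN => /= H.
  by have := f0 x; have [->] := H I; rewrite ltxx.
by rewrite [LHS](probability_setT mu) => /eqP; rewrite eqe oner_eq0.
Qed.

Lemma normalised_pairing (mu : probability E R) (f : E -> R) (M : R) k :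
  bmeas f -> (forall x, `|f x| <= M) ->
  `|pairing mu (iter k Q f) / Lam ^+ k - L f * pairing mu h| <= C * be ^+ k * M.
Proof.
move=> bf fM; have bh := gap_bh gap; have pm := pmu mu.
have -> : pairing mu (iter k Q f) / Lam ^+ k - L f * pairing mu h =
    pairing mu (fun x => (Lam ^+ k)^-1 * iter k Q f x - L f * h x).
  rewrite (posB pm); last 2 first.
  - by apply: bmeasZ; exact: bk.
  - exact: bmeasZ.
  by rewrite (posZ pm) ?(posZ pm)//; [rewrite mulrC|exact: bk].
rewrite -[leRHS](pairing_cst mu); apply: (pos_abs pm).
- by apply: bmeasB; apply: bmeasZ => //; exact: bk.
- exact: bmeas_cst.
- by move=> x; rewrite mulrC; exact: (gap_cvg gap).
Qed.

Let iterQ1_gt0 k x : 0 < iter k Q (cst 1) x.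
Proof.
have bh := gap_bh gap; have [B B0 hB'] := bmeas_ub bh.
rewrite -(pmulr_rgt0 _ B0); apply: (@lt_le_trans _ _ (iter k Q h x)).
  rewrite (iter_eigenfunction kQ bh (gap_eig gap)).
  by rewrite mulr_gt0 ?exprn_gt0// (gap_h gap).
have pk := kop_pos (kernel_op_iter kQ k) x.
by rewrite -(pos_cst pk); apply: (pos_le pk) => //; exact: bmeas_cst.
Qed.

Lemma mass_gt0 (mu : probability E R) k : 0 < pairing mu (iter k Q (cst 1)).
Proof. by apply: pairing_gt0 => //; exact: bk. Qed.

Lemma mass_cvg (mu : probability E R) :
  pairing mu (iter k Q (cst 1)) / Lam ^+ k @[k --> \oo] -->
  L (cst 1) * pairing mu h.
Proof.
have /andP[be0 be1] := gap_be gap.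
apply/subr_cvg0/norm_cvg0P.
have Cb : C * be ^+ k @[k --> \oo] --> (0 : R).
  rewrite -(mulr0 C); apply: cvgMr; apply: cvg_expr.
  by rewrite ger0_norm// ltW.
apply: (squeeze_cvgr _ (cvg_cst 0) Cb); apply: nearW => k.
rewrite normr_ge0/= -[leRHS]mulr1; apply: normalised_pairing => // x.
by rewrite normr1.
Qed.

Lemma mass_limit_gt0 (mu : probability E R) : 0 < L (cst 1) * pairing mu h.
Proof.
apply: mulr_gt0; first exact: L1_gt0.
by apply: pairing_gt0; [exact: (gap_bh gap)|exact: (gap_h gap)].
Qed.

(** Numerator and denominator of the flow, both divided by [Lam^k], are
    [O(be^k)]-close to [L f * pairing mu h] and [L (cst 1) * pairing mu h]. The
    constant depends on [mu] through the lower bound [m] of the denominator. *)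
Lemma flow_bound (mu : probability E R) : exists D : R, forall f (M : R) k,
  bmeas f -> (forall x, `|f x| <= M) ->
  `|pairing mu (iter k Q f) / pairing mu (iter k Q (cst 1)) -
    L f / L (cst 1)| <= D * be ^+ k * M.
Proof.
have L1 := L1_gt0; have /andP[be0 be1] := gap_be gap; have C0 := gap_C gap.
pose u k := pairing mu (iter k Q (cst 1)) / Lam ^+ k.
have Lk k : 0 < Lam ^+ k by exact: exprn_gt0.
have u0 k : 0 < u k by rewrite divr_gt0// mass_gt0.
have [m m0 mu_] := positive_cvg_bounded_below (mass_limit_gt0 mu) u0 (@mass_cvg mu).
exists (2 * C / m) => f M k bf fM.
have M0 : 0 <= M by rewrite (le_trans (normr_ge0 _) (fM 0)).
set a := pairing mu (iter k Q f) / Lam ^+ k.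
have n1 : `|u k - L (cst 1) * pairing mu h| <= C * be ^+ k * 1.
  by apply: normalised_pairing => // x; rewrite normr1.
have nf : `|a - L f * pairing mu h| <= C * be ^+ k * M by exact: normalised_pairing.
have LfM : `|L f / L (cst 1)| <= M.
  rewrite normrM normfV (gtr0_norm L1) ler_pdivrMr// -(pos_cst pL).
  by apply: (pos_abs pL) => //; exact: bmeas_cst.
set q := L f / L (cst 1) in LfM *.
have qE : q * L (cst 1) = L f by rewrite divfK// gt_eqF.
have -> : pairing mu (iter k Q f) / pairing mu (iter k Q (cst 1)) - q =
    ((a - L f * pairing mu h) - q * (u k - L (cst 1) * pairing mu h)) / u k.
  rewrite -qE /a /u; field; rewrite !gt_eqF//; exact: mass_gt0.
rewrite normrM normfV (gtr0_norm (u0 k)) ler_pdivrMr//.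
have num : `|a - L f * pairing mu h - q * (u k - L (cst 1) * pairing mu h)|
    <= 2 * C * be ^+ k * M.
  rewrite (le_trans (ler_normB _ _))// normrM.
  have : `|q| * `|u k - L (cst 1) * pairing mu h| <= M * (C * be ^+ k * 1).
    exact: ler_pM.
  by move: nf; lra.
apply: (le_trans num).
have -> : 2 * C / m * be ^+ k * M * u k = 2 * C * be ^+ k * M * (u k / m) by ring.
apply: ler_peMr; last by rewrite ler_pdivlMr// mul1r.
apply: mulr_ge0 => //; apply: mulr_ge0; last by rewrite exprn_ge0// ltW.
by apply: mulr_ge0 => //; exact: ltW.
Qed.

Lemma log_mass_cvg (mu : probability E R) :
  k%:R^-1 * ln (pairing mu (iter k Q (cst 1))) @[k --> \oo] --> ln Lam.
Proof.
pose u k := pairing mu (iter k Q (cst 1)) / Lam ^+ k.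
have Lk k : 0 < Lam ^+ k by exact: exprn_gt0.
have u0 k : 0 < u k by rewrite divr_gt0// mass_gt0.
have lu : ln (u k) @[k --> \oo] --> ln (L (cst 1) * pairing mu h).
  by apply: (cvg_comp _ _ (@mass_cvg mu)); exact: (continuous_ln (mass_limit_gt0 mu)).
have inv0 : (k.+1%:R^-1 : R) @[k --> \oo] --> (0 : R) by exact: cvg_harmonic.
rewrite -(cvg_shiftS (fun k => k%:R^-1 * ln (pairing mu (iter k Q (cst 1))))).
have lim : ln Lam + k.+1%:R^-1 * ln (u k.+1) @[k --> \oo] --> ln Lam.
  rewrite -[X in _ --> X]addr0 -[X in _ + X](mul0r (ln (L (cst 1) * pairing mu h))).
  apply: cvgD; first exact: cvg_cst.
  apply: cvgM => //; by rewrite (cvg_shiftS (fun k => ln (u k))).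
apply: cvg_trans lim; apply: near_eq_cvg; apply: nearW => k /=.
have -> : pairing mu (iter k.+1 Q (cst 1)) = u k.+1 * Lam ^+ k.+1.
  by rewrite divfK// gt_eqF.
rewrite lnM ?posrE// lnXn// mulrDr addrC; congr (_ + _).
by rewrite -[ln Lam *+ _]mulr_natl mulKf// pnatr_eq0.
Qed.

End feynman_kac_gap.

Theorem proposition3p1 (R : realType) (d : nat) (eps alpha dt : R)
    (V : 'rV[R]_d -> R) (b : 'rV[R]_d -> 'rV[R]_d)
    (d_gt0 : (0 < d)%N) (eps_gt0 : 0 < eps) (dt_gt0 : 0 < dt)
    (hA : assumptionA V) (hB : assumptionB V b) :
  let PU := fk_semigroup eps alpha dt V b in
  let Lambda := spectral_radius PU in
  (exists (mustar : probability 'rV[R]_d R) (beta : R),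
    [/\ Lambda = pairing mustar (PU (cst 1)),
        0 < beta < 1 &
        forall mu : probability 'rV[R]_d R, exists C : R,
          forall phi : 'rV[R]_d -> R, Linfty phi ->
          forall k : nat, (1 <= k)%N ->
            `| fk_flow eps alpha dt V b k mu phi - pairing mustar phi |
              <= C * beta ^+ k * Linfty_norm phi]) /\
  (forall (mu : probability 'rV[R]_d R)
      (dO : measure_display) (Omega : measurableType dO)
      (P : probability Omega R)
      (X0 : {RV P >-> 'rV[R]_d}) (G : nat -> {RV P >-> 'rV[R]_d}),
    em_noise mu X0 G ->
    (fun k : nat => k%:R^-1 *
       ln (fine 'E_P[fk_weight eps alpha dt V b
                       (em_chain eps alpha dt b X0 G) k]%E))
      @ \oo --> ln Lambda).
Proof.
move=> PU Lambda.
have cQ := fk_semigroup_confining alpha eps_gt0 dt_gt0 hA hB.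
have kQ := conf_op cQ.
have [Lam [h [L [be [C gap]]]]] := spectral_gap_exists cQ.
have ae_inv := @fk_semigroup_ae R d eps alpha dt V b eps_gt0 dt_gt0.
have LamE : Lambda = Lam by exact: (spectral_radiusE kQ ae_inv gap).
have b1 : bmeas (cst 1 : 'rV[R]_d -> R) by exact: bmeas_cst.
have L1 := L1_gt0 gap.
split.
  have [mus [musE mus_ae]] := stationary_measure eps_gt0 dt_gt0 hA hB gap.
  exists mus, be; split.
  - rewrite LamE musE; last exact: (kop_bmeas kQ).
    by rewrite (gap_inv gap)// mulfK// gt_eqF.
  - exact: (gap_be gap).
  - move=> mu; have [D HD] := flow_bound eps_gt0 dt_gt0 hA hB gap mu.
    exists D => phi Lphi k k1.
    have [psi [bpsi psiN] phi_psi] := Linfty_bmeas Lphi.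
    have [mphi _] := Linfty_ae_le Lphi; have mpsi : measurable_fun setT psi by case: bpsi.
    rewrite (mus_ae phi psi)// musE//.
    have -> : fk_flow eps alpha dt V b k mu phi = fk_flow eps alpha dt V b k mu psi.
      rewrite /fk_flow -/PU.
      have -> // : iter k PU phi = iter k PU psi.
      case: k k1 => [//|k _]; rewrite !iterSr; congr (iter k PU _).
      by apply/funext; exact: ae_inv.
    exact: HD.
move=> mu dO Omega P X0 G noise; rewrite LamE.
have := log_mass_cvg eps_gt0 dt_gt0 hA hB gap mu.
rewrite (_ : (fun k => _) = (fun k => k%:R^-1 * ln (fine
  'E_P[fk_weight eps alpha dt V b (em_chain eps alpha dt b X0 G) k]%E)))//.
apply/funext => k; congr (_ * ln _).
rewrite unlock /pairing /Rintegral.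
rewrite -(feynman_kac alpha eps_gt0 dt_gt0 hA hB noise k b1) => [|x]; last exact: ler01.
by congr fine; apply: eq_integral => w _; rewrite mulr1.
Qed.
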